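(* Let $n \ge 3$ and let $\mathcal Z : \mathrm{LC}_{sc}(\mathbb R^n) \to F(\mathbb R^n;\mathbb R)$ be a map. Then $\mathcal Z$ is a continuous and $\mathrm{SL}(n)$ contravariant valuation which satisfies $$\mathcal Z(\tau_y f)=e^{\ell_y}\,\mathcal Z(f),\qquad \mathcal Z(e^{-\ell_y}f)=\tau_y\mathcal Z(f)$$ for every $f\in \mathrm{LC}_{sc}(\mathbb R^n)$ and $y\in\mathbb R^n$, if and only if there are constants $c_1,c_2\in\mathbb R$ such that $$\mathcal Z f=\frac{c_1}{f^\circ}+c_2\,\mathcal L f$$ for every $f \in \mathrm{LC}_{sc}(\mathbb R^n)$.
   Context: $\mathrm{Conv}_{sc}(\mathbb R^n)$ is the set of all lower semi-continuous convex functions $u:\mathbb R^n\to\mathbb R\cup\{\infty\}$ that are proper ($u\not\equiv\infty$) and super-coercive ($\lim_{|x|\to\infty} u(x)/|x|=\infty$). $\mathrm{LC}_{sc}(\mathbb R^n)=\{e^{-u}:u\in \mathrm{Conv}_{sc}(\mathbb R^n)\}$ (with $e^{-\infty}=0$). $F(\mathbb R^n;\mathbb R)$ is the set of all functions $\mathbb R^n\to\mathbb R$. The Legendre transform is $u^\ast(x)=\sup_{y\in\mathbb R^n}(x\cdot y-u(y))$, and for $f=e^{-u}$ we set $f^\circ=e^{-u^\ast}$. The Laplace transform of $f$ is $\mathcal L f(x)=\int_{\mathbb R^n}e^{x\cdot y}f(y)\,dy$, $x\in\mathbb R^n$. $f\vee g$ and $f\wedge g$ denote pointwise maximum and minimum.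 $\mathcal Z$ is a valuation if $\mathcal Z(f\vee g)+\mathcal Z(f\wedge g)=\mathcal Z f+\mathcal Z g$ whenever $f,g,f\vee g,f\wedge g\in \mathrm{LC}_{sc}(\mathbb R^n)$. $\mathcal Z$ is continuous if hypo-convergence $f_i\to f$ in $\mathrm{LC}_{sc}(\mathbb R^n)$ implies $\mathcal Z f_i\to\mathcal Z f$ pointwise; hypo-convergence of $f_i$ to $f$ means that $u_i=-\log f_i$ epi-converges to $u=-\log f$, i.e. for every $x\in\mathbb R^n$, $u(x)\le\liminf_i u_i(x_i)$ for all $x_i\to x$, and there is a sequence $x_i\to x$ with $u(x)=\lim_i u_i(x_i)$. $\mathcal Z$ is $\mathrm{SL}(n)$ contravariant if $\mathcal Z(f\circ\phi^{-1})=(\mathcal Z f)\circ\phi^{t}$ for all $f$ and all $\phi\in \mathrm{SL}(n)$. For $y\in\mathbb R^n$, $\tau_y f(x)=f(x-y)$ and $\ell_y(x)=x\cdot y$. *)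

(* Defs.v *)
From HB Require Import structures.
From mathcomp Require Import all_boot all_order all_algebra.
From mathcomp Require Import all_classical all_reals all_analysis.
Set Implicit Arguments.
Unset Strict Implicit.
Unset Printing Implicit Defensive.

Import Order.TTheory GRing.Theory Num.Theory.
Import numFieldNormedType.Exports.
Local Open Scope classical_set_scope.
Local Open Scope ring_scope.

Definition measure_cV_display : measure_display -> measure_display.
Proof. exact. Qed.

Section measurable_cV.
Context {d} {T : measurableType d} {n : nat}.

(* As for the library's n.-tuple T, the sigma-algebra is the one generated by
   the coordinates: for T = R, it is the Borel sigma-algebra of R^n. *)
Let coors : 'I_n -> 'cV[T]_n -> T := fun i v => v i ord0.

Let cV_set0 : g_sigma_preimage coors set0.
Proof. exact: sigma_algebra0. Qed.

Let cV_setC A : g_sigma_preimage coors A -> g_sigma_preimage coors (~` A).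
Proof. exact: sigma_algebraC. Qed.

Let cV_bigcup (F : (set 'cV[T]_n)^nat) :
  (forall i, g_sigma_preimage coors (F i)) ->
  g_sigma_preimage coors (\bigcup_i (F i)).
Proof. exact: sigma_algebra_bigcup. Qed.

HB.instance Definition _ := @isMeasurable.Build (measure_cV_display d)
  'cV[T]_n (g_sigma_preimage coors) cV_set0 cV_setC cV_bigcup.

Lemma measurable_coor (i : 'I_n) :
  measurable_fun [set: 'cV[T]_n] (fun v => v i ord0).
Proof.
move=> _ Y mY; rewrite setTI; apply: sub_sigma_algebra => /=.
rewrite -bigcup_seq/=; exists i => /=; first by rewrite mem_index_enum.
by exists Y => //; rewrite setTI.
Qed.

Lemma measurable_fun_cVP d' (T' : measurableType d') (f : T' -> 'cV[T]_n) :
  (forall i, measurable_fun [set: T'] (fun x => f x i ord0)) ->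
  measurable_fun [set: T'] f.
Proof.
move=> mf; move=> _ Y mY; rewrite setTI.
suff : measurable `<=` [set A : set 'cV[T]_n | measurable (f @^-1` A)].
  by apply; exact: mY.
apply: smallest_sub; first split.
- by rewrite /= preimage_set0.
- by move=> A /= mA; rewrite setTD preimage_setC; exact: measurableC.
- by move=> F /= mF; rewrite preimage_bigcup; exact: bigcup_measurable.
rewrite -bigcup_seq; apply: bigcup_sub => i _ A [B mB <-] /=.
by rewrite setTI; move: (mf i measurableT B mB); rewrite setTI.
Qed.

End measurable_cV.

Section lebesgue_cV.
Context {R : realType}.
Local Notation mR := (measurableTypeR R).

Definition cons_cV n (p : mR * 'cV[mR]_n) : 'cV[mR]_n.+1 :=
  \col_i oapp (fun j => p.2 j ord0) p.1 (unlift ord0 i).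

Lemma measurable_cons_cV n : measurable_fun setT (@cons_cV n).
Proof.
apply: measurable_fun_cVP => i.
case: (unliftP ord0 i) => [j ->|->]; under eq_fun do rewrite mxE.
  rewrite liftK /=.
  by apply: (measurableT_comp (measurable_coor j)); exact: measurable_snd.
by rewrite unlift_none /=; exact: measurable_fst.
Qed.

Section step.
Context {n : nat} (mu : {sigma_finite_measure set 'cV[mR]_n -> \bar R}).

Definition lebesgue_cV_succ : set 'cV[mR]_n.+1 -> \bar R :=
  pushforward (lebesgue_measure \x mu)%E (@cons_cV n).

Let succ0 : lebesgue_cV_succ set0 = 0%E.
Proof. by rewrite /lebesgue_cV_succ /pushforward preimage_set0 measure0. Qed.

Let succ_ge0 A : (0 <= lebesgue_cV_succ A)%E.
Proof. by rewrite /lebesgue_cV_succ /pushforward measure_ge0. Qed.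

Let mcons A : measurable A -> measurable (@cons_cV n @^-1` A).
Proof.
by move=> mA; rewrite -[X in measurable X]setTI; exact: measurable_cons_cV.
Qed.

Let succ_sigma_additive : semi_sigma_additive lebesgue_cV_succ.
Proof.
move=> F mF tF mUF; rewrite /lebesgue_cV_succ /pushforward preimage_bigcup.
apply: measure_semi_sigma_additive.
- by move=> k; exact: mcons.
- apply/trivIsetP => /= i j _ _ ij; rewrite -preimage_setI.
  by move/trivIsetP : tF => /(_ _ _ _ _ ij) ->//; rewrite preimage_set0.
- by rewrite -preimage_bigcup; exact: mcons.
Qed.

HB.instance Definition _ := isMeasure.Build _ _ _ lebesgue_cV_succ
  succ0 succ_ge0 succ_sigma_additive.

Let uncons (v : 'cV[mR]_n.+1) : mR * 'cV[mR]_n :=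
  (v ord0 ord0, \col_j v (lift ord0 j) ord0).

Let cons_cVK : cancel (@cons_cV n) uncons.
Proof.
move=> [t v]; rewrite /uncons mxE unlift_none /=; congr (_, _).
by apply/matrixP => i j; rewrite !mxE liftK /= [j]ord1.
Qed.

Let muncons : measurable_fun setT uncons.
Proof.
apply: measurable_fun_pair => /=; first exact: measurable_coor.
by apply: measurable_fun_cVP => i; under eq_fun do rewrite mxE;
  exact: measurable_coor.
Qed.

Let succ_sigma_finite : sigma_finite setT lebesgue_cV_succ.
Proof.
have /sigma_finiteP[F [FT ndF Foo]] :=
  sigma_finiteT (@lebesgue_measure R : {sigma_finite_measure set mR -> \bar R}).
have /sigma_finiteP[G [GT ndG Goo]] := sigma_finiteT mu.
exists (fun k => uncons @^-1` (F k `*` G k)).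
  rewrite -preimage_bigcup (_ : \bigcup_k (F k `*` G k) = setT) //.
  rewrite -setXTT FT GT predeqE => -[x y]; split.
    by move=> [k _ []/= ? ?]; split; exists k.
  move=> [/= [k _ Fkx] [l _ Gly]]; exists (maxn k l) => //; split.
    by move: x Fkx; exact/subsetPset/ndF/leq_maxl.
  by move: y Gly; exact/subsetPset/ndG/leq_maxr.
move=> k; have [mF Fk] := Foo k; have [mG Gk] := Goo k; split.
  by rewrite -[X in measurable X]setTI; apply: muncons => //; exact: measurableX.
rewrite /lebesgue_cV_succ /pushforward -comp_preimage.
rewrite (_ : uncons \o _ = id); last by apply/funext => p /=; rewrite cons_cVK.
by rewrite preimage_id product_measure1E// lte_mul_pinfty// ge0_fin_numE.
Qed.

HB.instance Definition _ := Measure_isSigmaFinite.Build _ _ _ lebesgue_cV_succ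
  succ_sigma_finite.

End step.

Fixpoint lebesgue_cV n : {sigma_finite_measure set 'cV[mR]_n -> \bar R} :=
  match n with
  | 0 => @dirac _ 'cV[mR]_0 (0 : 'cV[R]_0) R
  | m.+1 => lebesgue_cV_succ (lebesgue_cV m)
  end.

(* This characterizes lebesgue_cV n as the n-dimensional Lebesgue measure. *)
Lemma lebesgue_cV_box n (A : 'I_n -> set mR) : (forall i, measurable (A i)) ->
  lebesgue_cV n [set v | forall i, A i (v i ord0)] =
  (\prod_(i < n) lebesgue_measure (A i))%E.
Proof.
elim: n A => [|n IH] A mA.
  by rewrite big_ord0 /= diracE mem_set //; case.
have mB : measurable [set v : 'cV[mR]_n | forall i, A (lift ord0 i) (v i ord0)].
  rewrite (_ : mkset _ = \bigcap_(i in [set: 'I_n])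
      ((fun v : 'cV[mR]_n => v i ord0) @^-1` A (lift ord0 i))).
    apply: fin_bigcap_measurable => // i _.
    rewrite -[X in measurable X]setTI.
    exact: (measurable_coor i measurableT (mA _)).
  by apply/seteqP; split=> v /= h i; [move=> _|]; exact: h.
rewrite big_ord_recl -IH // -product_measure1E //.
rewrite /= /lebesgue_cV_succ /pushforward; congr product_measure1.
apply/seteqP; split=> -[t v] /=.
  move=> h; split=> [|i]; first by have := h ord0; rewrite mxE unlift_none.
  by have := h (lift ord0 i); rewrite mxE liftK.
move=> [At Av] i; rewrite mxE.
by case: (unliftP ord0 i) => [j ->|->] //=; exact: Av.
Qed.

End lebesgue_cV.

Section functions.
Context {R : realType} {n : nat}.
Implicit Types (u : 'cV[R]_n -> \bar R) (f : 'cV[R]_n -> R) (x y : 'cV[R]_n).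

Definition dotv x y : R := \sum_(i < n) x i ord0 * y i ord0.

(* The norm `|x| that the library puts on matrices is the sup norm. *)
Definition enorm x : R := Num.sqrt (dotv x x).

Definition convex_ereal u := forall x y (t : R), 0 < t < 1 ->
  (u (t *: x + (1 - t) *: y)%R <= t%:E * u x + (1 - t)%R%:E * u y)%E.

Definition proper u := exists x, u x != +oo%E.

Definition supercoercive u := forall M : R, exists r : R, 0 < r /\
  forall x, r < enorm x -> (M%:E <= u x / (enorm x)%:E)%E.

Definition Conv_sc : set ('cV[R]_n -> \bar R) :=
  [set u | [/\ forall x, u x != -oo%E, lower_semicontinuous u,
               convex_ereal u, proper u & supercoercive u]].

(* e^{-u}, with e^{-oo} = 0 *)
Definition exp_neg u : 'cV[R]_n -> R := fun x => fine (expeR (- u x)).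

(* -log f, with -log 0 = +oo: the inverse of exp_neg, provided u > -oo *)
Definition neg_log f : 'cV[R]_n -> \bar R := fun x => (- lne (f x)%:E)%E.

Definition LC_sc : set ('cV[R]_n -> R) := [set exp_neg u | u in Conv_sc].

Definition legendre u : 'cV[R]_n -> \bar R :=
  fun x => ereal_sup [set ((dotv x y)%:E - u y)%E | y in setT].

Definition polar f : 'cV[R]_n -> R := exp_neg (legendre (neg_log f)).

Definition laplace f : 'cV[R]_n -> R :=
  fun x => \int[lebesgue_cV n]_y (expR (dotv x y) * f y).

Definition epi_converges (u_ : nat -> 'cV[R]_n -> \bar R) u := forall x,
  (forall x_ : nat -> 'cV[R]_n, x_ i @[i --> \oo] --> x ->
     (u x <= limn_einf (fun i => u_ i (x_ i)))%E) /\
  (exists2 x_ : nat -> 'cV[R]_n, x_ i @[i --> \oo] --> x &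
     u_ i (x_ i) @[i --> \oo] --> u x).

Definition hypo_converges (f_ : nat -> 'cV[R]_n -> R) f :=
  epi_converges (fun i => neg_log (f_ i)) (neg_log f).

Definition translate y f : 'cV[R]_n -> R := fun x => f (x - y).

End functions.

Section operators.
Context {R : realType} {n : nat}.

(* Operators on LC_sc are total functions; their values outside LC_sc are
   irrelevant. *)
Implicit Types Z : ('cV[R]_n -> R) -> ('cV[R]_n -> R).

Definition valuation Z := forall f g,
  LC_sc f -> LC_sc g -> LC_sc (f \max g) -> LC_sc (f \min g) ->
  Z (f \max g) \+ Z (f \min g) = Z f \+ Z g.

Definition hypo_continuous Z := forall (f_ : nat -> 'cV[R]_n -> R) f,
  (forall i, LC_sc (f_ i)) -> LC_sc f -> hypo_converges f_ f ->
  forall x, Z (f_ i) x @[i --> \oo] --> Z f x.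

Definition SL_contravariant Z := forall f (phi : 'M[R]_n),
  LC_sc f -> \det phi = 1 ->
  Z (f \o mulmx (invmx phi)) = Z f \o mulmx phi^T.

End operators.

(* Main.v *)
(* Evaluating at the origin turns Z into a functional z f = Z f 0 that is
   invariant under SL(n) and translations and commutes with positive scalars,
   with Z f x = z (y |-> e^{x.y} f y). The maximum and the integral of f are
   functionals of this kind, and they give rise to the two terms of the
   formula. Subtracting suitable multiples of them from z, one may assume
   that z vanishes on the indicators of a point and of one simplex, and has to
   show z = 0.

   If f is supported in a hyperplane, linear maps in SL(n) dilating this
   hyperplane concentrate f at a point, so z f = 0; hence z is additive under
   dissections of simplices. The value of z on e^a 1_T, with a affine and T a
   simplex, depends only on the vertex values of a and on |det T|; cutting T at
   an edge yields Cauchy's functional equation in |det T|, so the value is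
   proportional to |det T|. On a fine dissection according to the level sets of
   a, it is therefore a small multiple of the volume, and vanishes. Further cuts
   extend this to minima of finitely many affine functions, and such functions
   restricted to simplices approximate every f from above. *)

Require Import Defs.
From HB Require Import structures.
From mathcomp Require Import all_boot all_order all_algebra.
From mathcomp Require Import all_classical all_reals all_analysis.
From mathcomp Require Import perm measurable_realfun.
From mathcomp Require Import ring lra.
Set Implicit Arguments.
Unset Strict Implicit.
Unset Printing Implicit Defensive.
Import Order.TTheory GRing.Theory Num.Theory.
Import numFieldNormedType.Exports.
Local Open Scope classical_set_scope.
Local Open Scope ring_scope.

(** * Log-concave functions and hypo-convergence *)

(** Cutting an edge changes the vertex values of an affine function, so Cauchy's equation appears at
    first only when the values at the two ends of some edge agree; with three vertices at hand, the
    general case is a sum of two such cases. The equation is one in the signed determinant, which is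
    what SL(n) and translations preserve, and an exchange of two vertices with equal values removes
    the sign. Proportionality to the volume does not by itself give zero, because the factor depends
    on the vertex values; it vanishes at equal values, and its continuity there makes fine
    dissections effective. In the other direction, the obstacle is the continuity of the integral:
    hypo-convergence bounds the functions from above locally uniformly, but from below only along
    recovery sequences, which leaves the boundary of the support uncontrolled. Hence the two
    estimates are separate: the upper one is dominated convergence under a uniform exponential
    bound, the lower one uses a contraction towards an interior point of the support. *)

Lemma ereal_le_real {R : realType} (a b : \bar R) :
  (forall r : R, (r%:E < a)%E -> (r%:E <= b)%E) -> (a <= b)%E.
Proof.
case: a => [r| |] H; rewrite ?leNye//; case: b H => [s| |] H; rewrite ?leey//.
- rewrite lee_fin; apply/ler_addgt0Pr => e e0.
  have /H : ((r - e)%:E < r%:E)%E by rewrite lte_fin ltrBlDr ltrDl.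
  by rewrite lee_fin lerBlDr.
- by have /H : ((r - 1)%:E < r%:E)%E by rewrite lte_fin ltrBlDr ltrDl.
- have /H : ((s + 1)%:E < +oo)%E by exact: ltry.
  by rewrite lee_fin gerDl ler10.
- by have /H : ((0 : R)%:E < +oo)%E by exact: ltry.
Qed.

Lemma ereal_liminf_ge {R : realType} (u : nat -> \bar R) (b : \bar R) :
  (\forall i \near \oo, (b <= u i)%E) -> (b <= limn_einf u)%E.
Proof.
move=> [N _ H]; rewrite limn_einf_lim (cvg_lim _ (@cvg_einfs_sup _ u))//.
apply: le_trans (ereal_sup_ubound _); last by exists N.
by apply: le_ereal_inf_tmp => _ [k /= Nk <-]; exact: H.
Qed.

Lemma ereal_liminf_le {R : realType} (u : nat -> \bar R) (b : \bar R) :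
  (forall N, exists2 i, (N <= i)%N & (u i <= b)%E) -> (limn_einf u <= b)%E.
Proof.
move=> H; rewrite limn_einf_lim (cvg_lim _ (@cvg_einfs_sup _ u))//.
apply: ub_ereal_sup => _ [N _ <-]; have [i Ni ui] := H N.
by apply: le_trans ui; apply: ereal_inf_lbound; exists i.
Qed.

Section LogConcave.
Context {R : realType} {n : nat}.
Local Notation V := 'cV[R]_n.
Implicit Types (f g : V -> R) (x y z : V).

Lemma coord_le_norm x i : `|x i ord0| <= `|x|.
Proof.
rewrite [leRHS]/Num.norm /= mx_normrE.
by apply: le_trans (le_bigmax_cond _ _ (_ : xpredT (i, ord0))).
Qed.

Lemma norm_le_coord x c : 0 <= c -> (forall i, `|x i ord0| <= c) -> `|x| <= c.
Proof.
move=> c0 H; rewrite [leLHS]/Num.norm /= mx_normrE.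
by apply/bigmax_leP; split=> // -[i j] _ /=; rewrite (ord1 j).
Qed.

Lemma enorm_ge0 x : 0 <= enorm x. Proof. exact: sqrtr_ge0. Qed.

Lemma norm_le_enorm x : `|x| <= enorm x.
Proof.
apply: norm_le_coord (enorm_ge0 x) _ => i.
rewrite -sqrtr_sqr ler_sqrt; last first.
  by apply: sumr_ge0 => j _; rewrite -expr2 sqr_ge0.
rewrite /dotv (bigD1 i)//= -expr2 lerDl.
by apply: sumr_ge0 => j _; rewrite -expr2 sqr_ge0.
Qed.

Lemma enorm_le_norm x : enorm x <= n.+1%:R * `|x|.
Proof.
rewrite -[leRHS]ger0_norm ?mulr_ge0// -sqrtr_sqr ler_sqrt ?sqr_ge0//.
apply: (@le_trans _ _ (\sum_(i < n) `|x| ^+ 2)).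
  apply: ler_sum => i _; rewrite -expr2 -real_normK ?num_real//.
  by rewrite lerXn2r ?nnegrE//; exact: coord_le_norm.
rewrite sumr_const cardT size_enum_ord -[leLHS]mulr_natl exprMn.
apply: ler_wpM2r; first exact: sqr_ge0.
rewrite (@le_trans _ _ n.+1%:R)// ?ler_nat// -natrX ler_nat expnS.
by rewrite leq_pmulr.
Qed.

(** Lower bounds of the form [expR a] avoid [log 0] and real powers: points where [f] vanishes
    impose no condition. *)
Definition logconcave f := forall x y a b t, 0 < t < 1 ->
  expR a <= f x -> expR b <= f y ->
  expR (t * a + (1 - t) * b) <= f (t *: x + (1 - t) *: y).

Definition usc f := forall x c, f x < c -> \forall z \near x, f z < c.

(** Super-coercivity of [- log f], expressed in the sup norm, which is equivalent to [enorm]. *)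
Definition decaying f := forall M, exists r, forall x,
  r < `|x| -> f x <= expR (- (M * `|x|)).

(** The part of [LC] that exponentials of continuous concave functions satisfy as well, although
    these need not decay. *)
Record logconcave_usc f : Prop := LogconcaveUsc {
  lcu_ge0 : forall x, 0 <= f x;
  lcu_concave : logconcave f;
  lcu_usc : usc f }.

Record LC f : Prop := MkLC {
  LC_lcu :> logconcave_usc f;
  LC_pos : exists x, 0 < f x;
  LC_decay : decaying f }.

Lemma exp_neg_geE (u : V -> \bar R) x a : u x != -oo%E ->
  (expR a <= exp_neg u x) = (u x <= (- a)%:E)%E.
Proof.
rewrite /exp_neg; case: (u x) => [r| |]//= _; last first.
  by rewrite leNgt expR_gt0 leNgt ltry.
by rewrite ler_expR lee_fin lerNr.
Qed.

Lemma exp_neg_ltE (u : V -> \bar R) x a : u x != -oo%E ->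
  (exp_neg u x < expR a) = ((- a)%:E < u x)%E.
Proof. by move=> ux; rewrite ltNge exp_neg_geE// ltNge. Qed.

Lemma exp_neg_leE (u : V -> \bar R) x a : u x != -oo%E ->
  (exp_neg u x <= expR a) = ((- a)%:E <= u x)%E.
Proof.
rewrite /exp_neg; case: (u x) => [r| |]//= _; last by rewrite expR_ge0 leey.
by rewrite ler_expR lee_fin lerNl.
Qed.

Lemma exp_neg_ge0 (u : V -> \bar R) x : 0 <= exp_neg u x.
Proof. by apply: fine_ge0; exact: expeR_ge0. Qed.

Lemma neg_log_neqNy f x : neg_log f x != -oo%E.
Proof. by rewrite /neg_log /lne; case: ifP. Qed.

Lemma neg_logK f : (forall x, 0 <= f x) -> exp_neg (neg_log f) = f.
Proof.
move=> f0; apply/funext => x; rewrite /exp_neg /neg_log oppeK.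
by have /eqP -> : expeR (lne (f x)%:E) == (f x)%:E by rewrite lneK_eq lee_fin.
Qed.

Lemma neg_log_leE f x a : (forall x, 0 <= f x) ->
  (neg_log f x <= a%:E)%E = (expR (- a) <= f x).
Proof.
move=> f0; rewrite -{2}(neg_logK f0) exp_neg_geE ?neg_log_neqNy//.
by rewrite opprK.
Qed.

Lemma neg_log_gtE f x a : (forall x, 0 <= f x) ->
  (a%:E < neg_log f x)%E = (f x < expR (- a)).
Proof. by move=> f0; rewrite ltNge neg_log_leE// -ltNge. Qed.

Lemma neg_log_pos f x : 0 < f x -> neg_log f x = (- ln (f x))%:E.
Proof. by move=> fx; rewrite /neg_log lne_EFin. Qed.

Lemma neg_log_zero f x : f x <= 0 -> neg_log f x = +oo%E.
Proof. by move=> fx; rewrite /neg_log le0_lneNy. Qed.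

Lemma LC_scP f : LC_sc f <-> LC f.
Proof.
split=> [[u [uNy ulsc ucvx [x0 ux0] ucoe] <-]|[[f0 flc fusc] [x0 fx0] fdec]].
  split; first split.
  - exact: exp_neg_ge0.
  - move=> x y a b t t01; rewrite !exp_neg_geE// => ua ub.
    move: (t01) => /andP[t0 t1]; apply: le_trans (ucvx x y t t01) _.
    have -> : (- (t * a + (1 - t) * b))%:E =
        (t%:E * (- a)%:E + (1 - t)%:E * (- b)%:E)%E.
      by rewrite -!EFinM -EFinD; congr (_%:E); ring.
    by rewrite leeD ?lee_wpmul2l// lee_fin ltW// subr_gt0.
  - move=> x c fc; have c0 : 0 < c by apply: le_lt_trans fc; exact: exp_neg_ge0.
    move: fc; rewrite -(lnK c0) exp_neg_ltE// => /ulsc[W Wx HW].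
    by near=> z; rewrite exp_neg_ltE//; apply: HW; near: z.
  - exists x0; apply: (@lt_le_trans _ _ (expR (- fine (u x0)))).
      exact: expR_gt0.
    by rewrite exp_neg_geE// opprK fineK// fin_numE uNy.
  (* The passage from [enorm x] to the smaller sup norm needs a non-negative factor, hence the
     absolute value of [M]. *)
  - move=> M; have [r [r0 H]] := ucoe `|M|; exists r => x rx.
    have rx' := lt_le_trans rx (norm_le_enorm x).
    have e0 : 0 < enorm x by apply: lt_trans rx'.
    rewrite exp_neg_leE// opprK.
    have := H _ rx'; rewrite inver gt_eqF//= lee_pdivlMr// => /(le_trans _); apply.
    rewrite -EFinM lee_fin; apply: (@le_trans _ _ (`|M| * `|x|)).
      by rewrite ler_wpM2r// ler_norm.
    by rewrite ler_wpM2l// norm_le_enorm.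
exists (neg_log f); last exact: neg_logK.
split.
- by move=> x; exact: neg_log_neqNy.
- move=> x a; rewrite neg_log_gtE// => /fusc fa; exists [set z | f z < expR (- a)] => //.
  by move=> y /=; rewrite neg_log_gtE.
- move=> x y t t01; have /andP[t0 t1] := t01.
  have t1' : 0 < 1 - t by rewrite subr_gt0.
  have [fx|fx] := leP (f x) 0.
    rewrite (neg_log_zero fx) mulry gtr0_sg// mul1e addye ?leey//.
    have [fy|fy] := leP (f y) 0; last by rewrite neg_log_pos.
    by rewrite (neg_log_zero fy) mulry gtr0_sg// mul1e.
  have [fy|fy] := leP (f y) 0.
    by rewrite (neg_log_zero fy) mulry gtr0_sg// mul1e (neg_log_pos fx)
      -EFinM addey// leey.
  rewrite (neg_log_pos fx) (neg_log_pos fy) -!EFinM -EFinD neg_log_leE//.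
  by rewrite opprD -!mulrN !opprK flc// lnK.
- by exists x0; rewrite neg_log_pos.
(* The factor [n.+1] is the constant of [enorm_le_norm]; it is positive also in dimension 0. *)
- move=> M; have [r H] := fdec (`|M| * n.+1%:R).
  exists (n.+1%:R * (`|r| + 1)); split; first by rewrite mulr_gt0// ltr_wpDl.
  move=> x rx; have e0 : 0 < enorm x.
    by apply: le_lt_trans rx; rewrite mulr_ge0// addr_ge0.
  rewrite inver gt_eqF//= lee_pdivlMr// -EFinM.
  apply: (@le_trans _ _ (`|M| * n.+1%:R * `|x|)%:E).
    rewrite lee_fin -mulrA (@le_trans _ _ (`|M| * enorm x))//.
      by apply: ler_wpM2r; [exact: ltW|exact: ler_norm].
    by apply: ler_wpM2l; [|exact: enorm_le_norm].
  have rx' : r < `|x|.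
    have := lt_le_trans rx (enorm_le_norm x); rewrite ltr_pM2l//.
    apply: le_lt_trans; rewrite (le_trans (ler_norm r))// lerDl//.
  rewrite leNgt; apply/negP => abs; have := H _ rx'.
  move: abs; set K := `|M| * _ * _; have [fx|fx] := leP (f x) 0.
    by rewrite neg_log_zero.
  rewrite neg_log_pos// lte_fin ltrNl => abs.
  by rewrite leNgt -[X in _ < X](lnK fx) ltr_expR abs.
Unshelve. all: by end_near.
Qed.

Lemma cvg_neg_log (a : nat -> R) (l : R) : (forall i, 0 <= a i) -> 0 <= l ->
  (a @ \oo --> l) <->
  ((fun i => - lne (a i)%:E)%E @ \oo --> (- lne l%:E)%E).
Proof.
move=> a0; rewrite le_eqVlt => /predU1P[<-|l0].
  have -> : (- lne (0 : R)%:E)%E = +oo%E :> \bar R by rewrite le0_lneNy.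
  split=> [al|al].
    apply/cvgeyPge => A; have := @expR_gt0 _ (- A).
    move=> /(cvgr_lt _ al); apply: filterS => i ai.
    have [ai0|ai0] := leP (a i) 0; first by rewrite le0_lneNy// leey.
    by rewrite lne_EFin// lee_fin lerNr -ler_expR lnK// ltW.
  apply/cvgrPdist_lt => e e0; move/cvgeyPgt : al => /(_ (- ln e)).
  apply: filterS => i; rewrite sub0r normrN ger0_norm//.
  have [ai0|ai0] := leP (a i) 0; first by move=> _; exact: le_lt_trans e0.
  by rewrite lne_EFin// lte_fin ltrN2 ltr_ln.
rewrite lne_EFin//; split=> [al|al].
  have : (- ln (a i))%:E @[i --> \oo] --> (- ln l)%:E.
    apply: cvg_EFin; first by near=> i.
    apply: cvgN; apply: continuous_cvg => //.
    exact: continuous_ln.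
  apply: cvg_trans; apply: near_eq_cvg; near=> i.
  rewrite lne_EFin//; near: i; exact: cvgr_gt al _ l0.
have H : \forall i \near \oo, 0 < a i.
  near=> i; rewrite lt_neqAle a0 andbT eq_sym; apply/negP => /eqP ai.
  have : ((- lne (a i)%:E) < (- ln l + 1)%:E)%E.
    near: i; move/fine_cvgP : (al) => [fa fl].
    near=> i; have fai : ((- lne (a i)%:E)%E \is a fin_num) by near: i.
    rewrite -(fineK fai) lte_fin; near: i.
    by apply: (cvgr_lt _ fl); rewrite ltrDl.
  by rewrite ai le0_lneNy.
move/fine_cvgP : (al) => [fa fl].
have : expR (- fine (- lne (a i)%:E)%E) @[i --> \oo] --> expR (- - ln l).
  apply: continuous_cvg; first exact: continuous_expR.
  exact: cvgN.
rewrite opprK lnK//; apply: cvg_trans; apply: near_eq_cvg; near=> i.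
have ai : 0 < a i by near: i.
by rewrite lne_EFin//= opprK lnK.
Unshelve. all: by end_near.
Qed.


(** Hypo-convergence without logarithms. The liminf inequality along sequences becomes an upper
    bound valid on a neighbourhood and for all large indices at once, the form that compactness
    arguments take. *)
Definition hypo (f_ : nat -> V -> R) f :=
  (forall x c, f x < c -> \forall z \near x & i \near \oo, f_ i z < c) /\
  (forall x, exists2 x_ : nat -> V, x_ @ \oo --> x &
    f_ i (x_ i) @[i --> \oo] --> f x).

(* The recovery sequences of bad points are assembled along a strictly
   increasing sequence of indices, and completed by the constant x. *)
Lemma sequential_limsup (f_ : nat -> V -> R) x c :
  (forall x_ : nat -> V, x_ @ \oo --> x ->
     exists N, forall i, (N <= i)%N -> f_ i (x_ i) < c) ->
  \forall z \near x & i \near \oo, f_ i z < c.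
Proof.
move=> H; apply: contrapT => nH.
have bad k N : exists iz : nat * V,
    [/\ (N <= iz.1)%N, ball x k.+1%:R^-1 iz.2 & c <= f_ iz.1 iz.2].
  apply: contrapT => nE; apply: nH.
  exists (ball x k.+1%:R^-1, [set i | (N <= i)%N]).
    by split; [exact: nbhsx_ballx|exists N].
  move=> [z i] [/= zx Ni]; rewrite ltNge; apply/negP => cf; apply: nE.
  by exists (i, z).
have [g Hg] := @boolp.choice _ _ (fun kN iz => [/\ (kN.2 <= iz.1)%N,
  ball x kN.1.+1%:R^-1 iz.2 & c <= f_ iz.1 iz.2]) (fun kN => bad kN.1 kN.2).
pose fix h k := if k is k'.+1 then g (k'.+1, (h k').1.+1) else g (0%N, 0%N).
have hP k : ball x k.+1%:R^-1 (h k).2 /\ c <= f_ (h k).1 (h k).2.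
  by case: k => [|k] /=; [have [] := Hg (0, 0)%N|
    have [] := Hg (k.+1, (h k).1.+1)].
have h_lt k : ((h k).1 < (h k.+1).1)%N.
  by have [] := Hg (k.+1, (h k).1.+1).
have h_mono k l : (k <= l)%N -> ((h k).1 <= (h l).1)%N.
  elim: l => [|l IH]; first by rewrite leqn0 => /eqP ->.
  rewrite leq_eqVlt ltnS => /predU1P[->//|/IH kl].
  exact: leq_trans kl (ltnW (h_lt l)).
have h_ge k : (k <= (h k).1)%N.
  by elim: k => // k IH; exact: leq_ltn_trans IH (h_lt k).
pose x_ i := if pselect (exists k, i = (h k).1) is left e
  then (h (projT1 (cid e))).2 else x.
have x_h k : exists2 l, (h l).1 = (h k).1 & x_ (h k).1 = (h l).2.
  rewrite /x_; case: pselect => [e|]; last by case; exists k.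
  by case: cid => l /= ->; exists l.
have [] := H x_; last first.
  move=> N /(_ (h N).1 (h_ge N)); have [l lN ->] := x_h N.
  by rewrite -lN ltNge (hP l).2.
apply/cvg_ballP => e e0.
have [k ke] : exists k, k.+1%:R^-1 < e.
  have [k _ Hk] := near_infty_natSinv_lt (PosNum e0).
  by exists k; exact: Hk (leqnn k).
near=> i; rewrite /x_; case: pselect => [e'|_]; last exact: ballxx.
case: cid => l /= il.
apply: le_ball (hP l).1; apply: le_trans (ltW ke).
rewrite lef_pV2 ?posrE// ler_nat ltnS leqNgt; apply/negP => lk.
have : ((h k).1 <= i)%N by near: i; exists (h k).1.
rewrite il; apply/negP; rewrite -ltnNge.
exact: leq_trans (h_lt l) (h_mono _ _ lk).
Unshelve. all: by end_near.
Qed.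

Lemma hypo_convergesP (f_ : nat -> V -> R) f :
  (forall i x, 0 <= f_ i x) -> (forall x, 0 <= f x) ->
  hypo_converges f_ f <-> hypo f_ f.
Proof.
move=> f_0 f0; split=> [H|[Hsup Hrec] x]; last first.
  split; last first.
    have [x_ x_x fx] := Hrec x; exists x_ => //.
    exact: (cvg_neg_log (fun i => f_0 i (x_ i)) (f0 x)).1.
  move=> x_ x_x; apply: ereal_le_real => r; rewrite neg_log_gtE// => fr.
  apply: ereal_liminf_ge; have [[U W] [/= Ux Woo] UW] := Hsup _ _ fr.
  near=> i; apply/ltW; rewrite neg_log_gtE//; apply: (UW (x_ i, i)).
  by split => /=; near: i => //; exact: x_x.
split=> x.
  move=> c fxc; apply: sequential_limsup => x_ x_x.
  have c0 : 0 < c by exact: le_lt_trans fxc.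
  apply: contrapT => nN; have := (H x).1 _ x_x.
  apply/negP; rewrite -ltNge; apply: (@le_lt_trans _ _ (- ln c)%:E).
    apply: ereal_liminf_le => N; apply: contrapT => nE; apply: nN.
    exists N => i Ni; rewrite ltNge; apply/negP => cf; apply: nE.
    by exists i => //; rewrite neg_log_leE// opprK lnK.
  by rewrite neg_log_gtE// opprK lnK.
have [_ [x_ x_x fx]] := H x; exists x_ => //.
exact: (cvg_neg_log (fun i => f_0 i (x_ i)) (f0 x)).2.
Unshelve. all: by end_near.
Qed.

End LogConcave.

(** * Compactness and uniform decay *)

Section Topology.
Context {R : realType} {n : nat}.
Local Notation V := 'cV[R]_n.
Implicit Types (f g : V -> R) (x y z p : V).

Lemma cvg_cV {T : Type} (F : set_system T) {FF : Filter F} m (g : T -> 'cV[R]_m)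
    (l : 'cV[R]_m) :
  (forall i, g t i ord0 @[t --> F] --> l i ord0) -> g @ F --> l.
Proof.
move=> H; apply/cvgrPdist_le => e e0.
have : \forall t \near F, forall i, `|l i ord0 - g t i ord0| <= e.
  by apply: filter_forall => i; move/cvgrPdist_le : (H i); exact.
apply: filterS => t Ht; apply: norm_le_coord; first exact: ltW.
by move=> i; rewrite !mxE; exact: Ht.
Qed.

Lemma cvg_coord {T : Type} (F : set_system T) {FF : Filter F} m
    (g : T -> 'cV[R]_m) (l : 'cV[R]_m) i :
  g @ F --> l -> g t i ord0 @[t --> F] --> l i ord0.
Proof.
move=> gl; apply: (cvg_comp _ (fun v : 'cV[R]_m => v i ord0) gl).
exact: coord_continuous.
Qed.

Lemma norm_mulmx_le m (A : 'M[R]_(m, n)) x :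
  `|A *m x| <= (\sum_i \sum_j `|A i j|) * `|x|.
Proof.
have s0 i : 0 <= \sum_j `|A i j| by exact: sumr_ge0.
apply: norm_le_coord; first by rewrite mulr_ge0// sumr_ge0.
move=> i; rewrite mxE (le_trans (ler_norm_sum _ _ _))//.
apply: (@le_trans _ _ ((\sum_j `|A i j|) * `|x|)); last first.
  by rewrite ler_wpM2r// (bigD1 i)//= lerDl sumr_ge0.
rewrite mulr_suml; apply: ler_sum => j _.
by rewrite normrM ler_wpM2l// coord_le_norm.
Qed.

Lemma cvg_mulmx {T : Type} (F : set_system T) {FF : Filter F} m
    (A : 'M[R]_(m, n)) (g : T -> V) (l : V) :
  g @ F --> l -> A *m g t @[t --> F] --> A *m l.
Proof.
move=> gl; apply: cvg_cV => i; rewrite mxE; under eq_fun do rewrite mxE.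
apply: cvg_big => [|j _]; first exact: add_continuous.
by apply: cvgM; [exact: cvg_cst|exact: cvg_coord].
Qed.

Lemma mulmx_continuous m (A : 'M[R]_(m, n)) : continuous (fun x : V => A *m x).
Proof. by move=> x; apply: (@cvg_mulmx _ (nbhs x)); exact: cvg_id. Qed.

Lemma closed_fun_ge (h : V -> R) c : continuous h -> closed [set x | c <= h x].
Proof.
move=> ch; have := @closed_comp _ _ h [set y | c <= y]; apply.
  by move=> x _; exact: ch.
exact: closed_ge.
Qed.

(** [bounded_closed_compact] concerns row vectors, hence the transposition. *)
Lemma compact_norm_le p r : compact [set x : V | `|x - p| <= r].
Proof.
pose K : set 'rV[R]_n := [set v | `|v - p^T| <= r].
have -> : [set x : V | `|x - p| <= r] = trmx @` K.
  have nT m k (A : 'M[R]_(m, k)) : `|A^T| = `|A|.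
    have le m' k' (B : 'M[R]_(m', k')) : `|B^T| <= `|B|.
      rewrite [leLHS]/Num.norm [leRHS]/Num.norm /= !mx_normrE.
      apply/bigmax_leP; split=> [|[i j] _ /=]; first exact: bigmax_ge_id.
      by rewrite mxE; apply: (le_bigmax_cond _ _ (_ : xpredT (j, i))).
    by apply/eqP; rewrite eq_le le/= -{1}(trmxK A) le.
  apply/seteqP; split=> [x /= H|_ [v /= H <-]].
    by exists x^T; rewrite ?trmxK// /K /= -linearB nT.
  by rewrite -[p]trmxK -linearB nT.
apply: continuous_compact.
  apply: continuous_subspaceT => v; apply: (@cvg_cV _ (nbhs v)) => i.
  rewrite mxE; under eq_fun do rewrite mxE; exact: coord_continuous.
apply: bounded_closed_compact.
  exists (`|p^T| + r); split; first exact: num_real.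
  move=> M HM v /= Kv; apply: le_trans (ltW HM).
  rewrite -[v](subrK p^T) (le_trans (ler_normD _ _))// addrC lerD2l//.
rewrite (_ : K = closed_ball_ Num.norm p^T r); first exact: closed_closed_ball_.
by apply/seteqP; split=> v; rewrite /K /closed_ball_ /= distrC.
Qed.

(** The first half of [hypo]. For a constant sequence it is upper semicontinuity ([usc_hypo_sup]),
    so that one lemma on products serves both for convergence and for regularity. *)
Definition hypo_sup (f_ : nat -> V -> R) f :=
  forall x c, f x < c -> \forall z \near x & i \near \oo, f_ i z < c.

Lemma usc_hypo_sup f : usc f <-> hypo_sup (fun=> f) f.
Proof.
split=> H x c fxc.
  exists ([set z | f z < c], setT); last by move=> [z i] [].
  by split; [exact: H|exact: filterT].
have [[U W] /= [Ux [N _ NW]] UW] := H _ _ fxc.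
by apply: filterS Ux => z Uz; apply: (UW (z, N)); split=> //; apply: NW => /=.
Qed.

Lemma usc_hypo f : usc f -> hypo (fun=> f) f.
Proof.
move=> /usc_hypo_sup H; split=> // x; exists (fun=> x); exact: cvg_cst.
Qed.

Lemma hypo_sup_compact (f_ : nat -> V -> R) f (K : set V) c :
  hypo_sup f_ f -> compact K -> (forall x, K x -> f x < c) ->
  \forall i \near \oo, forall x, K x -> f_ i x < c.
Proof.
move=> fs /compact_near_coveringP cK Kc.
have := cK nat \oo (fun i x => f_ i x < c) _ (fun x Kx => fs x c (Kc x Kx)).
move=> /(_ _); apply: filterS => i H x Kx; exact: H.
Qed.

Lemma usc_compact_lt f (K : set V) c : usc f -> compact K ->
  (forall x, K x -> f x < c) -> exists2 d, d < c & forall x, K x -> f x <= d.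
Proof.
move=> uf /compact_near_coveringP cK Kc.
have : \forall k \near \oo, K `<=` (fun x => f x < c - k.+1%:R^-1).
  apply: cK => x Kx; have fxc := Kc _ Kx.
  pose c' := (f x + c) / 2.
  have fc' : f x < c' by rewrite /c' midf_lt.
  have c'c : c' < c by rewrite /c' midf_lt.
  exists ([set z | f z < c'], [set k | k.+1%:R^-1 < c - c']).
    split; first exact: uf.
    have c0 : 0 < c - c' by rewrite subr_gt0.
    exact: (near_infty_natSinv_lt (PosNum c0)).
  move=> [z k] [/= fz kc]; apply: lt_trans fz _.
  by rewrite ltrBrDr addrC -ltrBrDr.
move=> [k _ /(_ k (leqnn k)) H]; exists (c - k.+1%:R^-1).
  by rewrite gtrBl.
by move=> x Kx; exact/ltW/H.
Qed.

Lemma usc_bounded f (K : set V) : usc f -> compact K ->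
  exists2 c, 0 < c & forall x, K x -> f x < c.
Proof.
move=> uf /compact_near_coveringP cK.
have : \forall k \near \oo, K `<=` (fun x => f x < k.+1%:R).
  apply: cK => x Kx.
  exists ([set z | f z < `|f x| + 1], [set k | `|f x| + 1 <= k.+1%:R]).
    split; first by apply: uf; rewrite (le_lt_trans (ler_norm _))// ltrDl.
    exists (Num.truncn (`|f x| + 1)) => // k /= hk.
    rewrite ltW// (lt_le_trans (truncnS_gt _))// ler_nat.
    by rewrite ltnS.
  by move=> [z k] [/= fz kc]; exact: lt_le_trans fz kc.
move=> [k _ /(_ k (leqnn k)) H]; exists k.+1%:R => //.
Qed.

Lemma usc_max f : (forall x, 0 <= f x) -> usc f -> (exists x, 0 < f x) ->
  decaying f -> exists p, 0 < f p /\ forall x, f x <= f p.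
Proof.
move=> f0 uf [q fq] df; have [r Hr] := df 1.
(* Beyond [r'] the decay bound is already below [f q], so the maximum is sought in a ball. *)
pose r' := Num.max r (- ln (f q)).
have far x : r' < `|x| -> f x < f q.
  rewrite /r' gt_max => /andP[/Hr fx h]; apply: le_lt_trans fx _.
  by rewrite mul1r -[ltRHS]lnK// ltr_expR ltrNl.
pose K := [set x : V | `|x - 0| <= r'].
have uK : compact K by exact: compact_norm_le.
have Kq : K q by rewrite /K /= subr0 leNgt; apply/negP => /far; rewrite ltxx.
have [c c0 Kc] := usc_bounded uf uK.
have hs : has_sup [set f x | x in K].
  split; first by exists (f q), q.
  by exists c => _ [x Kx <-]; exact/ltW/Kc.
pose S := sup [set f x | x in K].
have fS x : K x -> f x <= S by move=> Kx; apply: sup_upper_bound => //; exists x.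
have [p Kp fp] : exists2 p, K p & S <= f p.
  apply: contrapT => nE.
  have [d dS Kd] : exists2 d, d < S & forall x, K x -> f x <= d.
    apply: usc_compact_lt => // x Kx; rewrite ltNge; apply/negP => Sf.
    by apply: nE; exists x.
  suff : S <= d by rewrite leNgt dS.
  by apply: sup_le_ub; [exists (f q), q|move=> _ [x Kx <-]; exact: Kd].
have qp : f q <= f p by apply: le_trans fp; exact: fS.
exists p; split; first exact: lt_le_trans qp.
move=> x; have [Kx|/negP] := pselect (K x).
  by apply: le_trans fp; exact: fS.
by rewrite /K /= subr0 -ltNge => /far/ltW/le_trans; apply.
Qed.

Lemma LC_max f : LC f -> exists p, 0 < f p /\ forall x, f x <= f p.
Proof. by case=> -[f0 _ fu] fp fd; exact: usc_max. Qed.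

(* Beyond a sphere around the recovery points of a point of positivity, the
   decay is forced by log-concavity along segments from these points. *)
Lemma uniform_decay (f_ : nat -> V -> R) f M :
  (forall i, logconcave_usc (f_ i)) -> LC f -> hypo f_ f ->
  exists2 C, 0 < C & \forall i \near \oo,
    forall x, f_ i x <= C * expR (- (M * `|x|)).
Proof.
move=> fc; wlog M0 : M / 0 <= M.
  move=> H Lf hf; have [C C0 HC] := H `|M| (normr_ge0 M) Lf hf.
  exists C => //; apply: filterS HC => i HC x; apply: le_trans (HC x) _.
  by rewrite ler_pM2l// ler_expR lerN2 ler_wpM2r// ler_norm.
move=> [[f0 flc fu] [p fp] fd] [hs hr].
have [x_ x_p fx_] := hr p.
pose a := ln (f p) - 1.
have af : expR a < f p by rewrite -[ltRHS]lnK// ltr_expR gtrBl.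
have [r0 Hr0] := fd (M + 1).
(* Here [b] is the exponent reached at distance [r] when starting from [a] and falling at rate [M].
   As [f] decays at rate [M + 1], there is a surplus growing with the radius, and [r] is so large
   that [f] lies below [expR b] on the shell [S]. *)
pose r := (M + 1) * (1 + `|p|) + `|a| + `|r0| + `|p| + 2.
pose b := a - M * r.
have Mp : 0 <= (M + 1) * (1 + `|p|) by rewrite mulr_ge0// addr_ge0.
have r_gt0 : 0 < r by rewrite /r ltr_wpDl// !addr_ge0.
pose B := [set x : V | `|x - p| <= r + 1].
have cB : compact B by exact: compact_norm_le.
(* The sphere is thickened by 1 on both sides because it will be centred at the recovery points,
   which are only within distance 1 of [p]. *)
pose S := B `&` [set x : V | r - 1 <= `|x - p|].
have cS : compact S.
  apply: (subclosed_compact _ cB); last by move=> x [].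
  apply: closedI; first exact: (compact_closed (@norm_hausdorff _ _) cB).
  apply: (@closed_fun_ge (fun x : V => `|x - p|)).
  move=> x; apply: (@cvg_norm _ _ _ (nbhs x)).
  by apply: (@cvgB _ _ _ (nbhs x) _ id (cst p)); [exact: cvg_id|exact: cvg_cst].
have Sb x : S x -> f x < expR b.
  move=> [_ /= rx].
  have xr : r - 1 - `|p| <= `|x|.
    rewrite lerBlDr (le_trans rx)//; exact: ler_normB.
  have r0x : r0 < `|x|.
    apply: lt_le_trans xr; rewrite /r; have := ler_norm r0; have := normr_ge0 a.
    by lra.
  apply: le_lt_trans (Hr0 _ r0x) _; rewrite ltr_expR /b.
  have := ler_wpM2l (_ : 0 <= M + 1) xr; rewrite addr_ge0// => /(_ isT).
  have := ler_norm (- a); rewrite normrN.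
  have := normr_ge0 r0; have := normr_ge0 p.
  have : r - (M + 1) * (1 + `|p|) = `|a| + `|r0| + `|p| + 2 by rewrite /r; ring.
  by lra.
have [c c0 Bc] := usc_bounded fu cB.
have ES := hypo_sup_compact hs cS Sb.
have EB := hypo_sup_compact hs cB Bc.
exists (c * expR (M * (`|p| + r + 1)) + expR (a + M * (`|p| + 1))).
  by rewrite addr_gt0 ?expR_gt0// mulr_gt0 ?expR_gt0.
near=> i => x.
have fi0 y : 0 <= f_ i y by case: (fc i).
have filc : logconcave (f_ i) by case: (fc i).
have ax : expR a <= f_ i (x_ i).
  by apply/ltW; near: i; exact: cvgr_gt fx_ _ af.
have xp : `|x_ i - p| <= 1.
  by near: i; move/cvgr_distC_le : x_p; apply.
have [xr|xr] := leP (`|x - x_ i|) r.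
  have Bx : B x.
    have := ler_normD (x - x_ i) (x_ i - p); rewrite addrA subrK.
    by rewrite /B /=; lra.
  have fx : f_ i x < c by move: x Bx {xr}; near: i.
  apply: (@le_trans _ _ (c * expR (M * (`|p| + r + 1)) * expR (- (M * `|x|)))).
    apply: (le_trans (ltW fx)); rewrite -mulrA; apply: ler_peMr; first exact: ltW.
    rewrite -expRD -[leLHS]expR0 ler_expR subr_ge0 ler_wpM2l//.
    have := ler_normD (x - p) p; rewrite subrK.
    by move: Bx; rewrite /B /=; lra.
  by rewrite ler_wpM2r ?expR_ge0// lerDl expR_ge0.
have [fx|fx] := leP (f_ i x) 0.
  apply: le_trans fx _; rewrite mulr_ge0 ?expR_ge0// addr_ge0 ?expR_ge0//.
  by rewrite mulr_ge0 ?expR_ge0// ltW.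
pose s := `|x - x_ i|; pose t := r / s; pose z := t *: x + (1 - t) *: x_ i.
have s0 : 0 < s by exact: lt_trans xr.
have t01 : 0 < t < 1 by rewrite /t divr_gt0//= ltr_pdivrMr// mul1r.
have zx : z - x_ i = t *: (x - x_ i).
  by apply/matrixP => k l; rewrite /z !mxE; ring.
have nz : `|z - x_ i| = r.
  rewrite zx normrZ gtr0_norm; last by case/andP: t01.
  by rewrite -/s /t divfK// gt_eqF.
have Sz : S z.
  split; rewrite /B /=.
    have := ler_normD (z - x_ i) (x_ i - p); rewrite addrA subrK nz.
    by lra.
  have := ler_normB (z - p) (x_ i - p); rewrite opprB addrA subrK nz.
  by lra.
have fz : f_ i z < expR b by move: z Sz {zx nz}; near: i.
have fx' : expR (ln (f_ i x)) <= f_ i x by rewrite lnK.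
have := le_lt_trans (filc _ _ _ _ _ t01 fx' ax) fz.
rewrite ltr_expR /b => h.
have h2 : ln (f_ i x) <= a - M * s.
  have {}h : t * (ln (f_ i x) - a) < - (M * r) by lra.
  have tr : r = t * s by rewrite /t divfK// gt_eqF.
  move: h; rewrite {1}tr mulrCA -mulrN ltr_pM2l; last by case/andP: t01.
  by lra.
apply: (@le_trans _ _ (expR (a + M * (`|p| + 1)) * expR (- (M * `|x|)))).
  rewrite -expRD -{1}(lnK fx) ler_expR; apply: (le_trans h2).
  have : `|x| <= s + 1 + `|p|.
    have := ler_normD (x - x_ i) (x_ i - p); rewrite addrA subrK -/s.
    by have := ler_normD (x - p) p; rewrite subrK; lra.
  move=> /(ler_wpM2l M0); lra.
by rewrite ler_wpM2r ?expR_ge0// lerDr mulr_ge0 ?expR_ge0// ltW.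
Unshelve. all: by end_near.
Qed.

Lemma LC_bound f M : LC f ->
  exists2 C, 0 < C & forall x, f x <= C * expR (- (M * `|x|)).
Proof.
move=> Lf; have [|C C0 [N _ H]] := @uniform_decay (fun=> f) f M (fun=> Lf) Lf.
  by apply: usc_hypo; case: Lf => -[].
by exists C => //; exact: H N (leqnn N).
Qed.

End Topology.

(** * Invariant valuations and the maximum functional *)

Section Operations.
Context {R : realType} {n : nat}.
Local Notation V := 'cV[R]_n.
Implicit Types (f g : V -> R) (x y z p : V).

Lemma dotvC x y : dotv x y = dotv y x.
Proof. by apply: eq_bigr => i _; rewrite mulrC. Qed.

Lemma dotvDr x y z : dotv x (y + z) = dotv x y + dotv x z.
Proof. by rewrite -big_split; apply: eq_bigr => i _; rewrite mxE mulrDr. Qed.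

Lemma dotvZr (a : R) x y : dotv x (a *: y) = a * dotv x y.
Proof. by rewrite mulr_sumr; apply: eq_bigr => i _; rewrite mxE; ring. Qed.

Lemma dotvNr x y : dotv x (- y) = - dotv x y.
Proof. by rewrite -scaleN1r dotvZr mulN1r. Qed.

Lemma dotvBr x y z : dotv x (y - z) = dotv x y - dotv x z.
Proof. by rewrite dotvDr dotvNr. Qed.

Lemma dotv0l x : dotv 0 x = 0.
Proof. by rewrite /dotv big1// => i _; rewrite mxE mul0r. Qed.

Lemma dotvDl x y z : dotv (x + y) z = dotv x z + dotv y z.
Proof. by rewrite dotvC dotvDr ![dotv z _]dotvC. Qed.

Lemma dotvZl (a : R) x y : dotv (a *: x) y = a * dotv x y.
Proof. by rewrite dotvC dotvZr dotvC. Qed.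

Lemma dotvNl x y : dotv (- x) y = - dotv x y.
Proof. by rewrite dotvC dotvNr dotvC. Qed.

Lemma dotvBl x y z : dotv (x - y) z = dotv x z - dotv y z.
Proof. by rewrite dotvDl dotvNl. Qed.

Lemma dotvv_ge0 x : 0 <= dotv x x.
Proof. by apply: sumr_ge0 => i _; rewrite -expr2 sqr_ge0. Qed.

Lemma dotv_mulmx (A : 'M[R]_n) x y : dotv x (A *m y) = dotv (A^T *m x) y.
Proof.
rewrite /dotv; under eq_bigr do rewrite mxE mulr_sumr.
under [RHS]eq_bigr do rewrite mxE mulr_suml.
rewrite exchange_big; apply: eq_bigr => i _; apply: eq_bigr => j _.
by rewrite mxE; ring.
Qed.

Lemma dotv_le_norm x y : dotv x y <= (\sum_i `|x i ord0|) * `|y|.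
Proof.
rewrite mulr_suml; apply: ler_sum => i _.
rewrite (le_trans (ler_norm _))// normrM ler_wpM2l//.
exact: coord_le_norm.
Qed.

Lemma cvg_dotv {T : Type} (F : set_system T) {FF : Filter F} x (g : T -> V) l :
  g @ F --> l -> dotv x (g t) @[t --> F] --> dotv x l.
Proof.
move=> gl; apply: cvg_big => [|j _]; first exact: add_continuous.
by apply: cvgM; [exact: cvg_cst|exact: cvg_coord].
Qed.

Lemma dotv_continuous x : continuous (dotv x).
Proof. by move=> y; apply: (@cvg_dotv _ (nbhs y)); exact: cvg_id. Qed.

Definition tilt x f : V -> R := fun y => expR (dotv x y) * f y.

Lemma tilt0 f : tilt 0 f = f.
Proof. by apply/funext => y; rewrite /tilt dotv0l expR0 mul1r. Qed.

Lemma tiltD x y f : tilt x (tilt y f) = tilt (x + y) f.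
Proof.
apply/funext => z; rewrite /tilt mulrA -expRD; congr (expR _ * _).
by rewrite ![dotv _ z]dotvC dotvDr.
Qed.

Lemma hypo_sup_mul (f_ : nat -> V -> R) f (g : V -> R) :
  (forall x, 0 <= f x) -> (forall x, 0 < g x) -> continuous g ->
  hypo_sup f_ f -> hypo_sup (fun i x => g x * f_ i x) (fun x => g x * f x).
Proof.
move=> f0 g0 cg H x c gfc.
have fxc : f x < c / g x by rewrite ltr_pdivlMr// mulrC.
pose c' := (f x + c / g x) / 2.
have fc' : f x < c' by rewrite /c' midf_lt.
have c'c : c' < c / g x by rewrite /c' midf_lt.
have c'0 : 0 < c' by exact: le_lt_trans fc'.
have [[U W] /= [Ux Wo] UW] := H _ _ fc'.
have : \forall z \near x, g z < c / c'.
  apply: (cvgr_lt _ (cg x)); rewrite ltr_pdivlMr//.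
  by rewrite mulrC -ltr_pdivlMr.
move=> gz; exists (U `&` [set z | g z < c / c'], W).
  by split=> //; exact: filterI.
move=> [z i] [/= [Uz gzc] Wi].
have fz : f_ i z < c' by exact: (UW (z, i)).
apply: (@lt_le_trans _ _ (g z * c')); first by rewrite ltr_pM2l.
by rewrite -ler_pdivlMr// ltW.
Qed.

Lemma hypo_mul (f_ : nat -> V -> R) f (g : V -> R) :
  (forall x, 0 <= f x) -> (forall x, 0 < g x) -> continuous g ->
  hypo f_ f -> hypo (fun i x => g x * f_ i x) (fun x => g x * f x).
Proof.
move=> f0 g0 cg [hs hr]; split; first exact: hypo_sup_mul.
move=> x; have [x_ x_x fx] := hr x; exists x_ => //.
by apply: cvgM => //; exact: (cvg_comp _ _ x_x (cg x)).
Qed.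

Lemma expR_dotv_continuous x : continuous (fun y => expR (dotv x y)).
Proof.
move=> y; apply: (@continuous_comp _ _ _ (dotv x) expR).
  exact: dotv_continuous.
exact: continuous_expR.
Qed.

Lemma hypo_tilt (f_ : nat -> V -> R) f x : (forall x, 0 <= f x) ->
  hypo f_ f -> hypo (fun i => tilt x (f_ i)) (tilt x f).
Proof.
move=> f0; apply: hypo_mul => // [y|]; first exact: expR_gt0.
exact: expR_dotv_continuous.
Qed.

Lemma expR_le_mul (a b : R) (c : R) : (expR a <= expR b * c) = (expR (a - b) <= c).
Proof. by rewrite expRD expRN ler_pdivrMr ?expR_gt0// mulrC. Qed.

Lemma lcu_tilt x f : logconcave_usc f -> logconcave_usc (tilt x f).
Proof.
move=> [f0 fl fu]; split.
- by move=> y; rewrite mulr_ge0 ?expR_ge0.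
- move=> y z a b t t01; rewrite /tilt !expR_le_mul => ay bz.
  apply: le_trans (fl _ _ _ _ _ t01 ay bz); rewrite ler_expR.
  by rewrite dotvDr !dotvZr; lra.
- apply/usc_hypo_sup; apply: hypo_sup_mul => // [y||].
  + exact: expR_gt0.
  + exact: expR_dotv_continuous.
  + exact/usc_hypo_sup.
Qed.

Lemma LC_tilt x f : LC f -> LC (tilt x f).
Proof.
move=> [fl [p fp] fd]; split; first exact: lcu_tilt.
  by exists p; rewrite mulr_gt0 ?expR_gt0.
move=> M; have [r Hr] := fd (M + \sum_i `|x i ord0|); exists r => y ry.
apply: (@le_trans _ _ (expR (dotv x y) *
    expR (- ((M + \sum_i `|x i ord0|) * `|y|)))).
  by rewrite ler_pM2l ?expR_gt0// Hr.
by rewrite -expRD ler_expR; have := dotv_le_norm x y; lra.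
Qed.

Lemma lcu_scale s f : 0 < s -> logconcave_usc f ->
  logconcave_usc (fun x => s * f x).
Proof.
move=> s0 [f0 fl fu]; split.
- by move=> y; rewrite mulr_ge0// ltW.
- move=> y z a b t t01; rewrite -(lnK s0) !expR_le_mul => ay bz.
  by apply: le_trans (fl _ _ _ _ _ t01 ay bz); rewrite ler_expR; lra.
- move=> x c; rewrite mulrC -ltr_pdivlMr// => /fu.
  by apply: filterS => z; rewrite ltr_pdivlMr// mulrC.
Qed.

Lemma LC_scale s f : 0 < s -> LC f -> LC (fun x => s * f x).
Proof.
move=> s0 [fl [p fp] fd]; split; first exact: lcu_scale.
  by exists p; rewrite mulr_gt0.
move=> M; have [r Hr] := fd (M + 1).
exists (Num.max r (ln s)) => y; rewrite gt_max => /andP[/Hr fy sy].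
apply: (@le_trans _ _ (s * expR (- ((M + 1) * `|y|)))); first by rewrite ler_pM2l.
by rewrite -{1}(lnK s0) -expRD ler_expR; lra.
Qed.

Lemma decaying_comp f (h : V -> V) (K K' : R) : 0 < K -> 0 <= K' ->
  (forall x, `|x| <= K * `|h x| + K') -> decaying f -> decaying (f \o h).
Proof.
move=> K0 K'0 Kh fd M; have [r Hr] := fd (`|M| * K + 1).
exists (K * (`|r| + `|M| * K') + K') => x xr /=.
have := Kh x; set X := `|x| in xr *; set H := `|h x| => XH.
have rH : `|r| + `|M| * K' < H.
  by rewrite -(ltr_pM2l K0); lra.
have MK : 0 <= `|M| * K' by rewrite mulr_ge0.
apply: (@le_trans _ _ (expR (- ((`|M| * K + 1) * H)))).
  by apply: Hr; have := ler_norm r; rewrite -/H; lra.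
rewrite ler_expR lerN2.
have h1 : M * X <= `|M| * X by apply: ler_wpM2r; [exact: normr_ge0|exact: ler_norm].
have h2 := ler_wpM2l (normr_ge0 M) XH.
have := normr_ge0 r; lra.
Qed.

Lemma lcu_affine f (A : 'M[R]_n) (b : V) : logconcave_usc f ->
  logconcave_usc (fun x => f (A *m x + b)).
Proof.
move=> [f0 fl fu]; split => //.
- move=> y z a c t t01 ay cz; apply: le_trans (fl _ _ _ _ _ t01 ay cz) _.
  rewrite le_eqVlt; apply/orP; left; apply/eqP; congr (f _).
  rewrite mulmxDr -!scalemxAr !scalerDr addrACA; congr (_ + _).
  by rewrite -scalerDl addrC subrK scale1r.
- move=> x c /fu H.
  have Ac : A *m z + b @[z --> x] --> A *m x + b.
    apply: (@cvgD _ _ _ (nbhs x) _ (fun z => A *m z) (fun=> b) (A *m x) b).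
      by apply: (@cvg_mulmx _ _ _ (nbhs x)); exact: cvg_id.
    exact: cvg_cst.
  exact: Ac H.
Qed.

Lemma LC_affine f (A : 'M[R]_n) (b : V) : A \in unitmx -> LC f ->
  LC (fun x => f (A *m x + b)).
Proof.
move=> uA [fl [p fp] fd]; split; first exact: lcu_affine.
  by exists (invmx A *m (p - b)); rewrite mulKVmx// subrK.
pose K := \sum_i \sum_j `|invmx A i j|.
have K0 : 0 <= K by apply: sumr_ge0 => i _; exact: sumr_ge0.
apply: (@decaying_comp f (fun x => A *m x + b) (K + 1) ((K + 1) * `|b|)) => //.
- by rewrite ltr_wpDl.
- by rewrite mulr_ge0// addr_ge0.
- move=> x; rewrite -mulrDr -{1}(mulKmx uA x).
  apply: (le_trans (norm_mulmx_le _ _)); rewrite -/K.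
  apply: ler_pM => //; first by rewrite lerDl.
  by have := ler_normB (A *m x + b) b; rewrite addrK.
Qed.

Lemma LC_translate y f : LC f -> LC (translate y f).
Proof.
move=> Lf; have := LC_affine (- y) (unitmx1 _ _) Lf.
by rewrite (_ : (fun x => _) = translate y f)//; apply/funext => x; rewrite mul1mx.
Qed.

Lemma LC_comp f (A : 'M[R]_n) : A \in unitmx -> LC f -> LC (f \o mulmx A).
Proof.
move=> uA Lf; have := LC_affine 0 uA Lf.
by rewrite (_ : (fun x => _) = f \o mulmx A)//; apply/funext => x; rewrite addr0.
Qed.

End Operations.

(** * Operators as functionals of tilted functions; the maximum *)

Section InvariantValuations.
Context {R : realType} {n : nat}.
Local Notation V := 'cV[R]_n.
Implicit Types (f g : V -> R) (x y p : V) (z : (V -> R) -> R).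

Record invariant_valuation z : Prop := InvariantValuation {
  iv_cont : forall (f_ : nat -> V -> R) f, (forall i, LC (f_ i)) -> LC f ->
    hypo f_ f -> z (f_ i) @[i --> \oo] --> z f;
  iv_SL : forall f (A : 'M[R]_n), LC f -> \det A = 1 -> z (f \o mulmx A) = z f;
  iv_val : forall f g, LC f -> LC g -> LC (f \max g) -> LC (f \min g) ->
    z (f \max g) + z (f \min g) = z f + z g;
  iv_translate : forall f y, LC f -> z (translate y f) = z f;
  iv_scale : forall f s, 0 < s -> LC f -> z (fun x => s * f x) = s * z f }.

Lemma invariant_valuation_lin z1 z2 (a b : R) : invariant_valuation z1 ->
  invariant_valuation z2 -> invariant_valuation (fun f => a * z1 f + b * z2 f).
Proof.
move=> [c1 s1 v1 t1 h1] [c2 s2 v2 t2 h2]; split.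
- move=> f_ f Lf_ Lf ff; apply: cvgD.
    by apply: cvgM; [exact: cvg_cst|exact: c1].
  by apply: cvgM; [exact: cvg_cst|exact: c2].
- by move=> f A Lf dA; rewrite s1// s2.
- move=> f g Lf Lg LM Lm; have := v1 f g Lf Lg LM Lm.
  have := v2 f g Lf Lg LM Lm => e2 e1.
  have -> : a * z1 f = a * (z1 f + z1 g) - a * z1 g by ring.
  have -> : b * z2 f = b * (z2 f + z2 g) - b * z2 g by ring.
  by rewrite -e1 -e2; ring.
- by move=> f y Lf; rewrite t1// t2.
- by move=> f s s0 Lf; rewrite h1// h2//; ring.
Qed.

Lemma det1_unit (A : 'M[R]_n) : \det A = 1 -> A \in unitmx.
Proof. by move=> dA; rewrite unitmxE dA unitr1. Qed.

(** Tilting intertwines the actions: a linear substitution in [f] becomes the transposed one in the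
    tilt parameter, a translation by [y] contributes the factor [expR (dotv x y)], and an
    exponential factor shifts the parameter. *)
Lemma invariant_valuation_operator z (Z : (V -> R) -> V -> R) :
  invariant_valuation z ->
  (forall f, LC_sc f -> Z f = (fun x => z (tilt x f))) ->
  [/\ hypo_continuous Z, SL_contravariant Z, valuation Z,
    forall f y, LC_sc f -> Z (translate y f) = (fun x => expR (dotv x y) * Z f x)
  & forall f y, LC_sc f ->
      Z (fun x => expR (- dotv x y) * f x) = translate y (Z f)].
Proof.
move=> [zc zs zv zt zh] ZE; split.
- move=> f_ f Lf_ Lf ff x; rewrite ZE//.
  under eq_fun do rewrite ZE//.
  apply: zc => [i||]; [exact/LC_tilt/LC_scP|exact/LC_tilt/LC_scP|].
  apply: hypo_tilt; first by case/LC_scP : Lf => -[].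
  apply/hypo_convergesP => // [i x'|x']; last by case/LC_scP : Lf => -[].
  by case/LC_scP : (Lf_ i) => -[].
- move=> f A Lf dA; have Lf' := (LC_scP f).1 Lf.
  have dA' : \det (invmx A) = 1 by rewrite det_inv dA invr1.
  rewrite ZE; last exact/LC_scP/LC_comp/Lf'/det1_unit.
  rewrite ZE//; apply/funext => x /=.
  rewrite -(zs (tilt (A^T *m x) f) (invmx A))//; last exact: LC_tilt.
  congr z; apply/funext => y; rewrite /tilt/=; congr (expR _ * _).
  by rewrite -dotv_mulmx mulKVmx// det1_unit.
- move=> f g Lf Lg LM Lm; rewrite !ZE//; apply/funext => x /=.
  have tM : tilt x (f \max g) = tilt x f \max tilt x g.
    by apply/funext => y; rewrite /tilt/= maxr_pMr// expR_ge0.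
  have tm : tilt x (f \min g) = tilt x f \min tilt x g.
    by apply/funext => y; rewrite /tilt/= minr_pMr// expR_ge0.
  rewrite tM tm zv -?tM -?tm//; apply: LC_tilt; exact/LC_scP.
- move=> f y Lf; have Lf' := (LC_scP f).1 Lf.
  rewrite ZE; last exact/LC_scP/LC_translate.
  rewrite ZE//; apply/funext => x; rewrite -[z (tilt x f)](zt _ y); last exact: LC_tilt.
  rewrite -zh ?expR_gt0//; last exact/LC_translate/LC_tilt.
  congr z; apply/funext => w; rewrite /tilt /translate mulrA -expRD.
  by congr (expR _ * _); rewrite dotvBr; ring.
- move=> f y Lf; have Lf' := (LC_scP f).1 Lf.
  have -> : (fun x => expR (- dotv x y) * f x) = tilt (- y) f.
    by apply/funext => x; rewrite /tilt dotvC [in RHS]dotvC dotvNr [dotv x y]dotvC.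
  rewrite ZE; last exact/LC_scP/LC_tilt.
  by rewrite ZE//; apply/funext => x; rewrite tiltD.
Qed.

Lemma operator_invariant_valuation (Z : (V -> R) -> V -> R) : (0 < n)%N ->
  [/\ hypo_continuous Z, SL_contravariant Z, valuation Z,
    forall f y, LC_sc f -> Z (translate y f) = (fun x => expR (dotv x y) * Z f x)
  & forall f y, LC_sc f ->
      Z (fun x => expR (- dotv x y) * f x) = translate y (Z f)] ->
  exists2 z, invariant_valuation z &
    forall f, LC_sc f -> Z f = (fun x => z (tilt x f)).
Proof.
move=> n0 [Zc Zs Zv Zt Zl].
have ZE f x : LC f -> Z (tilt x f) 0 = Z f x.
  move=> Lf; have := Zl f (- x) ((LC_scP f).2 Lf).
  have -> : (fun w => expR (- dotv w (- x)) * f w) = tilt x f.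
    by apply/funext => w; rewrite /tilt dotvNr opprK dotvC.
  by move=> ->; rewrite /translate opprK add0r.
exists (fun f => Z f 0); last first.
  by move=> f /LC_scP Lf; apply/funext => x; rewrite ZE.
have trans f y : LC f -> Z (translate y f) 0 = Z f 0.
  by move=> /LC_scP Lf; rewrite Zt// dotv0l expR0 mul1r.
split=> //.
- move=> f_ f Lf_ Lf ff; apply: Zc => [i||]; [exact/LC_scP|exact/LC_scP|].
  apply/hypo_convergesP => // [i x|x]; last by case: Lf => -[].
  by case: (Lf_ i) => -[].
- move=> f A Lf dA; have := Zs f (invmx A) ((LC_scP f).2 Lf).
  rewrite det_inv dA invr1 invmxK => /(_ erefl) ->.
  by rewrite /= mulmx0.
- move=> f g /LC_scP Lf /LC_scP Lg /LC_scP LM /LC_scP Lm.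
  by have /(congr1 (fun h => h 0)) := Zv f g Lf Lg LM Lm.
- move=> f s s0 Lf.
  (* Translations and tilts commute only up to a scalar: the commutator of the translation by [e]
     with the tilt by [x] is multiplication by [expR (dotv x e)], which is [s] for the chosen [x].
     Homogeneity of [z] thus follows from the two covariance rules. *)
  pose e : V := \col_i (i == Ordinal n0)%:R.
  pose x := ln s *: e.
  have xe : dotv x e = ln s.
    rewrite dotvC dotvZr /dotv (bigD1 (Ordinal n0))//= big1 ?addr0.
      by rewrite mxE eqxx !mulr1.
    by move=> i /negbTE ie; rewrite mxE ie mul0r.
  pose g := translate (- e) f; pose h := tilt (- x) g.
  have Lg : LC g by exact: LC_translate.
  have Lh : LC h by exact: LC_tilt.
  have -> : (fun w => s * f w) = tilt x (translate e h).
    apply/funext => w; rewrite /tilt /translate /h /g /tilt /translate mulrA.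
    rewrite -expRD opprK subrK [dotv (- x) _]dotvC dotvNr [dotv _ x]dotvC dotvBr.
    by rewrite xe (_ : _ - _ = ln s) ?lnK//; ring.
  rewrite ZE; last exact: LC_translate.
  rewrite Zt; last exact/LC_scP.
  rewrite xe lnK// -ZE// /h tiltD subrr tilt0; congr (_ * _).
  exact: trans.
Qed.

Lemma logconcave_superlevel f m x y t : logconcave f -> 0 < m ->
  0 <= t <= 1 -> m <= f x -> m <= f y -> m <= f (t *: x + (1 - t) *: y).
Proof.
move=> fl m0 /andP[]; rewrite le_eqVlt => /predU1P[<- _ _ fy|t0].
  by rewrite scale0r add0r subr0 scale1r.
rewrite le_eqVlt => /predU1P[-> fx _|t1].
  by rewrite subrr scale0r scale1r addr0.
rewrite -{1 2 3}(lnK m0) => fx fy; have := fl x y _ _ t _ fx fy.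
by rewrite t0 t1 -mulrDl addrC subrK mul1r; exact.
Qed.

Definition maxf f : R := sup (range f).

Lemma maxfE f p : (forall x, f x <= f p) -> maxf f = f p.
Proof.
move=> fp; apply/eqP; rewrite eq_le; apply/andP; split.
  by apply: sup_le_ub; [exists (f p), p|move=> _ [x _ <-]].
apply: sup_upper_bound; last by exists p.
by split; [exists (f p), p|exists (f p) => _ [x _ <-]].
Qed.

Lemma le_maxf f x : LC f -> f x <= maxf f.
Proof. by move=> /LC_max[p [_ fp]]; rewrite (maxfE fp). Qed.

Lemma maxf_le f c : (forall x, f x <= c) -> maxf f <= c.
Proof. by move=> fc; apply: sup_le_ub; [exists (f 0), 0|move=> _ [x _ <-]]. Qed.

(** The Legendre transform of [- log f] at [x] is the logarithm of the maximum of the tilt, which is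
    attained and positive; in particular the supremum is finite. *)
Lemma polarE f x : LC f -> (polar f x)^-1 = maxf (tilt x f).
Proof.
move=> Lf; have [p [tp0 tp]] := LC_max (LC_tilt x Lf).
have f0 y : 0 <= f y by case: Lf => -[].
rewrite (maxfE tp) /polar /exp_neg.
suff -> : legendre (neg_log f) x = (ln (tilt x f p))%:E.
  by rewrite /= expRN invrK lnK.
have val y : 0 < f y -> ((dotv x y)%:E - neg_log f y = (ln (tilt x f y))%:E)%E.
  move=> fy; rewrite neg_log_pos// -EFinB opprK; congr (_%:E).
  by rewrite /tilt lnM ?posrE ?expR_gt0// expRK.
have fp : 0 < f p by move: tp0; rewrite /tilt pmulr_rgt0// expR_gt0.
apply/eqP; rewrite eq_le; apply/andP; split; last first.
  by apply: ereal_sup_ubound; exists p => //; rewrite val.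
apply: ub_ereal_sup => _ [y _ <-]; have [fy|fy] := leP (f y) 0.
  by rewrite neg_log_zero//= leNye.
rewrite val// lee_fin ler_ln ?posrE//.
by rewrite mulr_gt0 ?expR_gt0.
Qed.

Lemma maxf_cvg (f_ : nat -> V -> R) f : (forall i, LC (f_ i)) -> LC f ->
  hypo f_ f -> maxf (f_ i) @[i --> \oo] --> maxf f.
Proof.
move=> Lf_ Lf ff; have [p [fp0 fp]] := LC_max Lf.
rewrite (maxfE fp); apply/cvgrPdist_le => e e0.
have [C C0 HC] := uniform_decay 1 (fun i => LC_lcu (Lf_ i)) Lf ff.
case: (ff) => hs hr; have [x_ x_p fx_] := hr p.
(* Outside the ball of radius [r], the uniform bound [C * expR (- |x|)] is at most [f p]; inside,
   compactness gives the upper estimate. *)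
pose r := ln C - ln (f p).
have K := hypo_sup_compact (c := f p + e) hs (@compact_norm_le _ _ 0 r).
have {}K : \forall i \near \oo, forall x, `|x - 0| <= r -> f_ i x < f p + e.
  by apply: K => x _; rewrite (le_lt_trans (fp x))// ltrDl.
near=> i.
rewrite ler_distl; apply/andP; split; last first.
  rewrite -lerBlDr; apply: (@le_trans _ _ (f_ i (x_ i))); last exact: le_maxf.
  by near: i; apply: (cvgr_ge _ fx_); rewrite gtrBl.
rewrite lerBlDr.
apply: maxf_le => x; have [xr|xr] := leP (`|x - 0|) r.
  by apply/ltW; move: x xr; near: i.
have : f_ i x <= C * expR (- (1 * `|x|)) by move: x {xr}; near: i.
move=> /le_trans; apply; apply: (@le_trans _ _ (f p)); last first.
  by rewrite lerDl ltW.
move: xr; rewrite subr0 mul1r => /ltW; rewrite /r => xr.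
by rewrite -{1}(lnK C0) -expRD -[leRHS](lnK fp0) ler_expR; lra.
Unshelve. all: by end_near.
Qed.

(* A point of the segment joining the two maximisers lies in both superlevel
   sets, because they are closed and cover the segment. *)
Lemma maxf_min f g : LC f -> LC g -> LC (f \max g) -> LC (f \min g) ->
  maxf (f \min g) = Num.min (maxf f) (maxf g).
Proof.
move=> Lf Lg LM Lm; have [a [fa0 fa]] := LC_max Lf.
have [b [gb0 gb]] := LC_max Lg; rewrite (maxfE fa) (maxfE gb).
set m := Num.min (f a) (g b).
have m0 : 0 < m by rewrite lt_min fa0.
suff [c fc gc] : exists2 c, m <= f c & m <= g c.
  apply/eqP; rewrite eq_le; apply/andP; split.
    by apply: maxf_le => x /=; rewrite le_min2.
  by apply: le_trans (le_maxf c Lm); rewrite /= le_min fc.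
pose c t := t *: b + (1 - t) *: a.
have cc t : {for t, continuous c}.
  apply: cvgD; first by apply: cvgZr_tmp; exact: cvg_id.
  apply: cvgZr_tmp; apply: cvgB; [exact: cvg_cst|exact: cvg_id].
have open (h : V -> R) t : LC h -> h (c t) < m ->
    exists2 e, 0 < e & forall s, `|t - s| < e -> h (c s) < m.
  move=> [[_ _ hu] _ _] /hu /cc /nbhs_ballP[e e0 H]; exists e => // s ts.
have cover t : 0 <= t <= 1 -> m <= f (c t) \/ m <= g (c t).
  move=> t01; have : m <= (f \max g) (c t).
    apply: logconcave_superlevel => //=; first by case: LM => -[].
      by rewrite le_max [X in _ || X]ge_min lexx !orbT.
    by rewrite le_max ge_min lexx.
  by rewrite /= le_max => /orP[]; [left|right].
pose A := [set t : R | 0 <= t <= 1 /\ m <= f (c t)].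
have A0 : A 0.
  split; first by rewrite lexx ler01.
  by rewrite /c scale0r add0r subr0 scale1r ge_min lexx.
have hA : has_sup A by split; [exists 0|exists 1 => t [/andP[]]].
pose s := sup A.
have s0 : 0 <= s by exact: sup_upper_bound.
have s1 : s <= 1 by apply: sup_le_ub; [exists 0|move=> t [/andP[]]].
have fs : m <= f (c s).
  rewrite leNgt; apply/negP => /(open f s Lf)[e e0 He].
  have [t [t01 ft] st] := sup_adherent e0 hA.
  have ts : t <= s by apply: sup_upper_bound.
  have : f (c t) < m by apply: He; rewrite ger0_norm ?subr_ge0// ltrBlDr addrC -ltrBlDr.
  by rewrite ltNge ft.
exists (c s) => //; rewrite leNgt; apply/negP => gs.
have {}s1 : s < 1.
  rewrite lt_neqAle s1 andbT; apply/eqP => s1'; move: gs.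
  by rewrite s1' /c subrr scale0r scale1r addr0 ltNge ge_min lexx orbT.
have [e e0 He] := open g s Lg gs.
pose d := Num.min (e / 2) (1 - s).
have d0 : 0 < d by rewrite lt_min divr_gt0// subr_gt0.
have sd1 : s + d <= 1 by rewrite -lerBrDl ge_min lexx orbT.
have sd01 : 0 <= s + d <= 1 by rewrite addr_ge0// ltW.
have gsd : g (c (s + d)) < m.
  apply: He; rewrite opprD addNKr normrN gtr0_norm//.
  by rewrite (@le_lt_trans _ _ (e / 2))// ?ge_min ?lexx// gtr_pMr// invf_lt1// ltr1n.
have [fsd|] := cover _ sd01; last by rewrite leNgt gsd.
have : s + d <= s by exact: sup_upper_bound.
by rewrite leNgt ltrDl d0.
Qed.

Lemma maxf_invariant_valuation : invariant_valuation maxf.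
Proof.
have comp f (h h' : V -> V) : cancel h' h -> LC f ->
    maxf (f \o h) = maxf f.
  move=> hK Lf; have [p [_ fp]] := LC_max Lf.
  have fhp x : (f \o h) x <= (f \o h) (h' p) by rewrite /= hK.
  by rewrite (maxfE fhp) (maxfE fp) /= hK.
split.
- by move=> *; exact: maxf_cvg.
- move=> f A Lf dA; apply: (comp _ _ (mulmx (invmx A))) => // x.
  by rewrite mulKVmx// det1_unit.
- move=> f g Lf Lg LM Lm; rewrite maxf_min//.
  suff -> : maxf (f \max g) = Num.max (maxf f) (maxf g).
    by rewrite addr_max_min.
  apply/eqP; rewrite eq_le; apply/andP; split.
    by apply: maxf_le => x /=; rewrite ge_max !le_max !le_maxf// orbT.
  have [a [fa0 fa]] := LC_max Lf; have [b [gb0 gb]] := LC_max Lg.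
  rewrite (maxfE fa) (maxfE gb) ge_max; apply/andP; split.
    by apply: le_trans (le_maxf a LM); rewrite /= le_max lexx.
  by apply: le_trans (le_maxf b LM); rewrite /= le_max lexx orbT.
- move=> f y Lf; apply: (comp _ (fun x => x - y) (fun x => x + y)) => // x.
  by rewrite addrK.
- move=> f s s0 Lf; have [p [_ fp]] := LC_max Lf.
  have sfp x : s * f x <= s * f p by rewrite ler_pM2l.
  by rewrite (@maxfE (fun x => s * f x) p)// (maxfE fp).
Qed.

End InvariantValuations.

(** * Functions supported in a hyperplane *)

Section Restriction.
Context {R : realType} {n : nat}.
Local Notation V := 'cV[R]_n.
Implicit Types (f g q : V -> R) (C : set V) (x y p w : V).

Definition convexs C := forall x y (t : R), 0 < t < 1 -> C x -> C y ->
  C (t *: x + (1 - t) *: y).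

Definition restr f C : V -> R := fun x => if x \in C then f x else 0.

Lemma restrT f C x : C x -> restr f C x = f x.
Proof. by rewrite /restr => /mem_set ->. Qed.

Lemma restrF f C x : ~ C x -> restr f C x = 0.
Proof. by rewrite /restr; case: ifP => // /set_mem. Qed.

Lemma restr_ge0 f C x : (forall x, 0 <= f x) -> 0 <= restr f C x.
Proof. by rewrite /restr; case: ifP. Qed.

Lemma restr_le f C x : (forall x, 0 <= f x) -> restr f C x <= f x.
Proof. by rewrite /restr; case: ifP. Qed.

Lemma restr_neq0 f C x : restr f C x != 0 -> C x.
Proof. by move=> H; apply: contrapT => Cx; rewrite restrF ?eqxx in H. Qed.

Lemma lcu_restr f C : closed C -> convexs C -> logconcave_usc f ->
  logconcave_usc (restr f C).
Proof.
move=> cC vC [f0 fl fu].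
have inC x a : expR a <= restr f C x -> C x /\ expR a <= f x.
  have [Cx|Cx] := pselect (C x); first by rewrite restrT.
  by rewrite restrF// leNgt expR_gt0.
split.
- by move=> x; exact: restr_ge0.
- move=> x y a b t t01 /inC[Cx ax] /inC[Cy b_y].
  by rewrite restrT; [exact: fl|exact: vC].
- move=> x c; have [Cx|Cx] := pselect (C x).
    rewrite restrT// => /fu; apply: filterS => z; apply: le_lt_trans.
    exact: restr_le.
  rewrite restrF// => c0; have : nbhs x (~` C).
    by apply: open_nbhs_nbhs; split=> //; exact: closed_openC.
  by apply: filterS => z Cz; rewrite restrF.
Qed.

Lemma LC_restr f C : closed C -> convexs C -> (exists2 x, C x & 0 < f x) ->
  LC f -> LC (restr f C).
Proof.
move=> cC vC [p Cp fp] [fl _ fd]; split.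
- exact: lcu_restr.
- by exists p; rewrite restrT.
- move=> M; have [r Hr] := fd M; exists r => x /Hr; apply: le_trans.
  by apply: restr_le => z; case: fl.
Qed.

Lemma LC_restr_bounded f C (B : R) : closed C -> convexs C ->
  (forall x, C x -> `|x| <= B) -> (exists2 x, C x & 0 < f x) ->
  logconcave_usc f -> LC (restr f C).
Proof.
move=> cC vC CB [p Cp fp] fl; split.
- exact: lcu_restr.
- by exists p; rewrite restrT.
- move=> M; exists B => x xB; rewrite restrF ?expR_ge0// => /CB.
  by rewrite leNgt xB.
Qed.

Definition concave q := forall x y (t : R), 0 < t < 1 ->
  t * q x + (1 - t) * q y <= q (t *: x + (1 - t) *: y).

Lemma lcu_exp q : concave q -> continuous q ->
  logconcave_usc (fun x => expR (q x)).
Proof.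
move=> vq cq; split.
- by move=> x; exact: expR_ge0.
- move=> x y a b t t01; rewrite !ler_expR => ax b_y.
  apply: le_trans (vq x y t t01); have /andP[t0 t1] := t01.
  by apply: lerD; apply: ler_wpM2l => //; rewrite ?subr_ge0 ltW.
- move=> x c fxc.
  have : expR (q z) @[z --> x] --> expR (q x).
    apply: (@continuous_comp _ _ _ q expR); first exact: cq.
    exact: continuous_expR.
  by move/cvgr_lt; exact.
Qed.

Definition point0 : V -> R := restr (fun=> 1) [set 0].

Lemma point0_0 : point0 0 = 1. Proof. by rewrite /point0 restrT. Qed.

Lemma point0_neq0 x : x != 0 -> point0 x = 0.
Proof. by move=> /eqP x0; rewrite /point0 restrF. Qed.

Lemma LC_point0 : LC point0.
Proof.
apply: (@LC_restr_bounded _ _ 0).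
- have -> : [set 0] = [set x : V | 0 <= - `|x|].
    by apply/seteqP; split=> x /=; rewrite oppr_ge0 normr_le0 => /eqP.
  apply: closed_fun_ge => x.
  by apply: (@cvgN _ _ _ (nbhs x) _ Num.norm `|x|); exact: norm_continuous.
- by move=> x y t _ /= -> ->; rewrite !scaler0 addr0.
- by move=> x /= ->; rewrite normr0.
- by exists 0.
- have -> : (fun=> 1) = (fun x : V => expR (0 : R)).
    by apply/funext => x; rewrite expR0.
  apply: lcu_exp => [x y t _|]; last exact: cst_continuous.
  by rewrite !mulr0 addr0.
Qed.

(** This matrix introduces coordinates whose [i]-th one is [dotv w x], so that a hyperplane with
    normal [w] becomes a coordinate hyperplane. *)
Lemma row_subst_unit w i : w i ord0 != 0 ->
  (\matrix_(a, b) if a == i then w b ord0 else (a == b)%:R) \in @unitmx R n.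
Proof.
move=> wi; rewrite -unitmx_tr -row_free_unit; apply: inj_row_free => v.
set P := trmx _ => vP.
have E a : \sum_b v 0 b * (if a == i then w b 0 else (a == b)%:R) = 0.
  have := congr1 (fun M : 'rV_n => M 0 a) vP; rewrite !mxE => e.
  by rewrite -[RHS]e; apply: eq_bigr => b _; rewrite !mxE.
have v0 a : a != i -> v 0 a = 0.
  move=> ai; rewrite -[RHS](E a) (negbTE ai) (bigD1 a)//= eqxx mulr1 big1 ?addr0//.
  by move=> b; rewrite eq_sym => /negbTE ->; rewrite mulr0.
apply/rowP => a; rewrite mxE; have [->|/v0//] := eqVneq a i.
have := E i; rewrite eqxx (bigD1 i)//= big1 ?addr0; last first.
  by move=> b /v0 ->; rewrite mul0r.
by move/eqP; rewrite mulf_eq0 (negbTE wi) orbF => /eqP.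
Qed.

(* SL(n) contains maps acting on a given hyperplane as an arbitrarily strong
   dilation; composing with them concentrates f at the origin. *)
Lemma iv_hyperplane0 z f w : invariant_valuation z -> LC f -> w != 0 ->
  (forall x, f x != 0 -> dotv w x = 0) -> z f = maxf f * z point0.
Proof.
move=> vz Lf w0 fw.
have [i wi] : exists i, w i ord0 != 0.
  apply: contrapT => nE; move/eqP : w0; apply; apply/colP => i; rewrite mxE.
  by apply/eqP/negPn/negP => wi; apply: nE; exists i.
pose P : 'M[R]_n := \matrix_(a, b) if a == i then w b ord0 else (a == b)%:R.
have uP : P \in unitmx by exact: row_subst_unit.
have Px x : (P *m x) i ord0 = dotv w x.
  by rewrite mxE; apply: eq_bigr => b _; rewrite mxE eqxx.
(* The [n - 1] directions of the hyperplane are stretched by [k + 1]; the transversal direction is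
   compressed so that the determinant is 1. *)
pose d k : 'rV[R]_n := \row_a if a == i then k.+1%:R ^- n.-1 else k.+1%:R.
pose A k := invmx P *m diag_mx (d k) *m P.
have dA k : \det (A k) = 1.
  rewrite /A !det_mulmx det_inv mulrAC mulVr -?unitmxE// mul1r det_diag.
  rewrite (bigD1 i)//= mxE eqxx (eq_bigr (fun=> k.+1%:R)).
    rewrite prodr_const (_ : #|_| = n.-1) ?mulVf ?expf_neq0 ?pnatr_eq0//.
    by rewrite (cardC1 i) card_ord.
  by move=> a /negbTE ai; rewrite mxE ai.
pose g k x := f (k.+1%:R *: x).
have gE k : f \o mulmx (A k) = g k.
  apply/funext => x; rewrite /g /=.
  have [wx|wx] := eqVneq (dotv w x) 0.
    congr f; rewrite /A -!mulmxA.
    have -> : diag_mx (d k) *m (P *m x) = k.+1%:R *: (P *m x).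
      apply/colP => a; rewrite mul_diag_mx mxE [in RHS]mxE mxE.
      by case: eqP => // ->; rewrite Px wx !mulr0.
    by rewrite -scalemxAr mulKmx.
  have f0 y : dotv w y != 0 -> f y = 0.
    by move=> wy; apply/eqP; apply: contraNT wy => /fw ->.
  rewrite !f0//; first by rewrite dotvZr mulf_neq0.
  rewrite -Px /A -!mulmxA mulKVmx// mul_diag_mx mxE Px mxE eqxx.
  by rewrite mulf_neq0// invr_neq0// expf_neq0.
have Lg k : LC (g k) by rewrite -gE; apply: LC_comp => //; exact: det1_unit.
have [a [fa0 fa]] := LC_max Lf.
have f_ge0 x : 0 <= f x by case: Lf => -[].
have gto : hypo g (fun x => f a * point0 x).
  have hs : hypo_sup g (fun x => f a * point0 x).
    move=> x c; have [->|x0] := eqVneq x 0.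
      rewrite point0_0 mulr1 => fac; exists (setT, setT).
        by split; exact: filterT.
      by move=> [z' k] _ /=; apply: le_lt_trans fac; exact: fa.
    rewrite point0_neq0// mulr0 => c0; have [C C0 fC] := LC_bound 1 Lf.
    have nx0 : 0 < `|x| / 2 by rewrite divr_gt0// normr_gt0.
    pose N := (ln C - ln c) / (`|x| / 2).
    exists ([set z' | `|x| / 2 < `|z'|], [set k | N < k.+1%:R]).
      split.
        have /cvgr_gt := @norm_continuous _ _ x; apply.
        by rewrite gtr_pMr ?normr_gt0// invf_lt1// ltr1n.
      exists (Num.truncn N) => // k /= Nk.
      by rewrite (lt_le_trans (truncnS_gt _))// ler_nat ltnS.
    move=> [z' k] /= [xz Nk]; apply: le_lt_trans (fC _) _.
    rewrite normrZ mul1r ger0_norm// -{1}(lnK C0) -expRD -(lnK c0) ltr_expR.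
    have : ln C - ln c < k.+1%:R * `|z'|.
      move: Nk; rewrite /N ltr_pdivrMr// => /lt_le_trans; apply.
      by rewrite ler_wpM2l// ltW.
    by lra.
  split=> // x; have [->|x0] := eqVneq x 0.
    (* At these points, which tend to the origin, [g k] equals its maximal value [f a]. *)
    exists (fun k => k.+1%:R^-1 *: a).
      rewrite -[X in _ --> X](scale0r a); apply: cvgZl.
      exact: cvg_harmonic.
    rewrite point0_0 mulr1 (_ : (fun k => _) = fun=> f a); first exact: cvg_cst.
    by apply/funext => k; rewrite /g scalerA divff ?scale1r// pnatr_eq0.
  exists (fun=> x); first exact: cvg_cst.
  have e0 : f a * point0 x = 0 by rewrite point0_neq0 ?mulr0.
  rewrite e0; apply/cvgrPdist_lt => e ep.
  have [|[U W] /= [Ux Wo] UW] := hs x e; first by rewrite e0.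
  apply: filterS Wo => k Wk; rewrite sub0r normrN ger0_norm ?f_ge0//.
  by apply: (UW (x, k)); split=> //=; exact: nbhs_singleton.
have : z (g k) @[k --> \oo] --> z (fun x => f a * point0 x).
  by apply: (iv_cont vz) => //; apply: LC_scale => //; exact: LC_point0.
rewrite (iv_scale vz)//; last exact: LC_point0.
have -> : (fun k => z (g k)) = fun=> z f.
  by apply/funext => k; rewrite -gE (iv_SL vz).
move=> H; rewrite (maxfE fa) -(cvg_lim _ H)//; apply/esym.
by apply: cvg_lim => //; exact: cvg_cst.
Qed.

Lemma maxf_translate f y : LC f -> maxf (translate y f) = maxf f.
Proof. exact: iv_translate (@maxf_invariant_valuation R n) _ _. Qed.

Lemma iv_hyperplane z f w c : invariant_valuation z -> LC f -> w != 0 ->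
  (forall x, f x != 0 -> dotv w x = c) -> z f = maxf f * z point0.
Proof.
move=> vz Lf w0 fw; have [p fp] : exists x, 0 < f x by case: Lf.
rewrite -(iv_translate vz (- p))// -(maxf_translate (- p))//.
apply: (iv_hyperplane0 vz _ w0); first exact: LC_translate.
move=> x; rewrite /translate opprK => /fw; rewrite dotvDr (fw p) ?gt_eqF//.
by lra.
Qed.

End Restriction.

(** * Simplices and edge splittings *)

Section Simplices.
Context {R : realType} {n : nat}.
Local Notation V := 'cV[R]_n.
Implicit Types (x y : V) (v : 'M[R]_(n, 1 + n)) (l : 'cV[R]_(1 + n))
  (al : 'rV[R]_(1 + n)) (i j k : 'I_(1 + n)) (t : R).

Lemma natr_true : true%:R = 1 :> R. Proof. by []. Qed.

Lemma natr_false : false%:R = 0 :> R. Proof. by []. Qed.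

(* A matrix with 1 + n columns stands for the tuple of its columns, the vertices
   of a simplex. *)
Definition homog m (v : 'M[R]_(n, m)) : 'M[R]_(1 + n, m) :=
  col_mx (const_mx 1) v.

(** In homogeneous coordinates an affine function is a row: entry 0 is its constant term and the
    rest its slope. Accordingly [al *m homog v] is the row of its values at the vertices of [v]. *)
Definition aff al x : R := (al *m homog x) 0 0.

(** The vector [l] holds barycentric coordinates; the first row of the equation says that they add
    up to 1. Degenerate simplices are allowed. *)
Definition simplex v : set V :=
  [set x | exists2 l : 'cV[R]_(1 + n), (forall i, 0 <= l i ord0) &
    homog v *m l = homog x].

Lemma const1_mulmx m p (B : 'M[R]_(m, p)) :
  (forall k : 'I_p, \sum_a B a k = 1) -> const_mx 1 *m B = const_mx 1 :> 'rV[R]_p.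
Proof.
move=> B1; apply/rowP => k; rewrite !mxE -[RHS](B1 k).
by apply: eq_bigr => a _; rewrite mxE mul1r.
Qed.

Lemma homog_mulmx m p (v : 'M[R]_(n, m)) (B : 'M[R]_(m, p)) :
  (forall k : 'I_p, \sum_a B a k = 1) -> homog v *m B = homog (v *m B).
Proof. by move=> B1; rewrite /homog mul_col_mx const1_mulmx. Qed.

Lemma homog_eqP m p (v : 'M[R]_(n, m)) (B : 'M[R]_(m, p)) (x : 'M[R]_(n, p)) :
  homog v *m B = homog x <-> (forall k : 'I_p, \sum_a B a k = 1) /\ v *m B = x.
Proof.
split=> [|[B1 <-]]; last exact: homog_mulmx.
rewrite /homog mul_col_mx => /eq_col_mx[B1 vB]; split=> // k.
move/rowP : B1 => /(_ k); rewrite !mxE => <-.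
by apply: eq_bigr => a _; rewrite mxE mul1r.
Qed.

Lemma homog_inj m : injective (@homog m).
Proof. by move=> x y /eq_col_mx[]. Qed.

Lemma affE al x : aff al x = al 0 0 + dotv (rsubmx al)^T x.
Proof.
rewrite /aff /homog -{1}(hsubmxK al) mul_row_col mxE; congr (_ + _).
  by rewrite mxE big_ord1 !mxE mulr1; congr (al _ _); exact/val_inj.
by rewrite mxE; apply: eq_bigr => a _; rewrite !mxE.
Qed.

Lemma aff_continuous al : continuous (aff al).
Proof.
move=> x; rewrite (_ : aff al = fun x => al 0 0 + dotv (rsubmx al)^T x); last first.
  by apply/funext => y; rewrite affE.
apply: (@cvgD _ _ _ (nbhs x)); first exact: cvg_cst.
exact: dotv_continuous.
Qed.

Lemma aff_comb al x y t :
  aff al (t *: x + (1 - t) *: y) = t * aff al x + (1 - t) * aff al y.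
Proof. by rewrite !affE dotvDr !dotvZr; ring. Qed.

Lemma affD al be x : aff (al + be) x = aff al x + aff be x.
Proof. by rewrite /aff mulmxDl mxE. Qed.

Lemma affN al x : aff (- al) x = - aff al x.
Proof. by rewrite /aff mulNmx mxE. Qed.

Lemma affB al be x : aff (al - be) x = aff al x - aff be x.
Proof. by rewrite affD affN. Qed.

Lemma aff_simplex al v l x : homog v *m l = homog x ->
  aff al x = \sum_i (al *m homog v) 0 i * l i 0.
Proof. by rewrite /aff => <-; rewrite mulmxA mxE. Qed.

Lemma homog_sum1 v l x : homog v *m l = homog x -> \sum_i l i 0 = 1.
Proof. by move=> /homog_eqP[/(_ 0)]. Qed.

Lemma aff_simplex_ge al v c x : (forall i, c <= (al *m homog v) 0 i) ->
  simplex v x -> c <= aff al x.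
Proof.
move=> H [l l0 E]; rewrite (aff_simplex al E) -[c]mulr1 -(homog_sum1 E).
by rewrite mulr_sumr; apply: ler_sum => i _; rewrite ler_wpM2r.
Qed.

Lemma aff_simplex_le al v c x : (forall i, (al *m homog v) 0 i <= c) ->
  simplex v x -> aff al x <= c.
Proof.
move=> H vx; rewrite -lerN2 -affN; apply: aff_simplex_ge vx => i.
by rewrite mulNmx mxE lerN2.
Qed.

Lemma simplex_vertex v i : simplex v (col i v).
Proof.
exists (delta_mx i 0) => [k|]; first by rewrite mxE ler0n.
apply/homog_eqP; split; last by rewrite colE.
move=> k; rewrite (bigD1 i)//= big1 ?addr0 => [|a /negbTE ai].
  by rewrite mxE eqxx ord1.
by rewrite mxE ai.
Qed.

Lemma convexs_simplex v : convexs (simplex v).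
Proof.
move=> x y t /andP[t0 t1] [l l0 lx] [m m0 my].
exists (t *: l + (1 - t) *: m) => [i|].
  by rewrite !mxE addr_ge0// mulr_ge0// ?subr_ge0 ltW.
move/homog_eqP : lx => [l1 <-]; move/homog_eqP : my => [m1 <-].
apply/homog_eqP; split; last by rewrite mulmxDr -!scalemxAr.
move=> k; under eq_bigr do rewrite !mxE.
by rewrite big_split -!mulr_sumr l1 m1 /=; ring.
Qed.

Definition weights : set 'cV[R]_(1 + n) :=
  [set l | (forall i, 0 <= l i ord0) /\ \sum_i l i 0 = 1].

Lemma weights_le1 l i : weights l -> l i 0 <= 1.
Proof. by move=> [l0 <-]; rewrite (bigD1 i)//= lerDl sumr_ge0. Qed.

Lemma compact_weights : compact weights.
Proof.
apply: (@subclosed_compact _ _ [set l : 'cV[R]_(1 + n) | `|l - 0| <= 1]).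
- have -> : weights = \bigcap_(i in [set: 'I_(1 + n)]) [set l : 'cV[R]_(1 + n) | 0 <= l i ord0]
     `&` ([set l | 1 <= dotv (const_mx 1) l]
     `&` [set l | -1 <= dotv (const_mx (-1)) l]).
    have d1 (a : R) l : dotv (const_mx a) l = a * \sum_i l i 0.
      by rewrite mulr_sumr; apply: eq_bigr => i _; rewrite mxE.
    apply/seteqP; split=> l /=; rewrite !d1.
      by move=> [l0 ->]; rewrite !mulr1; split=> // i _; exact: l0.
    move=> [l0 [l1 l2]]; split; first by move=> i; exact: l0.
    by apply/eqP; rewrite eq_le; apply/andP; split; lra.
  apply: closedI; last by apply: closedI; apply: closed_fun_ge;
    exact: dotv_continuous.
  apply: closed_bigI => i _; apply: closed_fun_ge; exact: coord_continuous.
- exact: compact_norm_le.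
- move=> l wl /=; rewrite subr0; apply: norm_le_coord => // i.
  by rewrite ger0_norm; [exact: weights_le1|case: wl].
Qed.

Lemma simplexE v : simplex v = mulmx v @` weights.
Proof.
apply/seteqP; split=> [x [l l0 /homog_eqP[l1 <-]]|_ [l [l0 l1] <-]].
  by exists l => //; split.
by exists l => //; apply/homog_eqP; split=> // k; rewrite ord1.
Qed.

Lemma compact_simplex v : compact (simplex v).
Proof.
rewrite simplexE; apply: continuous_compact; last exact: compact_weights.
by apply: continuous_subspaceT; exact: mulmx_continuous.
Qed.

Lemma closed_simplex v : closed (simplex v).
Proof. exact: (compact_closed (@norm_hausdorff _ _) (@compact_simplex v)). Qed.

Lemma simplex_bounded v : exists B, forall x, simplex v x -> `|x| <= B.
Proof.
exists (\sum_i \sum_j `|v i j|) => x; rewrite simplexE => -[l wl <-].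
apply: le_trans (norm_mulmx_le _ _) _.
rewrite ler_piMr//; first by apply: sumr_ge0 => i _; exact: sumr_ge0.
apply: norm_le_coord => // i.
by rewrite ger0_norm; [exact: weights_le1|case: wl].
Qed.

Lemma LC_exp_simplex (q : V -> R) v : concave q -> continuous q ->
  LC (restr (fun x => expR (q x)) (simplex v)).
Proof.
move=> vq cq; have [B vB] := simplex_bounded v.
apply: (@LC_restr_bounded _ _ _ _ B) => //.
- exact: closed_simplex.
- exact: convexs_simplex.
- by exists (col 0 v); [exact: simplex_vertex|exact: expR_gt0].
- exact: lcu_exp.
Qed.

Lemma concave_aff al : concave (aff al).
Proof. by move=> x y t _; rewrite aff_comb. Qed.

(** Multiplication by this matrix on the right replaces vertex [i] by the point dividing the edge
    from [i] to [j] in the ratio [t] to [1 - t]. The matrices [esplit i j t] and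
    [esplit j i (1 - t)] use the same point and give the two pieces of the simplex. *)
Definition esplit i j t : 'M[R]_(1 + n) :=
  1%:M + t *: (delta_mx j i - delta_mx i i).

Lemma esplit_mull i j t l :
  esplit i j t *m l = l + (t * l i 0) *: (delta_mx j 0 - delta_mx i 0).
Proof.
rewrite /esplit mulmxDl mul1mx -scalemxAl; congr (_ + _).
rewrite -scalerA; congr (_ *: _); apply/colP => a.
have E k : (delta_mx k i *m l) a 0 = (a == k)%:R * l i 0.
  rewrite mxE (bigD1 i)//= big1 ?addr0 => [|b /negbTE bi]; rewrite mxE.
    by rewrite eqxx andbT.
  by rewrite bi andbF mul0r.
rewrite mulmxBl mxE E mxE E !mxE eqxx !andbT; ring.
Qed.

Lemma esplit_mulr i j t (s : 'rV[R]_(1 + n)) k :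
  (s *m esplit i j t) 0 k = s 0 k + (k == i)%:R * (t * (s 0 j - s 0 i)).
Proof.
rewrite /esplit mulmxDr mulmx1 mxE -scalemxAr mxE; congr (_ + _).
have E a : (s *m delta_mx a i) 0 k = s 0 a * (k == i)%:R.
  rewrite mxE (bigD1 a)//= big1 ?addr0 => [|b /negbTE ba]; rewrite mxE.
    by rewrite eqxx.
  by rewrite ba mulr0.
by rewrite mulmxBr mxE E mxE E; ring.
Qed.

Lemma esplit_sum1 i j t k : \sum_a esplit i j t a k = 1.
Proof.
have -> : \sum_a esplit i j t a k = ((const_mx 1 : 'rV[R]_(1 + n)) *m esplit i j t) 0 k.
  by rewrite mxE; apply: eq_bigr => a _; rewrite [const_mx _ _ _]mxE mul1r.
by rewrite esplit_mulr !mxE; ring.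
Qed.

Lemma homog_esplit v i j t :
  homog (v *m esplit i j t) = homog v *m esplit i j t.
Proof. by rewrite homog_mulmx//; exact: esplit_sum1. Qed.

(** The only entry off the diagonal is at [(j, i)], so the matrix or its transpose is lower
    triangular, according to the order of [i] and [j]. *)
Lemma det_esplit i j t : i != j -> \det (esplit i j t) = 1 - t.
Proof.
move=> ij; have nz k (a : 'I_(1 + n)) : esplit i j t k a =
    (k == a)%:R + t * ((k == j)%:R - (k == i)%:R) * (a == i)%:R.
  by rewrite !mxE; case: (k == j); case: (a == i);
    case: (k == i) => /=; ring.
have dg : \prod_k esplit i j t k k = 1 - t.
  rewrite (bigD1 i)//= big1 ?mulr1 => [|k /negbTE ki]; rewrite nz.
    by rewrite !eqxx (negbTE ij) natr_true natr_false; ring.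
  by rewrite ki eqxx natr_true natr_false; ring.
have [ltij|] := boolP (i < j)%N.
  rewrite det_trig ?dg//; apply/is_trig_mxP => k a kl; rewrite nz.
  have /negbTE -> : k != a by rewrite -val_eqE neq_ltn kl.
  have [li|_] := eqVneq a i; last by rewrite mulr0 addr0.
  have /negbTE -> : k != j.
    by rewrite -val_eqE neq_ltn (ltn_trans _ ltij)// -li.
  have /negbTE -> : k != i by rewrite -li -val_eqE neq_ltn kl.
  by rewrite natr_true natr_false; ring.
rewrite -leqNgt leq_eqVlt => /predU1P[ji|ltji].
  by move: ij; rewrite -val_eqE/= ji eqxx.
rewrite -det_tr det_trig; first by rewrite -dg; apply: eq_bigr => k _; rewrite mxE.
apply/is_trig_mxP => a k lk; rewrite mxE nz.
have /negbTE -> : k != a by rewrite -val_eqE neq_ltn lk orbT.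
have [li|_] := eqVneq a i; last by rewrite mulr0 addr0.
have /negbTE -> : k != j.
  by rewrite -val_eqE neq_ltn (ltn_trans ltji) ?orbT// -li.
have /negbTE -> : k != i by rewrite -li -val_eqE neq_ltn lk orbT.
by rewrite natr_true natr_false; ring.
Qed.

Lemma simplex_esplit v i j t : 0 < t < 1 ->
  simplex (v *m esplit i j t) `<=` simplex v.
Proof.
move=> /andP[t0 t1] x [l l0]; rewrite homog_esplit -mulmxA => E.
exists (esplit i j t *m l) => // k; rewrite esplit_mull !mxE eqxx !andbT.
have := l0 k; have := l0 i; have [->|ki] := eqVneq k i => l1 l2.
  have : 0 <= (1 - t) * l i 0 by rewrite mulr_ge0// subr_ge0 ltW.
  by case: (i == j); rewrite ?natr_true ?natr_false; lra.
have := mulr_ge0 (ltW t0) l1.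
by case: (k == j); rewrite ?natr_true ?natr_false; lra.
Qed.

Lemma simplex_esplitU v i j t : i != j -> 0 < t < 1 ->
  simplex v = simplex (v *m esplit i j t) `|` simplex (v *m esplit j i (1 - t)).
Proof.
move=> ij t01; have /andP[t0 t1] := t01.
apply/seteqP; split=> [x [l l0 E]|x]; last first.
  by case; apply: simplex_esplit => //; rewrite subr_gt0 t1 gtrBl.
have half (a b : 'I_(1 + n)) (s : R) : a != b -> 0 < s < 1 ->
    s * l a 0 <= (1 - s) * l b 0 -> simplex (v *m esplit a b s) x.
  move=> ab /andP[s0 s1] lab; have s1' : 0 < 1 - s by rewrite subr_gt0.
  (* The barycentric coordinates of [x] in the piece whose vertex [a] was moved. Coordinate [b] is
     the only one that could become negative, and the assumed inequality excludes this. *)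
  pose m := l + (s / (1 - s) * l a 0) *: (delta_mx a 0 - delta_mx b 0).
  exists m.
    move=> k; rewrite !mxE eqxx !andbT.
    have [->|ka] := eqVneq k a.
      by rewrite (negbTE ab) subr0 mulr1 addr_ge0// !mulr_ge0// ?invr_ge0 ltW.
    have [->|kb] := eqVneq k b; last by rewrite subrr mulr0 addr0.
    rewrite sub0r mulrN1 subr_ge0 mulrAC ler_pdivrMr//.
    by rewrite [leRHS]mulrC.
  rewrite homog_esplit -mulmxA -E; congr (_ *m _).
  rewrite esplit_mull; apply/colP => k; rewrite !mxE !eqxx !andbT (negbTE ab).
  by rewrite natr_true natr_false; field; rewrite gt_eqF.
have [h|h] := leP (t * l i 0) ((1 - t) * l j 0).
  by left; exact: half.
right; apply: half; rewrite 1?eq_sym//.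
  by rewrite subr_gt0 t1 gtrBl.
by lra.
Qed.

(** The pieces lie on opposite sides of the hyperplane through the split point and the vertices
    other than [i] and [j]; the equation is that of this hyperplane in barycentric coordinates. *)
Lemma simplex_esplitI v i j t x : i != j -> 0 < t < 1 ->
  homog v \in unitmx -> simplex (v *m esplit i j t) x ->
  simplex (v *m esplit j i (1 - t)) x ->
  t * (invmx (homog v) *m homog x) i 0 =
  (1 - t) * (invmx (homog v) *m homog x) j 0.
Proof.
move=> ij /andP[t0 t1] uv [l l0 El] [m m0 Em].
set w := invmx _ *m _.
have wl : w = esplit i j t *m l by rewrite /w -El homog_esplit -mulmxA mulKmx.
have wm : w = esplit j i (1 - t) *m m.
  by rewrite /w -Em homog_esplit -mulmxA mulKmx.
have ji : (j == i) = false by rewrite eq_sym (negbTE ij).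
have w1 := congr1 (fun M : 'cV_(1 + n) => M i 0) wl.
have w2 := congr1 (fun M : 'cV_(1 + n) => M j 0) wl.
have w3 := congr1 (fun M : 'cV_(1 + n) => M i 0) wm.
have w4 := congr1 (fun M : 'cV_(1 + n) => M j 0) wm.
move: w1 w2 w3 w4; rewrite !esplit_mull !mxE !eqxx !andbT (negbTE ij) ji.
have := l0 i; have := l0 j; have := m0 i; have := m0 j.
set a := l i 0; set b := l j 0; set c := m i 0; set d := m j 0.
move=> d0 c0 b0 a0 e1 e2 e3 e4; apply/eqP; rewrite eq_le; apply/andP; split.
  have : 0 <= (1 - t) * b by rewrite mulr_ge0// subr_ge0 ltW.
  by rewrite e1 e2 natr_true natr_false; lra.
have := mulr_ge0 (ltW t0) c0.
by rewrite e3 e4 natr_true natr_false; lra.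
Qed.

(** An induction principle over dissections: a property that passes from the two pieces to the whole
    need only be checked on simplices on which prescribed affine functions do not change sign. *)
Definition split_closed (P : 'M[R]_(n, 1 + n) -> Prop) :=
  forall v i j t, i != j -> 0 < t < 1 ->
  P (v *m esplit i j t) -> P (v *m esplit j i (1 - t)) -> P v.

Definition one_sided al v := (forall k, 0 <= (al *m homog v) 0 k) \/
  (forall k, (al *m homog v) 0 k <= 0).

Lemma esplit_ge0 (s : 'rV[R]_(1 + n)) i j t : 0 < t < 1 ->
  (forall k, 0 <= s 0 k) -> forall k, 0 <= (s *m esplit i j t) 0 k.
Proof.
move=> /andP[t0 t1] s0 k; rewrite esplit_mulr; have [->|_] := eqVneq k i.
  rewrite /= mul1r; have := mulr_ge0 (ltW t0) (s0 j).
  have : 0 <= (1 - t) * s 0 i by rewrite mulr_ge0// subr_ge0 ltW.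
  by lra.
by rewrite mul0r addr0.
Qed.

Lemma one_sided_esplit al v i j t : 0 < t < 1 -> one_sided al v ->
  one_sided al (v *m esplit i j t).
Proof.
move=> t01; rewrite /one_sided homog_esplit mulmxA => -[H|H]; [left|right].
  exact: esplit_ge0.
have H' k : 0 <= (- (al *m homog v)) 0 k by rewrite mxE oppr_ge0.
move=> k; have := @esplit_ge0 _ i j t t01 H' k.
by rewrite mulNmx mxE oppr_ge0.
Qed.

(* Splitting an edge at the zero of al lowers the number of vertices at which
   al does not vanish. *)
Lemma split_closed_cut P al : split_closed P ->
  (forall v, one_sided al v -> P v) -> forall v, P v.
Proof.
move=> sP H v; have [m] := ubnP #|[set k : 'I_(1 + n) | ((al *m homog v) ord0 k != 0)%R]%SET|.
elim: m v => // m IH v; rewrite ltnS => vm.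
have [pv|npv] := pselect (one_sided al v); first exact: H.
have [i ai] : exists i, (al *m homog v) 0 i < 0.
  apply: contrapT => nE; apply: npv; left => k; rewrite leNgt; apply/negP => ak.
  by apply: nE; exists k.
have [j aj] : exists j, 0 < (al *m homog v) 0 j.
  apply: contrapT => nE; apply: npv; right => k; rewrite leNgt; apply/negP => ak.
  by apply: nE; exists k.
have ij : i != j by apply/eqP => ij; move: ai aj; rewrite ij; lra.
move: ai aj vm; set s := al *m homog v => ai aj vm.
have d0 : 0 < s 0 j - s 0 i by rewrite subr_gt0 (lt_trans ai).
pose t := - s 0 i / (s 0 j - s 0 i).
have t01 : 0 < t < 1.
  by rewrite divr_gt0 ?oppr_gt0//= ltr_pdivrMr// mul1r; lra.
have dec a b (r : R) : s 0 a != 0 -> s 0 a + r * (s 0 b - s 0 a) = 0 ->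
    (#|[set k : 'I_(1 + n) |
       ((al *m homog (v *m esplit a b r)) ord0 k != 0)%R]%SET| < m)%N.
  move=> sa e; apply: leq_trans vm; apply: proper_card; apply/properP.
  rewrite homog_esplit mulmxA -/s; split.
    apply/fintype.subsetP => k; rewrite !inE esplit_mulr.
    have [->|_] := eqVneq k a; first by [].
    by rewrite mul0r addr0.
  by exists a; rewrite inE// esplit_mulr eqxx mul1r e eqxx.
apply: (sP v i j t) => //; apply: IH; apply: dec.
- by rewrite lt_eqF.
- by rewrite /t; field; rewrite gt_eqF.
- by rewrite gt_eqF.
- by rewrite /t; field; rewrite gt_eqF.
Qed.

(** A further split of a one-sided simplex leaves it one-sided, so the cuts made for one function
    are not spoiled by those for the next. *)
Lemma split_closed_cuts P (als : seq 'rV[R]_(1 + n)) : split_closed P ->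
  (forall v, (forall al, al \in als -> one_sided al v) -> P v) -> forall v, P v.
Proof.
move=> sP; elim: als => [|al als IH] H; first by move=> v; exact: H.
apply: IH => v vals; move: vals.
pose Q v := (forall be, be \in als -> one_sided be v) -> P v.
rewrite -/(Q v); move: v; apply: (@split_closed_cut Q al).
  move=> v i j t ij t01 Q1 Q2 vals; apply: (sP v i j t) => //.
    by apply: Q1 => be /vals; exact: one_sided_esplit.
  apply: Q2 => be /vals; apply: one_sided_esplit; have /andP[t0 t1] := t01.
  by rewrite subr_gt0 t1 gtrBl.
move=> v va vals; apply: H => be; rewrite inE => /predU1P[->//|]; exact: vals.
Qed.

End Simplices.

(** * Exponentials of affine functions on simplices *)

Section SimpleValuation.
Context {R : realType} {n : nat}.
Local Notation V := 'cV[R]_n.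
Implicit Types (x y : V) (v : 'M[R]_(n, 1 + n)) (al : 'rV[R]_(1 + n))
  (s : 'rV[R]_(1 + n)) (i j k : 'I_(1 + n)) (t : R) (f q : V -> R).

Definition expsimplex q v : V -> R := restr (fun x => expR (q x)) (simplex v).

Lemma expsimplex_congr q q' v : (forall x, simplex v x -> q x = q' x) ->
  expsimplex q v = expsimplex q' v.
Proof.
move=> qq; apply/funext => x; rewrite /expsimplex /restr.
by case: ifP => // /set_mem /qq ->.
Qed.

Lemma cvg_aff {T : Type} (F : set_system T) {FF : Filter F}
    (al_ : T -> 'rV[R]_(1 + n)) al (x_ : T -> V) x :
  (forall i, al_ t 0 i @[t --> F] --> al 0 i) -> x_ @ F --> x ->
  aff (al_ t) (x_ t) @[t --> F] --> aff al x.
Proof.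
move=> ca cx; rewrite affE; under eq_fun do rewrite affE.
apply: cvgD; first exact: ca.
apply: cvg_big => [|i _]; first exact: add_continuous.
apply: cvgM; last exact: cvg_coord.
by rewrite !mxE; under eq_fun do rewrite !mxE; exact: ca.
Qed.

Lemma norm_mulmx_weights m (A : 'M[R]_(m, 1 + n)) l : weights l ->
  `|A *m l| <= \sum_i \sum_j `|A i j|.
Proof.
move=> wl; apply: le_trans (norm_mulmx_le _ _) _.
rewrite ler_piMr//; first by apply: sumr_ge0 => i _; exact: sumr_ge0.
apply: norm_le_coord => // i.
by rewrite ger0_norm; [exact: weights_le1|case: wl].
Qed.

(** Weights are bounded, so points with the same weights in the moving simplex and in the limit
    simplex are uniformly close. This keeps the moving simplices away from outer points and also
    provides the recovery sequences; the limit may be degenerate. *)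
Lemma hypo_expsimplex (al_ : nat -> 'rV[R]_(1 + n)) al
    (v_ : nat -> 'M[R]_(n, 1 + n)) v :
  (forall i, al_ m 0 i @[m --> \oo] --> al 0 i) ->
  (forall a i, v_ m a i @[m --> \oo] --> v a i) ->
  hypo (fun m => expsimplex (aff (al_ m)) (v_ m)) (expsimplex (aff al) v).
Proof.
move=> ca cv.
have cvs : \sum_a \sum_i `|(v_ m - v) a i| @[m --> \oo] --> (0 : R).
  rewrite [X in _ --> X](_ : 0 = \sum_(a < n) \sum_(i < 1 + n) `|v a i - v a i|);
    last by rewrite big1// => a _; rewrite big1// => i _; rewrite subrr normr0.
  apply: cvg_big => [|a _]; first exact: add_continuous.
  apply: cvg_big => [|i _]; first exact: add_continuous.
  under eq_fun do rewrite !mxE.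
  apply: cvg_norm; apply: cvgB; [exact: cv|exact: cvg_cst].
have hs : hypo_sup (fun m => expsimplex (aff (al_ m)) (v_ m))
    (expsimplex (aff al) v).
  move=> x c; have [vx|vx] := pselect (simplex v x).
    rewrite /expsimplex restrT// => xc.
    have : expR (aff (al_ p.2) p.1) @[p --> filter_prod (nbhs x) \oo] -->
        expR (aff al x).
      apply: continuous_cvg; first exact: continuous_expR.
      apply: cvg_aff => [i|]; last exact: cvg_fst.
      exact: (cvg_comp _ _ cvg_snd (ca i)).
    move=> /cvgr_lt /(_ _ xc); apply: filterS => p; apply: le_lt_trans.
    by apply: restr_le => y; exact: expR_ge0.
  rewrite /expsimplex restrF// => c0.
  have : nbhs x (~` simplex v).
    by apply: open_nbhs_nbhs; split=> //; apply: closed_openC; exact: closed_simplex.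
  move=> /nbhs_ballP[e e0 He].
  have e2 : 0 < e / 2 by rewrite divr_gt0.
  exists (ball x (e / 2), [set m | \sum_a \sum_i `|(v_ m - v) a i| < e / 2]).
    by split; [exact: nbhsx_ballx|exact: (cvgr_lt _ cvs)].
  move=> [y k] [/= xy vk]; rewrite restrF// simplexE => -[l wl vl].
  apply: (He (v *m l)); last by rewrite simplexE; exists l.
  move: xy; rewrite !mx_norm_ball /ball_ /= => xy.
  have : `|(v_ k - v) *m l| < e / 2.
    exact: le_lt_trans (norm_mulmx_weights _ wl) vk.
  rewrite mulmxBl vl => yl.
  have := ler_normD (x - y) (y - v *m l); rewrite addrA subrK.
  by lra.
split=> // x; have [vx|vx] := pselect (simplex v x).
  move: (vx); rewrite simplexE => -[l wl vl].
  have cx : v_ m *m l @[m --> \oo] --> x.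
    rewrite -vl; apply: cvg_cV => a; rewrite mxE; under eq_fun do rewrite mxE.
    apply: cvg_big => [|i _]; first exact: add_continuous.
    by apply: cvgM; [exact: cv|exact: cvg_cst].
  have e m : expsimplex (aff (al_ m)) (v_ m) (v_ m *m l) =
      expR (aff (al_ m) (v_ m *m l)).
    by rewrite /expsimplex restrT// simplexE; exists l.
  exists (fun m => v_ m *m l) => //; under eq_fun do rewrite e.
  have -> : expsimplex (aff al) v x = expR (aff al x) by exact: restrT.
  apply: continuous_cvg; first exact: continuous_expR.
  exact: cvg_aff.
exists (fun=> x); first exact: cvg_cst.
have e0 : expsimplex (aff al) v x = 0 by rewrite /expsimplex restrF.
rewrite e0; apply/cvgrPdist_lt => e ep.
have [|[U W] /= [Ux Wo] UW] := hs x e; first by rewrite e0.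
apply: filterS Wo => k Wk; rewrite sub0r normrN ger0_norm.
  by apply: (UW (x, k)); split=> //=; exact: nbhs_singleton.
by apply: restr_ge0 => y; exact: expR_ge0.
Qed.

Context (z : (V -> R) -> R) (vz : invariant_valuation z) (z0 : z point0 = 0).

Lemma simple_hyperplane f al : LC f -> al != 0 ->
  (forall x, f x != 0 -> aff al x = 0) -> z f = 0.
Proof.
move=> Lf al0 fal; have [p fp] : exists x, 0 < f x by case: Lf.
have [w0|w0] := eqVneq (rsubmx al)^T 0; last first.
  rewrite (iv_hyperplane (c := - al 0 0) vz Lf w0) ?z0 ?mulr0// => x /fal.
  by rewrite affE; lra.
have w0' : rsubmx al = 0 by rewrite -[LHS]trmxK w0 trmx0.
have : aff al p = 0 by apply: fal; rewrite gt_eqF.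
rewrite affE w0 dotv0l addr0 => a0; move/eqP : al0; case.
rewrite -[LHS]hsubmxK w0'; apply/rowP => i; rewrite !mxE.
case: splitP => k _; rewrite ?mxE//.
by rewrite -[RHS]a0; congr (al _ _); rewrite [k]ord1; exact/val_inj.
Qed.

(** A linear relation between the rows of [homog v] is an affine function vanishing at all vertices,
    hence on the simplex. *)
Lemma simple_degenerate q v : concave q -> continuous q ->
  homog v \notin unitmx -> z (expsimplex q v) = 0.
Proof.
move=> vq cq nu.
have [al al0 alv] : exists2 al : 'rV_(1 + n), al != 0 & al *m homog v = 0.
  apply: contrapT => nE; move/negP : nu; apply; rewrite -row_free_unit.
  apply: inj_row_free => al alv; apply/eqP; apply: contrapT => /negP al0.
  by apply: nE; exists al.
apply: (simple_hyperplane _ al0); first exact: LC_exp_simplex.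
move=> x /restr_neq0 vx; apply/eqP; rewrite eq_le.
rewrite (aff_simplex_le _ vx) ?(aff_simplex_ge _ vx)// => i; by rewrite alv mxE.
Qed.

Lemma simple_esplit q v i j t : concave q -> continuous q -> i != j ->
  0 < t < 1 -> z (expsimplex q v) = z (expsimplex q (v *m esplit i j t)) +
    z (expsimplex q (v *m esplit j i (1 - t))).
Proof.
move=> vq cq ij t01; have /andP[t0 t1] := t01.
have t01' : 0 < 1 - t < 1 by rewrite subr_gt0 t1 gtrBl.
have [uv|nuv] := boolP (homog v \in unitmx); last first.
  rewrite !simple_degenerate ?addr0// homog_esplit unitmx_mul (negbTE nuv)//.
pose T1 := simplex (v *m esplit i j t).
pose T2 := simplex (v *m esplit j i (1 - t)).
pose F x := expR (q x).
have LI : LC (restr F (T1 `&` T2)).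
  have [B vB] := simplex_bounded v.
  apply: (@LC_restr_bounded _ _ _ _ B).
  - by apply: closedI; exact: closed_simplex.
  - move=> x y r r01 [x1 x2] [y1 y2].
    by split; apply: convexs_simplex.
  - by move=> x [/(simplex_esplit t01)/vB].
  (* The split point is a common vertex, so the restriction to the intersection is not identically
     zero. *)
  - exists (col i (v *m esplit i j t)); last exact: expR_gt0.
    split; first exact: simplex_vertex.
    suff -> : col i (v *m esplit i j t) = col j (v *m esplit j i (1 - t)).
      exact: simplex_vertex.
    apply/colP => a; rewrite !mxE.
    have E k l r : \sum_b v a b * esplit k l r b k =
        v a k + r * (v a l - v a k).
      have := esplit_mulr k l r (row a v) k.
      rewrite eqxx mul1r [row a v 0 k]mxE [row a v 0 l]mxE => <-.
      by rewrite mxE; apply: eq_bigr => b _; rewrite [row _ _ _ _]mxE.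
    by rewrite !E; ring.
  - exact: lcu_exp.
have eM : restr F T1 \max restr F T2 = restr F (simplex v).
  apply/funext => x; rewrite (simplex_esplitU v ij t01) -/T1 -/T2 /=.
  have F0 : 0 <= F x by exact: expR_ge0.
  have [x1|x1] := pselect (T1 x); have [x2|x2] := pselect (T2 x).
  - by rewrite !restrT ?maxxx//; left.
  - by rewrite (restrT _ x1) (restrF _ x2) restrT; [rewrite max_l|left].
  - by rewrite (restrT _ x2) (restrF _ x1) restrT; [rewrite max_r|right].
  - by rewrite !restrF ?maxxx//; case.
have em : restr F T1 \min restr F T2 = restr F (T1 `&` T2).
  apply/funext => x /=; have F0 : 0 <= F x by exact: expR_ge0.
  have [x1|x1] := pselect (T1 x); have [x2|x2] := pselect (T2 x).
  - by rewrite !restrT ?minxx.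
  - by rewrite (restrT _ x1) (restrF _ x2) restrF; [rewrite min_r|case].
  - by rewrite (restrT _ x2) (restrF _ x1) restrF; [rewrite min_l|case].
  - by rewrite !restrF ?minxx//; case.
have := iv_val vz (LC_exp_simplex (v *m esplit i j t) vq cq)
  (LC_exp_simplex (v *m esplit j i (1 - t)) vq cq).
rewrite -/F -/T1 -/T2 eM em => /(_ (LC_exp_simplex v vq cq) LI) => <-.
rewrite (_ : z (restr F (T1 `&` T2)) = 0) ?addr0//.
(* The affine function [t * w_i - (1 - t) * w_j] in the barycentric coordinates [w]; it vanishes on
   the common face of the two pieces. *)
pose ga : 'rV[R]_(1 + n) := (t *: delta_mx 0 i - (1 - t) *: delta_mx 0 j)
  *m invmx (homog v).
apply: (@simple_hyperplane _ ga) => //.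
  apply/eqP => ga0; have : (ga *m homog v) 0 i = 0 by rewrite ga0 mul0mx mxE.
  rewrite /ga mulmxKV// !mxE !eqxx (negbTE ij) natr_true natr_false; lra.
move=> x /restr_neq0 [x1 x2].
have e := simplex_esplitI ij t01 uv x1 x2.
rewrite /aff /ga -mulmxA mulmxBl -!scalemxAl -!rowE.
by move: e; set w := invmx _ *m _; rewrite !mxE => ->; ring.
Qed.

(** The matrix [B] carries the vertices of [v] to those of [v']. Both homogeneous matrices have
    first row 1, which makes [B] an affine map, and the equality of determinants puts its linear
    part in SL(n). *)
Lemma simple_congr al al' v v' : \det (homog v) != 0 ->
  \det (homog v') = \det (homog v) -> al' *m homog v' = al *m homog v ->
  z (expsimplex (aff al') v') = z (expsimplex (aff al) v).
Proof.
move=> dv dv' alv.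
have uv : homog v \in unitmx by rewrite unitmxE unitfE.
have uv' : homog v' \in unitmx by rewrite unitmxE unitfE dv'.
pose B := homog v' *m invmx (homog v).
have Bv : B *m homog v = homog v' by rewrite /B mulmxKV.
have uB : B \in unitmx by rewrite unitmx_mul uv' unitmx_inv.
pose A := drsubmx B; pose b := dlsubmx B.
have BE : B = block_mx 1%:M 0 b A.
  rewrite -[LHS]submxK; suff : usubmx B = row_mx 1%:M 0.
    by move=> e; rewrite /ulsubmx /ursubmx e row_mxKl row_mxKr.
  have : usubmx B *m homog v = usubmx (homog v') by rewrite mul_usub_mx Bv.
  have : row_mx 1%:M 0 *m homog v = usubmx (homog v').
    by rewrite /homog mul_row_col mul1mx mul0mx addr0 col_mxKu.
  by move=> <- /(can_inj (mulmxK uv)).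
have Bx x : B *m homog x = homog (A *m x + b).
  rewrite BE /homog mul_block_col mul1mx mul0mx addr0; congr col_mx.
  rewrite addrC; congr (_ + _); apply/colP => a.
  by rewrite [LHS]mxE big_ord1 [X in _ * X]mxE mulr1.
have dA : \det A = 1.
  have := congr1 determinant Bv; rewrite det_mulmx dv' BE det_lblock det1 mul1r.
  by rewrite -[RHS]mul1r; exact: mulIf.
have Ts x : simplex v' (A *m x + b) <-> simplex v x.
  split=> -[l l0 E]; exists l => //.
    by apply: (can_inj (mulKmx uB)); rewrite mulmxA Bv E Bx.
  by rewrite -Bx -E mulmxA Bv.
have aE x : aff al' (A *m x + b) = aff al x.
  by rewrite /aff -Bx mulmxA /B mulmxA alv mulmxK.
have LA : LC (expsimplex (aff al') v').
  by apply: LC_exp_simplex; [exact: concave_aff|exact: aff_continuous].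
rewrite -(iv_translate vz (- b) LA) -(iv_SL vz _ dA); last exact: LC_translate.
congr z; apply/funext => x; rewrite /translate /= opprK /expsimplex.
have [vx|vx] := pselect (simplex v x).
  by rewrite !restrT ?aE//; exact/Ts.
by rewrite !restrF//; apply: contra_not vx => /Ts.
Qed.

Context (n1 : (1 < n)%N).

Definition stddiag (W : R) : 'rV[R]_n :=
  \row_k if k == Ordinal (ltnW n1) then W else 1.

(** A reference simplex of determinant [W]: the origin, [W] times the first basis vector and the
    other basis vectors. A negative [W] gives the opposite orientation. *)
Definition stdsimplex (W : R) : 'M[R]_(n, 1 + n) :=
  row_mx 0 (diag_mx (stddiag W)).

Definition stdaff s (W : R) : 'rV[R]_(1 + n) :=
  row_mx (lsubmx s) (\row_k ((rsubmx s 0 k - s 0 0) / stddiag W 0 k)).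

(** By [simple_congr], only the vertex values [s] and the determinant [W] matter; for non-zero [W]
    this is [z] as a function of the two. *)
Definition stdval s (W : R) := z (expsimplex (aff (stdaff s W)) (stdsimplex W)).

Lemma det_stdsimplex W : \det (homog (stdsimplex W)) = W.
Proof.
have -> : homog (stdsimplex W) =
    block_mx 1%:M (const_mx 1) 0 (diag_mx (stddiag W)).
  rewrite /homog /stdsimplex block_mxEv; congr col_mx.
  rewrite -[LHS]hsubmxK; congr row_mx; apply/matrixP => a b; rewrite !mxE//.
  by rewrite (ord1 a) (ord1 b).
rewrite det_ublock det1 mul1r det_diag (bigD1 (Ordinal (ltnW n1)))//=.
by rewrite big1 ?mulr1 ?mxE ?eqxx// => k /negbTE nk; rewrite mxE nk.
Qed.

Lemma row_mx_lsub00 s (w : 'rV[R]_n) : row_mx (lsubmx s) w 0 0 = s 0 0.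
Proof.
rewrite mxE; case: splitP => // k _; rewrite !mxE [k]ord1; congr (s _ _).
exact/val_inj.
Qed.

Lemma stdaffE s W : W != 0 -> stdaff s W *m homog (stdsimplex W) = s.
Proof.
move=> W0; rewrite /homog mul_row_col /stdsimplex mul_mx_row mulmx0.
have lE : lsubmx s *m const_mx 1 = const_mx (s 0 0) :> 'rV[R]_(1 + n).
  apply/rowP => a; rewrite mxE big_ord1 !mxE mulr1; congr (s _ _); exact/val_inj.
rewrite lE -[RHS]hsubmxK -[X in X + _]hsubmxK add_row_mx; congr row_mx.
  by apply/rowP => a; rewrite !mxE addr0 [a]ord1; congr (s _ _); exact/val_inj.
apply/rowP => a; rewrite mul_mx_diag !mxE divfK; last first.
  by case: ifP => // _; exact: oner_neq0.
by rewrite addrC subrK.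
Qed.

Lemma simple_stdval al v : \det (homog v) != 0 ->
  z (expsimplex (aff al) v) = stdval (al *m homog v) (\det (homog v)).
Proof.
move=> dv; rewrite /stdval; apply: simple_congr; rewrite ?det_stdsimplex//.
by rewrite stdaffE.
Qed.

Lemma stdval_esplit s W i j t : W != 0 -> i != j -> 0 < t < 1 ->
  stdval s W = stdval (s *m esplit i j t) ((1 - t) * W) +
    stdval (s *m esplit j i (1 - t)) (t * W).
Proof.
move=> W0 ij t01; have /andP[t0 t1] := t01.
have t1' : 1 - t != 0 by rewrite subr_eq0 gt_eqF.
have d1 : \det (homog (stdsimplex W *m esplit i j t)) = (1 - t) * W.
  by rewrite homog_esplit det_mulmx det_stdsimplex det_esplit// mulrC.
have d2 : \det (homog (stdsimplex W *m esplit j i (1 - t))) = t * W.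
  by rewrite homog_esplit det_mulmx det_stdsimplex det_esplit 1?eq_sym// subKr mulrC.
rewrite {1}/stdval (simple_esplit (stdsimplex W) (@concave_aff _ _ _)
  (@aff_continuous _ _ _) ij t01).
rewrite (simple_stdval _ (v := stdsimplex W *m esplit i j t)) ?d1; last first.
  by rewrite mulf_neq0.
rewrite (simple_stdval _ (v := stdsimplex W *m esplit j i (1 - t))) ?d2; last first.
  by rewrite mulf_neq0// gt_eqF.
by rewrite !homog_esplit !mulmxA stdaffE.
Qed.

Lemma stdval_shift s (c W : R) : W != 0 ->
  stdval (s + const_mx c) W = expR c * stdval s W.
Proof.
move=> W0; rewrite /stdval -(iv_scale vz) ?expR_gt0//; last first.
  by apply: LC_exp_simplex; [exact: concave_aff|exact: aff_continuous].
congr z; apply/funext => x; rewrite /expsimplex /restr; case: ifP; rewrite ?mulr0//.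
move=> _; rewrite -expRD; congr expR; rewrite !affE /stdaff !row_mxKr.
rewrite !row_mx_lsub00 [(s + _) 0 0]mxE [const_mx c 0 0]mxE.
rewrite [s 0 0 + c]addrC -addrA; congr (_ + (_ + dotv _ _)).
by apply/colP => k; rewrite !mxE; congr (_ / _); ring.
Qed.

(** Exchanging two vertices leaves the simplex unchanged as a set but reverses the sign of the
    determinant; equal values at these vertices keep [s] fixed. *)
Lemma stdval_swap s W i j : W != 0 -> i != j -> s 0 i = s 0 j ->
  stdval s (- W) = stdval s W.
Proof.
move=> W0 ij sij.
pose v := stdsimplex W; pose P : 'M[R]_(1 + n) := tperm_mx i j.
have P1 k : \sum_a P a k = 1.
  rewrite (bigD1 (tperm i j k))//= big1 ?addr0; first by rewrite !mxE tpermK eqxx.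
  move=> a ak; rewrite !mxE; case: eqP => // e.
  by move: ak; rewrite -e tpermK eqxx.
have hP : homog (v *m P) = homog v *m P by rewrite homog_mulmx.
have PP : P *m P = 1%:M by rewrite -perm_mxM tperm2 perm_mx1.
have sub (u : 'M[R]_(n, 1 + n)) : simplex (u *m P) `<=` simplex u.
  move=> x [l l0]; rewrite -homog_mulmx// -mulmxA => E; exists (P *m l) => // k.
  rewrite -row_permE mxE; exact: l0.
have eT : simplex (v *m P) = simplex v.
  apply/seteqP; split; first exact: sub.
  by rewrite -{1}[v]mulmx1 -PP mulmxA; exact: sub.
have dP : \det (homog (v *m P)) = - W.
  by rewrite hP det_mulmx det_stdsimplex det_perm odd_tperm ij expr1 mulrN1.
have sP : s *m P = s.
  apply/rowP => k; rewrite -xcolE mxE.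
  by case: tpermP => [->|->|//].
have := @simple_stdval (stdaff s W) (v *m P); rewrite dP oppr_eq0 => /(_ W0).
rewrite hP mulmxA stdaffE// sP => <-.
by rewrite /stdval /expsimplex eT.
Qed.

(** When the values at the ends of the cut edge agree, both pieces carry the vertex values [s]
    again, and [stdval_esplit] becomes Cauchy's equation. *)
Lemma stdval_add s (a b : R) i j : 0 < a -> 0 < b -> i != j -> s 0 i = s 0 j ->
  stdval s (a + b) = stdval s a + stdval s b.
Proof.
move=> a0 b0 ij sij; have ab0 : 0 < a + b by rewrite addr_gt0.
have t01 : 0 < b / (a + b) < 1.
  by rewrite divr_gt0//= ltr_pdivrMr// mul1r ltrDr.
rewrite (stdval_esplit s _ ij t01) ?gt_eqF//.
have E k l t : s 0 k = s 0 l -> s *m esplit k l t = s.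
  move=> kl; apply/rowP => m; rewrite esplit_mulr kl.
  by rewrite subrr !mulr0 addr0.
have ea : (1 - b / (a + b)) * (a + b) = a by field; rewrite gt_eqF.
have eb : b / (a + b) * (a + b) = b by rewrite divfK// gt_eqF.
by rewrite ea eb (E i j _ sij) (E j i _ (esym sij)).
Qed.

Lemma stdval_cvg (s_ : nat -> 'rV[R]_(1 + n)) s (W_ : nat -> R) (W : R) :
  0 < W -> (forall i, s_ m 0 i @[m --> \oo] --> s 0 i) -> W_ @ \oo --> W ->
  stdval (s_ m) (W_ m) @[m --> \oo] --> stdval s W.
Proof.
move=> W0 cs cW; apply: (iv_cont vz) => [m||].
- by apply: LC_exp_simplex; [exact: concave_aff|exact: aff_continuous].
- by apply: LC_exp_simplex; [exact: concave_aff|exact: aff_continuous].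
have cd a : stddiag (W_ m) 0 a @[m --> \oo] --> stddiag W 0 a.
  rewrite mxE; under eq_fun do rewrite mxE.
  by case: ifP => // _; exact: cvg_cst.
apply: hypo_expsimplex => [i|a i].
  rewrite mxE; under eq_fun do rewrite mxE.
  case: splitP => k _; rewrite !mxE; under eq_fun do rewrite !mxE.
    exact: cs.
  apply: cvgM; first by apply: cvgB; exact: cs.
  apply: cvgV.
    by case: ifP => _; rewrite ?oner_neq0// gt_eqF.
  by have := cd k; rewrite mxE; under eq_fun do rewrite mxE.
rewrite mxE; under eq_fun do rewrite mxE.
case: splitP => k _; first exact: cvg_cst.
rewrite !mxE; under eq_fun do rewrite !mxE.
rewrite mulrb; under eq_fun do rewrite mulrb.
case: (a == k); last exact: cvg_cst.
by have := cd a; rewrite mxE; under eq_fun do rewrite mxE.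
Qed.

Lemma stdval_linear s (W : R) i j : 0 < W -> i != j -> s 0 i = s 0 j ->
  stdval s W = W * stdval s 1.
Proof.
move=> W0 ij sij.
have nat_lin (a : R) m : 0 < a -> stdval s (m.+1%:R * a) = m.+1%:R * stdval s a.
  move=> a0; elim: m => [|m IH]; first by rewrite !mul1r.
  have -> : m.+2%:R * a = m.+1%:R * a + a by rewrite -natr1; ring.
  by rewrite (stdval_add _ a0 ij sij) ?mulr_gt0// IH -[m.+2%:R]natr1; ring.
have rat_lin p m : stdval s (p.+1%:R / m.+1%:R) = p.+1%:R / m.+1%:R * stdval s 1.
  have m0 : (0 : R) < m.+1%:R^-1 by rewrite invr_gt0.
  have mm : m.+1%:R * m.+1%:R^-1 = 1 :> R by rewrite mulfV// pnatr_eq0.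
  have h1 := nat_lin _ p m0; have h2 := nat_lin _ m m0; rewrite mm in h2.
  by rewrite h1 h2 mulrA divfK; [|rewrite pnatr_eq0].
(* Rational approximations from above; the successor keeps the numerators positive, as [rat_lin]
   requires. *)
pose W_ m : R := (Num.truncn (m.+1%:R * W)).+1%:R / m.+1%:R.
have W_W : W_ @ \oo --> W.
  apply/cvgrPdist_le => e e0; near=> m.
  have m0 : (0 : R) < m.+1%:R by [].
  have mW : 0 <= m.+1%:R * W by rewrite mulr_ge0// ltW.
  have /andP[h1 h2] := truncn_itv mW.
  have h3 : m.+1%:R^-1 <= e.
    by near: m; have [N _ H] := near_infty_natSinv_lt (PosNum e0);
      exists N => // m /H /ltW.
  have b1 : W <= W_ m by rewrite ler_pdivlMr// mulrC ltW.
  have b2 : W_ m <= W + e.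
    rewrite ler_pdivrMr// mulrDl -natr1 [W * _]mulrC lerD//.
    by rewrite -ler_pdivrMr// div1r.
  by rewrite ler_norml; apply/andP; split; lra.
have c1 : stdval s (W_ m) @[m --> \oo] --> stdval s W.
  by apply: (@stdval_cvg (fun=> s)) => // a; exact: cvg_cst.
have c2 : stdval s (W_ m) @[m --> \oo] --> W * stdval s 1.
  under eq_fun do rewrite rat_lin.
  by apply: (cvgM W_W); exact: cvg_cst.
rewrite -(cvg_lim _ c2)//; apply/esym.
by rewrite -(cvg_lim _ c1).
Unshelve. all: by end_near.
Qed.

Lemma stdval_linear_abs s (W : R) i j : W != 0 -> i != j -> s 0 i = s 0 j ->
  stdval s W = `|W| * stdval s 1.
Proof.
move=> W0 ij sij; have [Wp|Wn] := ltP 0 W.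
  by rewrite gtr0_norm// (stdval_linear Wp ij sij).
have Wn' : 0 < - W by rewrite oppr_gt0 lt_neqAle W0.
rewrite ler0_norm// -(stdval_linear Wn' ij sij).
by rewrite (stdval_swap W0 ij sij).
Qed.

Lemma three_sorted s : exists i j k,
  [/\ i != j, j != k & i != k] /\ s 0 i <= s 0 j <= s 0 k.
Proof.
pose a : 'I_(1 + n) := @Ordinal (1 + n) 0 isT.
pose b : 'I_(1 + n) := @Ordinal (1 + n) 1 (ltnW n1).
pose c : 'I_(1 + n) := @Ordinal (1 + n) 2 n1.
have [ab bc ac] : [/\ a != b, b != c & a != c] by split; rewrite -val_eqE.
have [ba cb ca] : [/\ b != a, c != b & c != a] by split; rewrite -val_eqE.
have [h1|/ltW h1] := leP (s 0 a) (s 0 b); have [h2|/ltW h2] := leP (s 0 b) (s 0 c);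
  have [h3|/ltW h3] := leP (s 0 a) (s 0 c).
- by exists a, b, c; rewrite h1 h2.
- by exists a, b, c; rewrite h1 h2.
- by exists a, c, b; rewrite h3 h2.
- by exists c, a, b; rewrite h3 h1.
- by exists b, a, c; rewrite h3 h1.
- by exists b, c, a; rewrite h3 h2.
- by exists c, b, a; rewrite h1 h2.
- by exists c, b, a; rewrite h1 h2.
Qed.

(* Splitting the edge that joins the vertices with smallest and largest value
   at the middle value produces simplices on which two values coincide. *)
Lemma stdval_abs s (W : R) : W != 0 -> stdval s W = `|W| * stdval s 1.
Proof.
move=> W0; have [i [j [k [[ij jk ik] /andP[sij sjk]]]]] := three_sorted s.
have [e|nij] := eqVneq (s 0 i) (s 0 j); first exact: stdval_linear_abs ij e.
have [e|njk] := eqVneq (s 0 j) (s 0 k); first exact: stdval_linear_abs jk e.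
have {nij}sij : s 0 i < s 0 j by rewrite lt_neqAle nij.
have {njk}sjk : s 0 j < s 0 k by rewrite lt_neqAle njk.
have ik0 : 0 < s 0 k - s 0 i by rewrite subr_gt0 (lt_trans sij).
pose t := (s 0 j - s 0 i) / (s 0 k - s 0 i).
have t01 : 0 < t < 1.
  apply/andP; split; first by apply: divr_gt0 => //; rewrite subr_gt0.
  by rewrite /t ltr_pdivrMr// mul1r; lra.
have /andP[t0 t1] := t01.
pose s1 := s *m esplit i k t; pose s2 := s *m esplit k i (1 - t).
have e1 : s1 0 i = s1 0 j.
  rewrite !esplit_mulr eqxx eq_sym (negbTE ij) natr_true natr_false /t.
  by field; rewrite gt_eqF.
have e2 : s2 0 j = s2 0 k.
  rewrite !esplit_mulr eqxx (negbTE jk) natr_true natr_false /t.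
  by field; rewrite gt_eqF.
have t1' : 1 - t != 0 by rewrite subr_eq0 gt_eqF.
have t0' : t != 0 by rewrite gt_eqF.
(* The second factor does not depend on [W'], so the cases [W] and 1 can be compared. *)
have lin W' : W' != 0 ->
    stdval s W' = `|W'| * ((1 - t) * stdval s1 1 + t * stdval s2 1).
  move=> W'0; rewrite (stdval_esplit s W'0 ik t01) -/s1 -/s2.
  rewrite (stdval_linear_abs (mulf_neq0 t1' W'0) ij e1).
  rewrite (stdval_linear_abs (mulf_neq0 t0' W'0) jk e2).
  rewrite (normrM (1 - t)) (normrM t) (gtr0_norm t0) (gtr0_norm (_ : 0 < 1 - t)).
    by move: (stdval s1 1) (stdval s2 1) => A B; ring.
  by rewrite subr_gt0.
have h1 := lin W W0; have h2 := lin 1 (oner_neq0 _).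
by rewrite h1 h2 normr1 mul1r.
Qed.

End SimpleValuation.

(** * Valuations vanishing on a point and on a simplex *)

Lemma subr_mxE (V : zmodType) p q (A B : 'M[V]_(p, q)) i j :
  (A - B) i j = A i j - B i j.
Proof. by rewrite !mxE. Qed.

Section Approximation.
Context {R : realType} {n : nat}.
Local Notation V := 'cV[R]_n.
Implicit Types (x y p : V) (v : 'M[R]_(n, 1 + n)) (al : 'rV[R]_(1 + n))
  (f q : V -> R).

Definition affcst (c : R) : 'rV[R]_(1 + n) := row_mx (const_mx c) 0.

Lemma affcst_homog m (c : R) (v : 'M[R]_(n, m)) :
  affcst c *m homog v = const_mx c.
Proof.
rewrite /affcst /homog mul_row_col mul0mx addr0.
by apply/rowP => k; rewrite !mxE big_ord1 !mxE mulr1.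
Qed.

Lemma aff_affcst c x : aff (affcst c) x = c.
Proof. by rewrite /aff affcst_homog mxE. Qed.

Lemma dotv_ge_norm x : `|x| ^+ 2 <= dotv x x.
Proof.
have d0 := dotvv_ge0 x.
rewrite -(sqr_sqrtr d0); apply: lerXn2r; rewrite ?nnegrE ?sqrtr_ge0//.
exact: norm_le_enorm.
Qed.

Lemma dotvv_comb x y (t : R) :
  dotv (x + t *: y) (x + t *: y) = dotv x x + 2 * t * dotv y x + t ^+ 2 * dotv y y.
Proof.
by rewrite !dotvDr !dotvDl !dotvZr !dotvZl [dotv x y]dotvC; ring.
Qed.

Definition gauss (N : R) x0 x : R := expR (- (N * dotv (x - x0) (x - x0))).

Lemma gauss_continuous N x0 : continuous (gauss N x0).
Proof.
move=> x; apply: (@continuous_comp _ _ _ (fun x => - (N * dotv (x - x0) (x - x0))) expR).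
  apply: (@cvgN _ _ _ (nbhs x)); apply: (@cvgM _ _ (nbhs x)).
    exact: cvg_cst.
  apply: cvg_big => [|i _]; first exact: add_continuous.
  have h : (y - x0) i ord0 @[y --> x] --> (x - x0) i ord0.
    rewrite !mxE; under eq_fun do rewrite !mxE.
    by apply: (@cvgB _ _ _ (nbhs x)); [exact: coord_continuous|exact: cvg_cst].
  exact: cvgM.
exact: continuous_expR.
Qed.

(* Maximising f times a narrow Gaussian centred at x0 yields a point where the
   gradient of the Gaussian is a slope of a majorant; this is the Moreau
   envelope of - log f. *)
Lemma gauss_majorant f x0 N : 0 < N -> LC f -> exists p, [/\ 0 < f p,
  (forall x, f x * gauss N x0 x <= f p * gauss N x0 p) &
  (forall x, f x <= f p * expR (2 * N * dotv (x - p) (p - x0)))].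
Proof.
move=> N0 [[f0 fl fu] [p0 fp0] fd].
have g0 x : 0 < gauss N x0 x by exact: expR_gt0.
have g1 x : gauss N x0 x <= 1.
  rewrite -expR0 ler_expR oppr_le0; apply: mulr_ge0; first exact: ltW.
  exact: dotvv_ge0.
have [p [pp pm]] : exists p, 0 < gauss N x0 p * f p /\
    forall x, gauss N x0 x * f x <= gauss N x0 p * f p.
  apply: (@usc_max _ _ (fun x => gauss N x0 x * f x)).
  - by move=> x; rewrite mulr_ge0// ltW.
  - apply/usc_hypo_sup; apply: hypo_sup_mul => //; first exact: gauss_continuous.
    exact/usc_hypo_sup.
  - by exists p0; rewrite mulr_gt0.
  - move=> M; have [r Hr] := fd M; exists r => x /Hr; apply: le_trans.
    by rewrite ler_piMl.
have fp : 0 < f p by move: pp; rewrite pmulr_rgt0.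
exists p; split => // [x|x]; first by rewrite mulrC [leRHS]mulrC.
have [fx|fx] := leP (f x) 0.
  by apply: le_trans fx _; rewrite mulr_ge0 ?expR_ge0// ltW.
rewrite -{1}(lnK fx) -{1}(lnK fp) -expRD ler_expR.
set d := ln (f x); set b := ln (f p); set D := dotv (x - p) (p - x0).
pose Q := dotv (x - p) (x - p).
have Q0 : 0 <= Q by exact: dotvv_ge0.
(* The first-order condition at the maximum [p]: compare with a point of the segment towards [x],
   apply log-concavity and divide by [t]. The remaining term in [t] is made arbitrarily small
   afterwards. *)
have key t : 0 < t < 1 -> d - b <= 2 * N * D + N * Q * t.
  move=> t01; have /andP[t0 t1] := t01.
  have h1 : expR (t * d + (1 - t) * b) <= f (t *: x + (1 - t) *: p).
    by apply: fl => //; rewrite lnK.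
  have := pm (t *: x + (1 - t) *: p).
  have -> : gauss N x0 (t *: x + (1 - t) *: p) =
      expR (- (N * (dotv (p - x0) (p - x0) + 2 * t * D + t ^+ 2 * Q))).
    have e : t *: x + (1 - t) *: p - x0 = (p - x0) + t *: (x - p).
      by apply/colP => i; rewrite !mxE; ring.
    by rewrite /gauss e dotvv_comb.
  rewrite /gauss -{1}(lnK fp) -expRD => h2.
  have : expR (- (N * (dotv (p - x0) (p - x0) + 2 * t * D + t ^+ 2 * Q)) +
      (t * d + (1 - t) * b)) <= expR (- (N * dotv (p - x0) (p - x0)) + b).
    by rewrite expRD; apply: le_trans h2; rewrite ler_pM2l// expR_gt0.
  rewrite ler_expR => h3.
  by rewrite -(ler_pM2l t0); lra.
rewrite -lerBlDl; apply/ler_addgt0Pr => e e0.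
pose t := Num.min (1 / 2) (e / (N * Q + 1)).
have NQ : 0 < N * Q + 1 by rewrite ltr_wpDl// mulr_ge0// ltW.
have t0 : 0 < t by rewrite lt_min !divr_gt0.
have t1 : t < 1 by rewrite gt_min; apply/orP; left; lra.
have /key h : 0 < t < 1 by rewrite t0.
have : N * Q * t <= e.
  apply: (@le_trans _ _ ((N * Q + 1) * t)); first by rewrite ler_pM2r// lerDl.
  by rewrite mulrC -ler_pdivlMr// ge_min lexx orbT.
by lra.
Qed.

Lemma affine_majorant f x0 c : LC f -> f x0 < c ->
  exists2 al, forall x, f x <= expR (aff al x) & expR (aff al x0) < c.
Proof.
move=> Lf fc; have [f0 _ fu] := LC_lcu Lf.
have c0 : 0 < c by exact: le_lt_trans fc.
have /nbhs_ballP[de de0 Hde] := fu _ _ fc.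
have [a [fa0 fa]] := LC_max Lf.
(* If [p] is within [de] of [x0], then [f p < c] is enough. Otherwise [N * dotv s s] exceeds
   [ln (f a) - ln c], and the slope term brings the value at [x0] below [ln c]. *)
pose N := (`|ln (f a) - ln c| + 1) / de ^+ 2.
have N0 : 0 < N by rewrite divr_gt0 ?exprn_gt0// ltr_wpDl.
have [p [fp gp fm]] := gauss_majorant x0 N0 Lf.
pose s := p - x0.
pose al : 'rV[R]_(1 + n) :=
  row_mx (const_mx (ln (f p) - 2 * N * dotv p s)) (2 * N *: s)^T.
have alE x : aff al x = ln (f p) + 2 * N * dotv (x - p) s.
  rewrite affE row_mxKr trmxK.
  have -> : al 0 0 = ln (f p) - 2 * N * dotv p s.
    by rewrite mxE; case: splitP => // k _; rewrite mxE.
  by rewrite dotvZl dotvBl [dotv s x]dotvC; ring.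
exists al => [x|]; first by rewrite alE expRD lnK.
have s0 : 0 <= dotv s s by exact: dotvv_ge0.
have -> : aff al x0 = ln (f p) - 2 * N * dotv s s.
  by rewrite alE -opprB -/s ![dotv (- s) _]dotvC dotvNr; ring.
have Ns : 0 <= N * dotv s s by rewrite mulr_ge0// ltW.
have [sde|sde] := ltP `|s| de.
  apply: (@le_lt_trans _ _ (f p)).
    by rewrite -[leRHS](lnK fp) ler_expR; lra.
  by apply: Hde; rewrite mx_norm_ball /ball_ /= distrC.
rewrite -[ltRHS](lnK c0) ltr_expR.
have h1 : ln (f p) <= ln (f a) by rewrite ler_ln ?posrE.
have h2 : de ^+ 2 <= dotv s s.
  apply: le_trans (dotv_ge_norm s); apply: lerXn2r; rewrite ?nnegrE//.
  exact: ltW.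
have h3 : `|ln (f a) - ln c| + 1 <= N * dotv s s.
  apply: (@le_trans _ _ (N * de ^+ 2)); last by rewrite ler_pM2l.
  by rewrite /N divfK// expf_neq0// gt_eqF.
have := ler_norm (ln (f a) - ln c); lra.
Qed.

(** Rational coefficients leave countably many majorants, which can be enumerated. An affine
    majorant is raised by half of the gap [ga] at [x0] and its coefficients are then rounded; on the
    ball of radius [|B| + |x0|] this changes the values by at most [ga / 4]. The bounded support
    makes control on a ball sufficient. *)
Lemma rational_majorant f x0 c (B : R) : LC f ->
  (forall x, f x != 0 -> `|x| <= B) -> f x0 < c ->
  exists2 r : 'rV[rat]_(1 + n), forall x, f x <= expR (aff (map_mx ratr r) x) &
    expR (aff (map_mx ratr r) x0) < c.
Proof.
move=> Lf fB fc; have [f0 _ _] := LC_lcu Lf.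
have c0 : 0 < c by exact: le_lt_trans fc.
have [al fal alc] := affine_majorant Lf fc.
have ga0 : 0 < ln c - aff al x0.
  by rewrite subr_gt0 -ltr_expR lnK.
set ga := ln c - aff al x0 in ga0.
pose B' := 1 + n%:R * (`|B| + `|x0|).
have B'0 : 0 < B' by rewrite ltr_pwDl// mulr_ge0// addr_ge0.
pose e := ga / 4 / B'.
have e0 : 0 < e by rewrite !divr_gt0.
pose be := al + affcst (ga / 2).
have [r Hr] : exists r : 'rV[rat]_(1 + n), forall i, `|ratr (r 0 i) - be 0 i| <= e.
  have ex i : exists r : rat, `|ratr r - be 0 i| <= e.
    have lt : be 0 i - e < be 0 i + e by lra.
    have [r] := rat_in_itvoo lt.
    by rewrite in_itv/= => /andP[h1 h2]; exists r; rewrite ler_norml; lra.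
  have [g Hg] := choice ex; exists (\row_i g i) => i; by rewrite mxE.
have Hr' i : `|(map_mx ratr r - be) 0 i| <= e.
  by rewrite subr_mxE [map_mx _ _ _ _]mxE; exact: Hr.
have close x : `|x| <= `|B| + `|x0| ->
    `|aff (map_mx ratr r) x - aff be x| <= ga / 4.
  move=> xB; rewrite -affB affE (le_trans (ler_normD _ _))//.
  have -> : ga / 4 = e * B' by rewrite /e divfK// gt_eqF.
  rewrite /B' mulrDr mulr1; apply: lerD.
    exact: Hr'.
  rewrite (le_trans (ler_norm_sum _ _ _))//.
  apply: (@le_trans _ _ (\sum_(i < n) e * (`|B| + `|x0|))); last first.
    by rewrite sumr_const card_ord -[leLHS]mulr_natl mulrCA.
  apply: ler_sum => i _; rewrite normrM; apply: ler_pM => //.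
    by rewrite mxE [rsubmx _ _ _]mxE; exact: Hr'.
  exact: le_trans (coord_le_norm _ _) xB.
exists r => [x|].
  have [->|fx] := eqVneq (f x) 0; first exact: expR_ge0.
  have /close : `|x| <= `|B| + `|x0|.
    rewrite (le_trans (fB _ fx))// (le_trans (ler_norm _))// lerDl//.
  rewrite ler_norml affD aff_affcst => /andP[h _].
  by apply: (le_trans (fal x)); rewrite ler_expR; lra.
have /close : `|x0| <= `|B| + `|x0| by rewrite lerDr.
rewrite ler_norml affD aff_affcst => /andP[_ h].
by rewrite -[ltRHS](lnK c0) ltr_expR; rewrite /ga in h ga0; lra.
Qed.

Lemma hypo_decreasing (f_ : nat -> V -> R) f : (forall k, usc (f_ k)) ->
  (forall k x, f x <= f_ k x) -> (forall k x, f_ k.+1 x <= f_ k x) ->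
  (forall x c, f x < c -> exists k, f_ k x < c) -> hypo f_ f.
Proof.
move=> fu fle fd fc.
have fmono k l x : (k <= l)%N -> f_ l x <= f_ k x.
  elim: l => [|l IH]; first by rewrite leqn0 => /eqP ->.
  by rewrite leq_eqVlt ltnS => /predU1P[->//|/IH]; exact: le_trans.
split=> [x c /fc[k fk]|x].
  exists ([set y | f_ k y < c], [set l | (k <= l)%N]).
    by split; [exact: fu|exists k].
  by move=> [y l] [/= yk kl]; apply: le_lt_trans yk; exact: fmono.
exists (fun=> x); first exact: cvg_cst.
apply/cvgrPdist_lt => e e0; have /fc[k fk] : f x < f x + e by rewrite ltrDl.
exists k => // l /= kl; rewrite distrC ger0_norm ?subr_ge0// ltrBlDl.
by apply: le_lt_trans fk; exact: fmono.
Qed.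

(** The corner simplex with apex at the point all of whose coordinates are [- c] and legs of length
    [2 * n * c]. It contains the cube of sup-norm radius [c], where the [n] coordinates relative to
    the apex are at most [2 * c] each. *)
Definition bigsimplex (c : R) : 'M[R]_(n, 1 + n) :=
  row_mx (const_mx (- c)) (const_mx (- c) + (2 * n%:R * c)%:M).

Lemma bigsimplexP c x : 0 < c -> `|x| <= c -> simplex (bigsimplex c) x.
Proof.
move=> c0 xc; have xi i : - c <= x i 0 <= c.
  by rewrite -ler_norml; exact: le_trans (coord_le_norm _ _) xc.
pose K := 2 * n%:R * c; pose m := K^-1 *: (x + const_mx c).
have n0 (i : 'I_n) : (0 < n)%N by exact: leq_ltn_trans (ltn_ord i).
have K0 (i : 'I_n) : 0 < K by rewrite !mulr_gt0// ltr0n (n0 i).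
have Kn : 0 <= K by rewrite !mulr_ge0// ltW.
have m0 i : 0 <= m i 0.
  rewrite !mxE mulr_ge0 ?invr_ge0// -lerBlDr sub0r.
  by case/andP: (xi i).
have m1 i : m i 0 <= n%:R^-1.
  rewrite !mxE mulrC ler_pdivrMr ?(K0 i)// /K.
  have -> : n%:R^-1 * (2 * n%:R * c) = 2 * c.
    by field; rewrite pnatr_eq0 -lt0n (n0 i).
  by rewrite mulr_natl mulr2n lerD2r; case/andP: (xi i).
have ms : \sum_i m i 0 <= 1.
  apply: (@le_trans _ _ (\sum_(i < n) n%:R^-1)); first exact: ler_sum.
  rewrite sumr_const card_ord -[_ *+ n]mulr_natl.
  by have [->|nn] := eqVneq n%:R (0 : R); [rewrite mul0r|rewrite mulfV].
exists (col_mx (const_mx (1 - \sum_i m i 0)) m).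
  by move=> i; rewrite mxE; case: splitP => k _; rewrite ?mxE ?subr_ge0//;
    have := m0 k; rewrite !mxE.
apply/homog_eqP; split=> [k|].
  rewrite big_split_ord/= big_ord1 col_mxEu mxE (ord1 k).
  rewrite [X in _ + X](_ : _ = \sum_i m i 0) ?subrK//.
  by apply: eq_bigr => i _; exact: col_mxEd.
rewrite /bigsimplex mul_row_col mulmxDl mul_scalar_mx.
have cE (M : 'cV[R]_n) : const_mx (- c) *m M = const_mx (- c * \sum_i M i 0) :> V.
  apply/colP => i; rewrite mxE [RHS]mxE mulr_sumr.
  by apply: eq_bigr => k _; rewrite mxE.
rewrite cE; apply/colP => i.
rewrite mxE [X in X + _]mxE big_ord1 !mxE.
have Ki : K != 0 by rewrite gt_eqF// (K0 i).
rewrite [X in X + _]mulrBr mulr1 -/K mulrA mulfV// mul1r.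
by move: (\sum_i0 m i0 0) => w; ring.
Qed.

Definition minaff (al : 'rV[R]_(1 + n)) (als : seq 'rV[R]_(1 + n)) x : R :=
  foldr (fun be => Num.min (aff be x)) (aff al x) als.

Lemma concave_minaff al als : concave (minaff al als).
Proof.
elim: als => [|be als IH]; first exact: concave_aff.
move=> x y t t01; have /andP[t0 t1] := t01; have t1' : 0 < 1 - t by rewrite subr_gt0.
rewrite /minaff /= -!/(minaff al als _) le_min; apply/andP; split.
  by rewrite aff_comb; apply: lerD; rewrite ler_pM2l// ge_min lexx.
apply: le_trans (IH x y t t01).
by apply: lerD; rewrite ler_pM2l// ge_min lexx orbT.
Qed.

Lemma minaff_continuous al als : continuous (minaff al als).
Proof.
elim: als => [|be als IH]; first exact: aff_continuous.
by move=> x; apply: continuous_min; [exact: aff_continuous|exact: IH].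
Qed.

Lemma foldr_min_swap (a b : R) (s : seq R) :
  Num.min a (foldr Num.min b s) = foldr Num.min (Num.min a b) s.
Proof. by elim: s => //= c s <-; rewrite minCA. Qed.

Lemma minaff_cons al be als x :
  minaff al (be :: als) x = foldr Num.min (Num.min (aff be x) (aff al x))
    [seq aff ga x | ga <- als].
Proof.
rewrite -foldr_min_swap /minaff /=; congr (Num.min _ _).
by elim: als => //= ga als ->.
Qed.

Lemma minaff_map al als x :
  minaff al als x = foldr Num.min (aff al x) [seq aff ga x | ga <- als].
Proof. by rewrite /minaff; elim: als => //= ga als ->. Qed.

End Approximation.

(** * From small oscillation on simplices to arbitrary log-concave functions *)

Section Vanishing.
Context {R : realType} {n : nat}.
Local Notation V := 'cV[R]_n.
Implicit Types (x y p : V) (v : 'M[R]_(n, 1 + n)) (al : 'rV[R]_(1 + n))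
  (s : 'rV[R]_(1 + n)) (i j k : 'I_(1 + n)) (t : R) (f q : V -> R).
Context (z : (V -> R) -> R) (vz : invariant_valuation z) (z0 : z point0 = 0)
  (n1 : (1 < n)%N) (z1 : z (expsimplex (fun=> 0) (stdsimplex n1 1)) = 0).

Lemma stdval00 : stdval z n1 0 1 = 0.
Proof.
rewrite -z1 /stdval; congr z; apply: expsimplex_congr => x _.
rewrite (_ : stdaff n1 0 1 = 0); first by rewrite /aff mul0mx mxE.
apply/rowP => i; rewrite mxE [RHS]mxE; case: splitP => k _; rewrite !mxE//.
by rewrite subrr mul0r.
Qed.

(** Continuity at [s = 0], where the value is 0 by [stdval00]: counterexamples for
    [de = 1 / (m + 1)] would form a sequence of vertex values tending to 0. *)
Lemma stdval_small (eta : R) : 0 < eta -> exists2 de : R, 0 < de &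
  forall s, (forall i, 0 <= s 0 i <= de) -> `|stdval z n1 s 1| <= eta.
Proof.
move=> eta0; apply: contrapT => nE.
have ex m : exists s, (forall i, 0 <= s 0 i <= m.+1%:R^-1) /\
    eta < `|stdval z n1 s 1|.
  apply: contrapT => nm; apply: nE; exists m.+1%:R^-1; first by rewrite invr_gt0.
  by move=> s Hs; rewrite leNgt; apply/negP => h; apply: nm; exists s.
have [s_ Hs] := choice ex.
have : stdval z n1 (s_ m) 1 @[m --> \oo] --> stdval z n1 0 1.
  apply: (@stdval_cvg _ _ _ vz n1 s_ 0 (fun=> 1) 1) => //; last exact: cvg_cst.
  move=> i; rewrite mxE.
  apply: (@squeeze_cvgr _ _ _ _ (fun=> 0) (fun m => m.+1%:R^-1)).
  - by near=> m; have [/(_ i)] := Hs m.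
  - exact: cvg_cst.
  - exact: cvg_harmonic.
rewrite stdval00 => /cvgrPdist_lt /(_ _ eta0) [N _ /(_ N (leqnn N))].
have [_ h] := Hs N.
by rewrite sub0r normrN => /(lt_trans h); rewrite ltxx.
Unshelve. all: by end_near.
Qed.

Lemma simple_abs al v : z (expsimplex (aff al) v) =
  `|\det (homog v)| * stdval z n1 (al *m homog v) 1.
Proof.
have [d0|d0] := eqVneq (\det (homog v)) 0.
  rewrite d0 normr0 mul0r; apply: (simple_degenerate vz z0).
  - exact: concave_aff.
  - exact: aff_continuous.
  - by rewrite unitmxE unitfE d0 eqxx.
by rewrite (simple_stdval vz n1)// (stdval_abs vz z0)// .
Qed.

Lemma esplit_bounds s i j t (m M : R) : 0 < t < 1 ->
  (forall k, m <= s 0 k <= M) -> forall k, m <= (s *m esplit i j t) 0 k <= M.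
Proof.
move=> t01 H k; rewrite esplit_mulr; have [->|_] := eqVneq k i; last first.
  by rewrite natr_false mul0r addr0.
have /andP[t0 t1] := t01; have /andP[a1 a2] := H i; have /andP[b1 b2] := H j.
by rewrite natr_true mul1r; apply/andP; split; nra.
Qed.

Lemma det_homog_esplit v i j t : i != j ->
  \det (homog (v *m esplit i j t)) = (1 - t) * \det (homog v).
Proof. by move=> ij; rewrite homog_esplit det_mulmx det_esplit// mulrC. Qed.

Lemma one_sided_affcst al v (c : R) : one_sided (al - affcst c) v ->
  (forall k, c <= (al *m homog v) 0 k) \/ (forall k, (al *m homog v) 0 k <= c).
Proof.
have E k : ((al - affcst c) *m homog v) 0 k = (al *m homog v) 0 k - c.
  by rewrite mulmxBl affcst_homog !mxE.
by move=> [H|H]; [left|right] => k; have := H k; rewrite E ?subr_ge0 ?subr_le0.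
Qed.

(** The left-hand side is subadditive and the right-hand side additive under edge splits, so it
    suffices to treat pieces on which [al] varies by at most [de]. There the smaller level is split
    off as a factor [expR (c a)] and the hypothesis applies to the rest. *)
Lemma simple_bound al (eta de m M : R) : 0 < de ->
  (forall s, (forall i, 0 <= s 0 i <= de) -> `|stdval z n1 s 1| <= eta) ->
  forall v, (forall k, m <= (al *m homog v) 0 k <= M) ->
  `|z (expsimplex (aff al) v)| <= eta * `|\det (homog v)| * expR M.
Proof.
move=> de0 Hde.
have eta0 : 0 <= eta.
  apply: le_trans (normr_ge0 _) (Hde 0 _) => i; rewrite mxE lexx ltW//.
pose P v := (forall k, m <= (al *m homog v) 0 k <= M) ->
  `|z (expsimplex (aff al) v)| <= eta * `|\det (homog v)| * expR M.
suff : forall v, P v by [].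
pose c a : R := m + a%:R * de.
pose N := (Num.truncn ((M - m) / de)).+1.
have cN : M < c N.
  rewrite /c -ltrBlDl -ltr_pdivrMr//; exact: truncnS_gt.
apply: (@split_closed_cuts _ _ P [seq al - affcst (c a) | a <- iota 0 N.+1]).
  move=> v i j t ij t01 P1 P2 H; have /andP[t0 t1] := t01.
  rewrite (simple_esplit vz z0 v (@concave_aff _ _ _) (@aff_continuous _ _ _) ij t01).
  apply: (le_trans (ler_normD _ _)).
  have t01' : 0 < 1 - t < 1 by rewrite subr_gt0 t1 gtrBl.
  have -> : eta * `|\det (homog v)| * expR M =
     eta * `|\det (homog (v *m esplit i j t))| * expR M +
     eta * `|\det (homog (v *m esplit j i (1 - t)))| * expR M.
    have ji : j != i by rewrite eq_sym.
    rewrite (det_homog_esplit v t ij) (det_homog_esplit v (1 - t) ji) subKr.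
    rewrite !normrM (gtr0_norm t0).
    by rewrite (gtr0_norm (_ : 0 < 1 - t)) ?subr_gt0//; ring.
  apply: lerD; [apply: P1|apply: P2] => k; rewrite homog_esplit mulmxA;
    exact: esplit_bounds.
move=> v Hv H; set s := al *m homog v in H.
(* The highest level below all vertex values. Some vertex lies below the next level, and
   one-sidedness forces all others to do so. *)
have [a aN [al_ge al_lt]] : exists2 a, (a < N)%N &
    (forall k, c a <= s 0 k) /\ exists k, s 0 k < c a.+1.
  apply: contrapT => nE.
  have all a : (a <= N)%N -> forall k, c a <= s 0 k.
    elim: a => [_ k|a IH aN k]; first by rewrite /c mul0r addr0; case/andP: (H k).
    rewrite leNgt; apply/negP => sk; apply: nE; exists a => //.
    by split; [apply: IH; exact: ltnW|exists k].
  by have := all N (leqnn N) 0; rewrite leNgt (le_lt_trans _ cN)//; case/andP: (H 0).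
have s_le k : s 0 k <= c a.+1.
  have : one_sided (al - affcst (c a.+1)) v.
    apply: Hv; apply/mapP; exists a.+1 => //.
    by rewrite mem_iota /= add0n ltnS.
  move/one_sided_affcst => [h|h]; last exact: h.
  by have [b sb] := al_lt; have := h b; rewrite -/s leNgt sb.
rewrite simple_abs -/s normrM normr_id.
have -> : s = (s - const_mx (c a)) + const_mx (c a) by rewrite subrK.
rewrite (stdval_shift vz)// normrM (gtr0_norm (expR_gt0 _)).
have h1 : `|stdval z n1 (s - const_mx (c a)) 1| <= eta.
  apply: Hde => k; rewrite subr_mxE [const_mx _ _ _]mxE subr_ge0 al_ge/= lerBlDr.
  by rewrite (le_trans (s_le k))// /c -natr1 mulrDl mul1r addrA addrC.
have h2 : expR (c a) <= expR M.
  by rewrite ler_expR (le_trans (al_ge 0))//; case/andP: (H 0).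
rewrite [eta * _]mulrC -mulrA ler_wpM2l// mulrC.
by apply: ler_pM => //; exact: expR_ge0.
Qed.

(** In [simple_bound], the volume and the maximum of [al] are fixed while [eta] is arbitrary; the
    number of pieces does not enter. *)
Lemma simple_aff0 al v : z (expsimplex (aff al) v) = 0.
Proof.
pose s := al *m homog v.
pose M := \sum_k `|s 0 k|.
have sM k : - M <= s 0 k <= M.
  rewrite -ler_norml /M (bigD1 k)//= lerDl.
  by apply: sumr_ge0 => ? _; exact: normr_ge0.
pose C := `|\det (homog v)| * expR M + 1.
have C0 : 0 < C by rewrite ltr_wpDl// mulr_ge0// expR_ge0.
apply/eqP; rewrite -normr_le0; apply/ler_addgt0Pr => e e0; rewrite add0r.
have [de de0 Hde] := stdval_small (divr_gt0 e0 C0).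
apply: le_trans (simple_bound de0 Hde sM) _.
by rewrite -mulrA mulrAC ler_pdivrMr// ler_pM2l// lerDl.
Qed.

(** Cutting where two of the affine functions agree makes one of them redundant on each side, so the
    number of functions drops. *)
Lemma simple_minaff0 al als v : z (expsimplex (minaff al als) v) = 0.
Proof.
have [m] := ubnP (size als); elim: m al als v => // m IH al [|be als] v.
  by move=> _; exact: simple_aff0.
rewrite ltnS => sm.
pose P v := z (expsimplex (minaff al (be :: als)) v) = 0.
suff H : forall w, P w by exact: H.
apply: (@split_closed_cut _ _ P (be - al)).
  move=> w i j t ij t01; rewrite /P => P1 P2.
  rewrite (simple_esplit vz z0 w (@concave_minaff _ _ _ _)
    (@minaff_continuous _ _ _ _) ij t01).
  by rewrite P1 P2 addr0.
move=> w [H|H]; rewrite /P.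
  rewrite (@expsimplex_congr _ _ _ (minaff al als)); first exact: IH.
  move=> x /(aff_simplex_ge H); rewrite affB subr_ge0 => h.
  by rewrite minaff_cons minaff_map min_r.
rewrite (@expsimplex_congr _ _ _ (minaff be als)); first exact: IH.
move=> x /(aff_simplex_le H); rewrite affB subr_le0 => h.
by rewrite minaff_cons minaff_map min_l.
Qed.

Lemma simple_restr_simplex f v : LC f -> (exists2 x, simplex v x & 0 < f x) ->
  z (restr f (simplex v)) = 0.
Proof.
move=> Lf fv; have f0 x : 0 <= f x by case: Lf => -[].
pose F := restr f (simplex v).
have LF : LC F.
  by apply: LC_restr => //; [exact: closed_simplex|exact: convexs_simplex].
have [B vB] := simplex_bounded v.
have FB x : F x != 0 -> `|x| <= B by move=> /restr_neq0/vB.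
pose maj (r : 'rV[rat]_(1 + n)) := forall x, F x <= expR (aff (map_mx ratr r) x).
have F01 : F 0 < F 0 + 1 by rewrite ltrDl.
have [r0 maj0 _] := rational_majorant LF FB F01.
(* An enumeration of all rational majorants of [F]; codes of anything else are sent to the majorant
   [r0]. The minima [q a] of the first [a + 1] of them decrease. *)
pose r a : 'rV[rat]_(1 + n) := if unpickle a is Some r' then
  if pselect (maj r') then r' else r0 else r0.
have majr a : maj (r a).
  by rewrite /r; case: unpickle => // r'; case: pselect.
pose al a : 'rV[R]_(1 + n) := map_mx ratr (r a).
pose fix als a := if a is b.+1 then al b.+1 :: als b else [::].
pose q a := minaff (al 0%N) (als a).
have Fq a x : F x <= expR (q a x).
  elim: a => [|a IH]; first exact: majr.
  rewrite /q /minaff /= -/(minaff _ _ _) -/(q a x).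
  by rewrite /Num.min; case: ifP => // _; exact: majr.
have q_al a x : q a x <= aff (al a) x.
  by case: a => [//|a]; rewrite /q /minaff /= ge_min lexx.
have qd a x : q a.+1 x <= q a x by rewrite /q /minaff /= ge_min lexx orbT.
have Lq a : LC (expsimplex (q a) v).
  by apply: LC_exp_simplex; [exact: concave_minaff|exact: minaff_continuous].
have : z (expsimplex (q a) v) @[a --> \oo] --> z F.
  apply: (iv_cont vz) => //; apply: hypo_decreasing.
  - by move=> a; case: (Lq a) => -[].
  - move=> a x; have [vx|vx] := pselect (simplex v x).
      by rewrite [leRHS]restrT.
    by rewrite /F /expsimplex !restrF.
  - move=> a x; have [vx|vx] := pselect (simplex v x).
      by rewrite /expsimplex !restrT// ler_expR.
    by rewrite /expsimplex !restrF.
  - move=> x c Fc; have [vx|vx] := pselect (simplex v x); last first.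
      by exists 0%N; rewrite /expsimplex restrF//; move: Fc; rewrite /F restrF.
    have [r' maj' r'c] := rational_majorant LF FB Fc.
    exists (pickle r'); rewrite /expsimplex restrT//; apply: le_lt_trans r'c.
    rewrite ler_expR; apply: le_trans (q_al _ _) _.
    by rewrite /al /r pickleK; case: pselect.
have -> : (fun a => z (expsimplex (q a) v)) = fun=> 0.
  by apply/funext => a; exact: simple_minaff0.
by move=> /(cvg_lim _) <-//; apply: cvg_lim => //; exact: cvg_cst.
Qed.

Theorem simple_eq0 f : LC f -> z f = 0.
Proof.
move=> Lf; have [p fp] : exists x, 0 < f x by case: Lf.
have f0 x : 0 <= f x by case: Lf => -[].
(* The summand [|p|] puts a point of positivity of [f] into every simplex, so that all restrictions
   belong to [LC]. *)
pose c a : R := `|p| + a.+1%:R.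
have c0 a : 0 < c a by rewrite ltr_wpDl.
have Tp a : simplex (bigsimplex (c a)) p by apply: bigsimplexP => //; rewrite lerDl.
have : z (restr f (simplex (bigsimplex (c a)))) @[a --> \oo] --> z f.
  apply: (iv_cont vz) => [a|//|].
    apply: LC_restr => //; [exact: closed_simplex|exact: convexs_simplex|].
    by exists p.
  split=> [x e fe|x].
    exists ([set y | f y < e], setT).
      by split; [case: Lf => -[_ _ fu] _ _; exact: fu|exact: filterT].
    by move=> [y a] [/= ye _]; apply: le_lt_trans ye; exact: restr_le.
  exists (fun=> x); first exact: cvg_cst.
  apply/cvgrPdist_lt => e e0; exists (Num.truncn `|x|) => // a /= xa.
  rewrite restrT ?subrr ?normr0//; apply: bigsimplexP => //.
  apply: (@le_trans _ _ a.+1%:R); last by rewrite lerDr.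
  by rewrite ltW// (lt_le_trans (truncnS_gt _))// ler_nat ltnS.
have -> : (fun a => z (restr f (simplex (bigsimplex (c a))))) = fun=> 0.
  by apply/funext => a; apply: simple_restr_simplex => //; exists p.
by move=> /(cvg_lim _) <-//; apply: cvg_lim => //; exact: cvg_cst.
Qed.

End Vanishing.

(** * Affine changes of variables *)

Section AffineChange.
Context {R : realType}.
Local Notation mR := (measurableTypeR R).
Local Notation mV n := ('cV[mR]_n).
Local Open Scope ereal_scope.

Lemma measurable_affine1 (a b : R) :
  measurable_fun setT (fun t => a * t + b : mR)%R.
Proof.
apply: (@measurable_funD _ mR R setT (fun t => a * t)%R (cst b)) => //.
by apply: (@measurable_funM _ mR R setT (cst a) id).
Qed.

(** By uniqueness of Lebesgue measure it suffices to compare half-open intervals. For negative [a]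
    the preimage is half-open at the other end, which does not affect its length. *)
Lemma lebesgue_affine1 (a b : R) (A : set mR) : a != 0%R -> measurable A ->
  lebesgue_measure A =
  `|a|%:E * lebesgue_measure ((fun t => a * t + b)%R @^-1` A).
Proof.
move=> a0 mA.
pose phi := (fun t => a * t + b)%R : mR -> mR.
have mphi : measurable_fun setT phi by exact: measurable_affine1.
pose mu2 : {measure set mR -> \bar R} :=
  mscale (NngNum (normr_ge0 a)) (pushforward lebesgue_measure phi).
rewrite (@lebesgue_measure_unique _ (mu2 mphi))// => _ [[c d]] _ <-.
change (lebesgue_measure `]c, d] =
  `|a|%:E * lebesgue_measure ((fun t => a * t + b)%R @^-1` `]c, d])).
have [aa|aa|/eqP] := ltgtP 0%R a; last by rewrite eq_sym (negPf a0).
- have -> : (fun t => a * t + b)%R @^-1` `]c, d]%classic =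
      `]((c - b) / a)%R, ((d - b) / a)%R]%classic.
    apply/seteqP; split=> t /=; rewrite !in_itv/= ltr_pdivrMr// ler_pdivlMr//;
    by rewrite ltrBlDr lerBrDr [(t * a)%R]mulrC.
  rewrite !lebesgue_measure_itv/= !lte_fin ltr_pM2r ?invr_gt0// ltrD2r.
  case: ifP => _; last by rewrite mule0.
  rewrite -!EFinD -EFinM gtr0_norm//; congr EFin.
  by field; rewrite gt_eqF.
- have -> : (fun t => a * t + b)%R @^-1` `]c, d]%classic =
      `[((d - b) / a)%R, ((c - b) / a)%R[%classic.
    apply/seteqP; split=> t /=; rewrite !in_itv/= ltr_ndivlMr// ler_ndivrMr//;
    by rewrite ltrBlDr lerBrDr [(t * a)%R]mulrC andbC.
  rewrite !lebesgue_measure_itv/= !lte_fin ltr_nM2r ?invr_lt0// ltrD2r.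
  case: ifP => _; last by rewrite mule0.
  rewrite -!EFinD -EFinM ltr0_norm//; congr EFin.
  by field; rewrite lt_eqF.
Qed.

Lemma integral_affine1 (a b : R) (f : mR -> \bar R) : a != 0%R ->
  measurable_fun setT f -> (forall t, 0 <= f t) ->
  `|a|%:E * \int[lebesgue_measure]_t f (a * t + b)%R = \int[lebesgue_measure]_t f t.
Proof.
move=> a0 mf f0.
pose phi := (fun t => a * t + b)%R : mR -> mR.
have mphi : measurable_fun setT phi by exact: measurable_affine1.
pose mu2 : {measure set mR -> \bar R} :=
  pushforward lebesgue_measure phi.
rewrite [RHS](eq_measure_integral (mscale (NngNum (normr_ge0 a)) (mu2 mphi))).
  by rewrite ge0_integral_mscale//= [in RHS]ge0_integral_pushforward.
by move=> A mA _; exact: (lebesgue_affine1 b a0 mA).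
Qed.

Lemma measurable_affine n m (A : 'M[R]_(m, n)) (b : 'cV[R]_m) :
  measurable_fun [set: mV n] (fun x => A *m x + b : mV m)%R.
Proof.
apply: measurable_fun_cVP => i; under eq_fun do rewrite !mxE.
apply: (@measurable_funD _ (mV n) R setT) => //.
apply: (@measurable_sum _ (mV n) R) => j.
apply: (@measurable_funM _ (mV n) R setT (cst (A i j))) => //.
exact: (@measurable_coor _ mR n j).
Qed.

Local Notation leb n := (@lebesgue_cV R n).

Section Tonelli.
Context {n : nat} (f : mV n.+1 -> \bar R).
Hypothesis mf : measurable_fun setT f.
Hypothesis f0 : forall x, 0 <= f x.

Lemma measurable_cons : measurable_fun setT (f \o @cons_cV R n).
Proof. exact: measurableT_comp mf (@measurable_cons_cV R n). Qed.

Lemma lebesgue_cV_tonelli1 : \int[leb n.+1]_x f x =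
  \int[lebesgue_measure]_t \int[leb n]_v f (cons_cV (t, v)).
Proof.
rewrite /= [LHS](ge0_integral_pushforward (@measurable_cons_cV R n))//.
by rewrite fubini_tonelli1//; [exact: measurable_cons|move=> x; exact: f0].
Qed.

Lemma lebesgue_cV_tonelli2 : \int[leb n.+1]_x f x =
  \int[leb n]_v \int[lebesgue_measure]_t f (cons_cV (t, v)).
Proof.
rewrite /= [LHS](ge0_integral_pushforward (@measurable_cons_cV R n))//.
by rewrite fubini_tonelli2//; [exact: measurable_cons|move=> x; exact: f0].
Qed.

Lemma measurable_int1 :
  measurable_fun setT (fun t : mR => \int[leb n]_v f (cons_cV (t, v))).
Proof.
exact: (measurable_fun_fubini_tonelli_F (f \o @cons_cV R n) measurable_cons
  (fun x => f0 _)).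
Qed.

Lemma measurable_int2 :
  measurable_fun setT (fun v : mV n => \int[lebesgue_measure]_t f (cons_cV (t, v))).
Proof.
exact: (measurable_fun_fubini_tonelli_G (f \o @cons_cV R n) measurable_cons
  (fun x => f0 _)).
Qed.

Lemma measurable_cons_r t : measurable_fun setT (fun v : mV n => f (cons_cV (t, v))).
Proof.
exact: (measurableT_comp measurable_cons (pair1_measurable t)).
Qed.

Lemma measurable_cons_l v : measurable_fun setT (fun t : mR => f (cons_cV (t, v))).
Proof.
exact: (measurableT_comp measurable_cons (pair2_measurable v)).
Qed.

End Tonelli.

(** The translation [b] is part of the statement because, with one block of coordinates fixed, the
    off-diagonal block of a triangular matrix acts on the others as a translation. *)
Definition affine_change n (A : 'M[R]_n) := forall (b : 'cV[R]_n) (f : mV n -> \bar R),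
  measurable_fun setT f -> (forall x, 0 <= f x) ->
  `|\det A|%:E * \int[leb n]_x f (A *m x + b)%R = \int[leb n]_x f x.

Lemma affine_change_mul n (A B : 'M[R]_n) :
  affine_change A -> affine_change B -> affine_change (A *m B).
Proof.
move=> HA HB b f mf f0; rewrite -(HA b f)// det_mulmx normrM EFinM -muleA.
congr (_ * _).
rewrite -(HB 0%R (fun x => f (A *m x + b)%R))//; last first.
  exact: measurableT_comp mf (measurable_affine A b).
by congr (_ * _); apply: eq_integral => x _; rewrite addr0 mulmxA.
Qed.

Lemma cons_cVE n (t : R) (v : 'cV[R]_n) : cons_cV (t, v) = col_mx t%:M v.
Proof.
apply/colP => i; rewrite [LHS]mxE; case: (unliftP ord0 i) => [j ->|->] /=.
  have -> : lift ord0 j = rshift 1 j by exact/val_inj.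
  by rewrite [RHS](@col_mxEd _ 1).
have -> : ord0 = lshift n (0%R : 'I_1) by exact/val_inj.
by rewrite (@col_mxEu _ 1) mxE eqxx.
Qed.

Lemma block_cons_cV n (a : R) (r : 'rV[R]_n) (c : 'cV[R]_n) (L : 'M[R]_n)
    (b : 'cV[R]_(1 + n)) (t : R) (v : 'cV[R]_n) :
  (block_mx a%:M r c L *m cons_cV (t, v) + b)%R =
  cons_cV ((a * t + ((r *m v) 0%R 0%R + usubmx b 0%R 0%R))%R, (L *m v + (c *m t%:M + dsubmx b))%R).
Proof.
rewrite !cons_cVE mul_block_col -{1}[b]vsubmxK add_col_mx; congr col_mx.
  apply/colP => i; rewrite !ord1 -scalar_mxM !mxE eqxx mulr1n.
  by rewrite [RHS]mulr1n addrA.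
by rewrite addrA [(c *m _ + _)%R]addrC.
Qed.

(** For a fixed first coordinate the remaining ones undergo [L] and a shift, so they are integrated
    first; [affine_change_upper] uses the opposite order. *)
Lemma affine_change_lower n (a : R) (c : 'cV[R]_n) (L : 'M[R]_n) : a != 0%R ->
  affine_change L -> affine_change (block_mx a%:M 0 c L : 'M[R]_(1 + n)).
Proof.
move=> a0 HL b f mf f0; rewrite det_lblock det_scalar1 normrM EFinM.
pose g := fun x : mV (1 + n) => f (block_mx a%:M 0 c L *m x + b)%R.
have mg : measurable_fun setT g.
  exact: measurableT_comp mf (measurable_affine _ b).
rewrite (lebesgue_cV_tonelli1 mg (fun x => f0 _)) (lebesgue_cV_tonelli1 mf f0).
rewrite -muleA -ge0_integralZl_EFin//; last 2 first.
- by move=> t _; apply: integral_ge0 => v _; exact: f0.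
- exact: measurable_int1 mg (fun x => f0 _).
rewrite -(integral_affine1 (usubmx b 0%R 0%R) a0 (measurable_int1 mf f0)); last first.
  by move=> t; exact: integral_ge0.
congr (_ * _); apply: eq_integral => t _.
rewrite -(HL (c *m t%:M + dsubmx b)%R (fun v => f (cons_cV (_, v)))) //; last first.
  exact: measurable_cons_r.
congr (_ * _); apply: eq_integral => v _.
by rewrite /g block_cons_cV mul0mx mxE add0r.
Qed.

Lemma affine_change_upper n (a : R) (r : 'rV[R]_n) (U : 'M[R]_n) : a != 0%R ->
  affine_change U -> affine_change (block_mx a%:M r 0 U : 'M[R]_(1 + n)).
Proof.
move=> a0 HU b f mf f0; rewrite det_ublock det_scalar1 mulrC normrM EFinM.
pose g := fun x : mV (1 + n) => f (block_mx a%:M r 0 U *m x + b)%R.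
have mg : measurable_fun setT g.
  exact: measurableT_comp mf (measurable_affine _ b).
rewrite (lebesgue_cV_tonelli2 mg (fun x => f0 _)) (lebesgue_cV_tonelli2 mf f0).
rewrite -muleA -ge0_integralZl_EFin//; last 2 first.
- by move=> t _; apply: integral_ge0 => v _; exact: f0.
- exact: measurable_int2 mg (fun x => f0 _).
rewrite -(HU (dsubmx b) _ (measurable_int2 mf f0)); last first.
  by move=> t; exact: integral_ge0.
congr (_ * _); apply: eq_integral => v _.
rewrite -(@integral_affine1 a ((r *m v) 0%R 0%R + usubmx b 0%R 0%R)%R
  (fun t => f (cons_cV (t, _)))) //; last first.
  exact: measurable_cons_l.
congr (_ * _); apply: eq_integral => t _.
by rewrite /g block_cons_cV mul0mx add0r.
Qed.

(** As [b] is arbitrary, this is the translation invariance of Lebesgue measure. *)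
Lemma affine_change1 n : affine_change (1%:M : 'M[R]_n).
Proof.
elim: n => [|n IH].
  move=> b f mf f0; rewrite det1 normr1 mul1e; apply: eq_integral => x _.
  by congr f; apply/colP => -[].
rewrite [X in affine_change X](@scalar_mx_block _ 1 n 1); exact: affine_change_upper.
Qed.

(* Block elimination with pivot A 0 0, made nonzero by adding another row to
   the first one. *)
Theorem affine_change_unit n (A : 'M[R]_n) : \det A != 0%R -> affine_change A.
Proof.
elim: n A => [|n IH] A dA.
  have -> : A = 1%:M by apply/matrixP => -[].
  exact: affine_change1.
change ('M[R]_(1 + n)) in (type of A).
have pivot (B : 'M[R]_(1 + n)) : B 0%R 0%R != 0%R -> \det B != 0%R -> affine_change B.
  move=> b0 dB; pose a := B 0%R 0%R.
  (* The Schur complement of the pivot. *)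
  pose S := (drsubmx B - dlsubmx B *m (a^-1 *: ursubmx B))%R.
  have BE : B = block_mx 1%:M 0 (a^-1 *: dlsubmx B) 1%:M *m
      block_mx a%:M (ursubmx B) 0 S.
    rewrite mulmx_block !mul1mx !mul0mx !addr0 -{1}[B]submxK.
    have ulE : ulsubmx B = a%:M.
      apply/matrixP => i j; rewrite !ord1 !mxE eqxx mulr1n.
      by congr (B _ _); exact/val_inj.
    rewrite ulE; congr block_mx.
      by rewrite mul_mx_scalar scalerA mulfV// scale1r.
    by rewrite -scalemxAl /S -scalemxAr addrC subrK.
  have dS : \det S != 0%R.
    move: dB; rewrite BE det_mulmx det_lblock !det1 !mul1r det_ublock.
    by rewrite mulf_eq0 negb_or => /andP[].
  rewrite BE; apply: affine_change_mul.
    apply: affine_change_lower (oner_neq0 _) _; exact: affine_change1.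
  by apply: affine_change_upper => //; exact: IH.
have [A0|] := eqVneq (A 0%R 0%R) 0%R; last by move=> /pivot; exact.
have [i Ai] : exists i, dlsubmx A i 0%R != 0%R.
  apply: contrapT => nE; move/eqP: dA; apply.
  have cA : col 0%R A = 0%R.
    apply/colP => i; rewrite [RHS]mxE mxE.
    case: (split_ordP i) => j ->.
      by rewrite ord1; apply: etrans A0; congr (A _ _); exact/val_inj.
    apply/eqP/negPn/negP => Aj; apply: nE; exists j; rewrite !mxE.
    by apply: contra Aj => /eqP h; apply/eqP; rewrite -[RHS]h; congr (A _ _); exact/val_inj.
  rewrite (expand_det_col A 0%R) big1// => k _.
  have := congr1 (fun v : 'cV_(1 + n) => v k 0%R) cA; rewrite !mxE => ->.
  by rewrite mul0r.
pose E (s : R) : 'M[R]_(1 + n) := block_mx 1%:M (s *: delta_mx 0%R i) 0 1%:M.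
have EE : E (-1)%R *m E 1%R = 1%:M.
  rewrite /E mulmx_block !mul1mx !mul0mx !mulmx0 !mulmx1 !addr0 !add0r.
  by rewrite -scalerDl subrr scale0r -scalar_mx_block.
rewrite -[A]mul1mx -EE -mulmxA; apply: affine_change_mul.
  by apply: affine_change_upper (oner_neq0 _) _; exact: affine_change1.
apply: pivot; last first.
  by rewrite det_mulmx /E det_ublock !det1 !mul1r.
have -> : (E 1%R *m A) 0%R 0%R = dlsubmx A i 0%R; last by [].
rewrite -[A in LHS]submxK /E mulmx_block !mul1mx scale1r.
have e0 : (0%R : 'I_(1 + n)) = lshift n (0%R : 'I_1) by exact/val_inj.
rewrite e0 block_mxEul mxE -rowE [row _ _ _ _]mxE.
suff -> : ulsubmx A 0%R 0%R = 0%R by rewrite add0r.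
by rewrite !mxE -[RHS]A0; congr (A _ _); exact/val_inj.
Qed.

End AffineChange.

(** * The integral of log-concave functions *)

Section Measurability.
Context {R : realType} {n : nat}.
Local Notation V := 'cV[R]_n.
Local Notation mR := (measurableTypeR R).
Local Notation mV := ('cV[mR]_n).

Lemma measurable_box (A : 'I_n -> set mR) : (forall i, measurable (A i)) ->
  measurable [set v : mV | forall i, A i (v i ord0)].
Proof.
move=> mA; rewrite (_ : mkset _ = \bigcap_(i in [set: 'I_n])
    ((fun v : mV => v i ord0) @^-1` A i)); last first.
  by apply/seteqP; split=> v /= h i; [move=> _|]; exact: h.
apply: fin_bigcap_measurable => // i _; rewrite -[X in measurable X]setTI.
exact: (measurable_coor i measurableT (mA _)).
Qed.

Lemma open_measurable_cV (U : set V) : open U -> measurable (U : set mV).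
Proof.
move=> oU.
(* The sigma-algebra is generated by the coordinates, so an open set is written as the countable
   union of those boxes with rational centres and radii [1 / (k + 1)] that it contains. *)
pose itv (q : 'cV[rat]_n) (k : nat) i : set mR :=
  `](ratr (q i ord0) - k.+1%:R^-1 : R), ratr (q i ord0) + k.+1%:R^-1[%classic.
pose box q k : set mV := [set v : mV | forall i, itv q k i (v i ord0)].
have mbox q k : measurable (box q k).
  by apply: (@measurable_box (itv q k)) => i; exact: measurable_itv.
have -> : U = \bigcup_(qk : 'cV[rat]_n * nat)
    [set v | box qk.1 qk.2 v /\ box qk.1 qk.2 `<=` (U : set mV)].
  apply/seteqP; split=> [x Ux|x [qk _ [h]]]; last exact.
  have /nbhs_normP[e /= e0 eU] := open_nbhs_nbhs (conj oU Ux).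
  have [k _ /(_ k (leqnn k)) ke] := near_infty_natSinv_lt (PosNum (divr_gt0 e0 (ltr0n R 2))).
  have k0 : 0 < k.+1%:R^-1 :> R by rewrite invr_gt0 ltr0n.
  have ex i : exists r : rat, `|ratr r - x i ord0| < k.+1%:R^-1.
    have lt : x i ord0 - k.+1%:R^-1 < x i ord0 + k.+1%:R^-1.
      by rewrite ltrD2l gtrN.
    have [r] := rat_in_itvoo lt.
    by rewrite in_itv/= => /andP[h1 h2]; exists r; rewrite ltr_distl h1 h2.
  have [q Hq] := choice ex.
  exists (\col_i q i, k) => //=; split=> [i|v bv].
    by rewrite /itv mxE /= in_itv/= -ltr_distl distrC; exact: Hq.
  apply: eU => /=; apply: (@le_lt_trans _ _ (k.+1%:R^-1 + k.+1%:R^-1)); last first.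
    by rewrite [ltRHS]splitr; apply: ltrD; exact: ke.
  apply/norm_le_coord => [|i]; first by rewrite addr_ge0// ltW.
  have := bv i; rewrite /itv mxE /= in_itv/= -ltr_distl distrC => bvi.
  rewrite subr_mxE -[X in `|X|](subrKA (ratr (q i))).
  rewrite (le_trans (ler_normD _ _))// lerD// ltW// distrC//; exact: Hq.
apply: countable_bigcupT_measurable => // -[q k] /=.
have [h|h] := pselect (box q k `<=` (U : set mV)).
  rewrite (_ : [set v | _] = box q k)//.
  by apply/seteqP; split=> [v []|v bv]//; split.
rewrite (_ : [set v | _] = set0)//.
by rewrite -subset0 => v [].
Qed.

Lemma usc_measurable (f : V -> R) : usc f -> measurable_fun [set: mV] f.
Proof.
move=> uf; apply: (measurability (@RGenInftyO.G R)).
  exact: RGenInftyO.measurableE.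
move=> _ [_ [c ->] <-]; rewrite setTI; apply: open_measurable_cV.
rewrite openE => x /=; rewrite in_itv/= => fxc.
apply: filterS (uf x c fxc) => y fy.
by rewrite /= in_itv/=.
Qed.

End Measurability.

(** * An integrable majorant of product form *)

Section ExponentialMajorant.
Context {R : realType}.
Local Notation mR := (measurableTypeR R).
Local Notation mV n := ('cV[mR]_n).
Local Notation leb n := (@lebesgue_cV R n).

(** Up to its value at 0 this is [expR (- |t|)], assembled from the exponential density and its
    reflection, so that its integral is known. *)
Definition epdf2 (t : R) : R := exponential_pdf 1 t + exponential_pdf 1 (- t).

Lemma epdf2_ge0 t : 0 <= epdf2 t.
Proof. by rewrite addr_ge0// exponential_pdf_ge0. Qed.

Lemma expR_le_epdf2 t : expR (- `|t|) <= epdf2 t.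
Proof.
have E (s : R) : 0 <= s -> expR (- s) = exponential_pdf 1 s.
  by move=> s0; rewrite exponential_pdfE// mul1r mulN1r.
have [t0|t0] := leP 0 t; rewrite /epdf2.
  by rewrite ger0_norm// E// lerDl exponential_pdf_ge0.
have nt : 0 <= - t by rewrite oppr_ge0 ltW.
by rewrite ltr0_norm// E// lerDr exponential_pdf_ge0.
Qed.

Lemma measurable_epdf2 : measurable_fun [set: mR] epdf2.
Proof.
apply: measurable_funD; first exact: measurable_exponential_pdf.
apply: (measurableT_comp (@measurable_exponential_pdf R 1)).
exact: oppr_measurable.
Qed.

Lemma integral_epdf2 : (\int[@lebesgue_measure R]_t (epdf2 t)%:E = 2%:E)%E.
Proof.
have mp : measurable_fun [set: mR] (EFin \o exponential_pdf (1 : R)).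
  apply/measurable_EFinP; exact: measurable_exponential_pdf.
under eq_integral do rewrite EFinD.
have p0 t : (0 <= (exponential_pdf 1 t : R)%:E)%E by rewrite lee_fin exponential_pdf_ge0.
have mpN : measurable_fun [set: mR] (fun t : mR => (exponential_pdf 1 (- t) : R)%:E).
  exact: (measurableT_comp mp (@oppr_measurable R setT)).
rewrite ge0_integralD//.
have := @integral_affine1 R (-1) 0 (EFin \o exponential_pdf 1).
rewrite oppr_eq0 oner_eq0 => /(_ isT mp p0).
rewrite normrN1 mul1e => H.
have E : (\int[@lebesgue_measure R]_t (exponential_pdf 1 (- t) : R)%:E =
    \int[@lebesgue_measure R]_t (exponential_pdf 1 t : R)%:E)%E.
  by rewrite -[RHS]H; apply: eq_integral => t _ /=; rewrite addr0 mulN1r.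
by rewrite E integral_exponential_pdf.
Qed.

(** The product form lets Tonelli's theorem compute the integral. Decay at rate [n] in the sup norm
    suffices to stay below a multiple of it, since the absolute values of the coordinates add up to
    at most [n] times the norm. *)
Definition majorant n (x : 'cV[R]_n) : R := \prod_i epdf2 (x i 0).

Lemma majorant_ge0 n (x : 'cV[R]_n) : 0 <= majorant x.
Proof. by apply: prodr_ge0 => i _; exact: epdf2_ge0. Qed.

Lemma measurable_majorant n : measurable_fun [set: mV n] (@majorant n).
Proof.
apply: measurable_prod => i _.
exact: (measurableT_comp measurable_epdf2 (@measurable_coor _ mR n i)).
Qed.

Lemma integral_majorant n : (\int[leb n]_x (majorant x)%:E = (2 ^+ n)%:E)%E.
Proof.
elim: n => [|n IH].
  rewrite /= integral_dirac//; last first.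
    by apply/measurable_EFinP; exact: measurable_majorant.
  by rewrite diracT mul1e /majorant big_ord0.
have mm : measurable_fun [set: mV n.+1] (EFin \o @majorant n.+1).
  by apply/measurable_EFinP; exact: measurable_majorant.
rewrite (lebesgue_cV_tonelli1 mm); last by move=> x; rewrite lee_fin majorant_ge0.
have E t v : (EFin \o @majorant n.+1) (cons_cV (t, v)) =
    ((epdf2 t)%:E * (majorant v)%:E)%E.
  rewrite /= /majorant big_ord_recl -EFinM mxE unlift_none /=; congr (_ * _)%:E.
  by apply: eq_bigr => i _; rewrite mxE liftK.
under eq_integral => t _.
  under eq_integral do rewrite E.
  rewrite ge0_integralZl_EFin//; last 3 first.
  - by move=> v _; rewrite lee_fin majorant_ge0.
  - by apply/measurable_EFinP; exact: measurable_majorant.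
  - exact: epdf2_ge0.
  rewrite IH; over.
rewrite ge0_integralZr//; last 2 first.
- by apply/measurable_EFinP; exact: measurable_epdf2.
- by move=> t _; rewrite lee_fin epdf2_ge0.
by rewrite integral_epdf2 exprS.
Qed.

Lemma integrable_majorant n (C : R) :
  (leb n).-integrable setT (fun x => (C * majorant x)%:E).
Proof.
under eq_fun do rewrite EFinM.
apply: integrableZl => //; apply/integrableP; split.
  by apply/measurable_EFinP; exact: measurable_majorant.
under eq_integral do rewrite gee0_abs ?lee_fin ?majorant_ge0//.
by rewrite integral_majorant ltry.
Qed.

Lemma expR_le_majorant n (x : 'cV[R]_n) : expR (- (n%:R * `|x|)) <= majorant x.
Proof.
apply: (@le_trans _ _ (\prod_i expR (- `|x i 0|))).
  rewrite -expR_sum ler_expR sumrN lerN2.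
  apply: le_trans (_ : \sum_(i < n) `|x| <= _).
    by apply: ler_sum => i _; exact: coord_le_norm.
  by rewrite sumr_const card_ord mulr_natl.
by apply: ler_prod => i _; rewrite expR_ge0 expR_le_epdf2.
Qed.

End ExponentialMajorant.

Section Integral.
Context {R : realType} {n : nat}.
Local Notation V := 'cV[R]_n.
Local Notation mR := (measurableTypeR R).
Local Notation mV := ('cV[mR]_n).
Local Notation leb := (@lebesgue_cV R n).
Implicit Types (f g : V -> R).

Definition intf f : R := \int[leb]_x f x.

Lemma intf_ge0 f : (forall x, 0 <= f x) -> 0 <= intf f.
Proof. by move=> f0; apply: Rintegral_ge0. Qed.

Lemma majorized_integrable f (C : R) : measurable_fun [set: mV] f ->
  (forall x, 0 <= f x <= C * majorant x) -> leb.-integrable setT (EFin \o f).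
Proof.
move=> mf fC; apply: le_integrable (integrable_majorant n C) => //.
  exact/measurable_EFinP.
move=> x _; have /andP[f0 fx] := fC x.
by rewrite /= !lee_fin ger0_norm// (le_trans fx)// ler_norm.
Qed.

Lemma LC_measurable f : LC f -> measurable_fun [set: mV] f.
Proof. by case=> -[_ _ fu] _ _; exact: usc_measurable. Qed.

Lemma LC_majorant f : LC f -> exists C, forall x, 0 <= f x <= C * majorant x.
Proof.
move=> Lf; have [C C0 fC] := LC_bound n%:R Lf; exists C => x.
have [[f0 _ _] _ _] := Lf; rewrite f0 (le_trans (fC x))// ler_pM2l//.
exact: expR_le_majorant.
Qed.

Lemma LC_integrable f : LC f -> leb.-integrable setT (EFin \o f).
Proof.
move=> Lf; have [C fC] := LC_majorant Lf.
exact: majorized_integrable (LC_measurable Lf) fC.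
Qed.

Lemma le_intf f g : leb.-integrable setT (EFin \o f) ->
  leb.-integrable setT (EFin \o g) -> (forall x, f x <= g x) -> intf f <= intf g.
Proof. by move=> If Ig fg; apply: le_Rintegral. Qed.

Lemma intf_affine f (A : 'M[R]_n) (b : V) : measurable_fun [set: mV] f ->
  (forall x, 0 <= f x) -> \det A != 0 ->
  `|\det A| * intf (fun x => f (A *m x + b)) = intf f.
Proof.
move=> mf f0 dA.
have mEf : measurable_fun [set: mV] (EFin \o f) by exact/measurable_EFinP.
have := @affine_change_unit R n A dA b (EFin \o f) mEf (fun x => f0 x).
rewrite /intf /Rintegral /= => <-.
have d0 : 0 < `|\det A| by rewrite normr_gt0.
(* For an infinite integral both sides are 0, the default value of [fine]. *)
case: (\int[leb]_x (f (A *m x + b)%R)%:E)%E => [r||]//=.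
- by rewrite mulr0 mulry gtr0_sg// mul1e.
- by rewrite mulr0 mulrNy gtr0_sg// mul1e.
Qed.

(* Stretching by the factor 2 transversally to the hyperplane preserves f, but
   halves its integral. *)
Lemma intf_hyperplane f w c : LC f -> w != 0 ->
  (forall x, f x != 0 -> dotv w x = c) -> intf f = 0.
Proof.
move=> Lf w0 fw; have [f0 _ _] := LC_lcu Lf.
have [i wi] : exists i, w i ord0 != 0.
  apply: contrapT => nE; move/eqP : w0; apply; apply/colP => i; rewrite mxE.
  by apply/eqP/negPn/negP => wi; apply: nE; exists i.
set P := (\matrix_(a, b) if a == i then w b ord0 else (a == b)%:R) : 'M[R]_n.
have uP : P \in unitmx by exact: row_subst_unit.
have Pw x : (P *m x) i 0 = dotv w x.
  by rewrite mxE; apply: eq_bigr => k _; rewrite mxE eqxx.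
pose u := invmx P *m delta_mx i (0 : 'I_1).
have wu : dotv w u = 1 by rewrite -Pw /u mulKVmx// mxE !eqxx.
pose D : 'M[R]_n := diag_mx (\row_k if k == i then 2 else 1).
pose A := invmx P *m D *m P.
have AE x : A *m x = x + dotv w x *: u.
  have DE y : D *m y = y + (y i 0) *: delta_mx i (0 : 'I_1).
    apply/colP => k; rewrite mul_diag_mx !mxE.
    by have [->|_] := eqVneq k i; rewrite ?andbT /=; ring.
  rewrite -mulmxA -mulmxA DE mulmxDr mulKmx// -scalemxAr Pw; exact.
have dA : \det A = 2.
  have uP' : \det P != 0 by rewrite -unitfE -unitmxE.
  rewrite !det_mulmx det_inv mulrAC mulVf// mul1r det_diag (bigD1 i)//= mxE eqxx.
  by rewrite big1 ?mulr1// => k /negPf ki; rewrite mxE ki.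
have fA x : f (A *m x + - c *: u) = f x.
  have E : A *m x + - c *: u = x + (dotv w x - c) *: u.
    by rewrite AE -addrA -scalerDl.
  have [wx|wx] := eqVneq (dotv w x) c.
    by rewrite E wx subrr scale0r addr0.
  have -> : f x = 0 by apply/eqP; apply: contraNT wx => /fw ->.
  apply/eqP; apply: contraNT wx => /fw; rewrite E dotvDr dotvZr wu mulr1 => h.
  by apply/eqP; lra.
have := @intf_affine f A (- c *: u) (LC_measurable Lf) f0.
rewrite dA => /(_ (lt0r_neq0 (ltr0n _ 2))).
have -> : (fun x => f (A *m x + - c *: u)) = f by apply/funext.
by rewrite ger0_norm//; lra.
Qed.

Lemma intf_comp f (A : 'M[R]_n) : LC f -> \det A = 1 -> intf (f \o mulmx A) = intf f.
Proof.
move=> Lf dA; have [f0 _ _] := LC_lcu Lf.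
rewrite -(@intf_affine f A 0 (LC_measurable Lf) f0) dA ?oner_neq0// normr1 mul1r.
by congr intf; apply/funext => x /=; rewrite addr0.
Qed.

Lemma intf_translate f y : LC f -> intf (translate y f) = intf f.
Proof.
move=> Lf; have [f0 _ _] := LC_lcu Lf.
rewrite -(@intf_affine f 1%:M (- y) (LC_measurable Lf) f0) det1 ?oner_neq0//.
by rewrite normr1 mul1r; congr intf; apply/funext => x; rewrite mul1mx.
Qed.

Lemma intf_scale f (s : R) : LC f -> intf (fun x => s * f x) = s * intf f.
Proof. by move=> Lf; rewrite /intf RintegralZl//; exact: LC_integrable. Qed.

Lemma intf_valuation f g : LC f -> LC g -> LC (f \max g) -> LC (f \min g) ->
  intf (f \max g) + intf (f \min g) = intf f + intf g.
Proof.
move=> Lf Lg LM Lm; rewrite /intf -!RintegralD//; try exact: LC_integrable.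
by apply: eq_Rintegral => x _; rewrite addr_max_min.
Qed.

End Integral.

(** * Simplices in the support and lower bounds near their centroids *)

Section CoreBound.
Context {R : realType} {n : nat}.
Local Notation V := 'cV[R]_n.
Implicit Types (x y z : V) (v : 'M[R]_(n, 1 + n)) (f : V -> R).

(** Sums are normalised because the partial sums of convex weights do not add up to 1; adding one
    point is then a single convex combination. *)
Lemma convexs_weighted (C : set V) m (x_ : 'I_m -> V) (l : 'I_m -> R) (s : seq 'I_m) :
  convexs C -> (forall k, C (x_ k)) -> (forall k, 0 <= l k) ->
  0 < \sum_(k <- s) l k ->
  C ((\sum_(k <- s) l k)^-1 *: \sum_(k <- s) l k *: x_ k).
Proof.
move=> vC Cx l0; elim: s => [|k s IH]; first by rewrite big_nil ltxx.
rewrite !big_cons; set L := \sum_(j <- s) l j; set X := \sum_(j <- s) _.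
have L0 : 0 <= L by apply: sumr_ge0.
have [L00|Lp] : L = 0 \/ 0 < L by move: L0; rewrite le_eqVlt => /predU1P[<-|]; [left|right].
  have -> : X = 0.
    rewrite /X big_seq big1// => j js.
    suff -> : l j = 0 by rewrite scale0r.
    apply/eqP; rewrite eq_le l0 andbT -L00 /L.
    by rewrite (big_rem j)//= lerDl sumr_ge0.
  rewrite L00 !addr0 => lk; rewrite scalerA mulVf ?gt_eqF// scale1r; exact: Cx.
have [l00|lp] : l k = 0 \/ 0 < l k.
    by have := l0 k; rewrite le_eqVlt => /predU1P[<-|]; [left|right].
  by rewrite l00 scale0r !add0r => _; exact: IH.
move=> S0; have -> : (l k + L)^-1 *: (l k *: x_ k + X) =
    (l k / (l k + L)) *: x_ k + (1 - l k / (l k + L)) *: (L^-1 *: X).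
  rewrite scalerDr !scalerA; congr (_ *: _ + _ *: _); first exact: mulrC.
  by field; rewrite !gt_eqF.
apply: vC => //; last exact: IH.
by rewrite divr_gt0//= ltr_pdivrMr// mul1r ltrDl.
Qed.

Lemma convexs_simplex_sub (C : set V) v : convexs C ->
  (forall k, C (col k v)) -> simplex v `<=` C.
Proof.
move=> vC Cv x [l l0 lx].
have l1 : \sum_k l k 0 = 1 by exact: homog_sum1 lx.
have := @convexs_weighted C _ (fun k => col k v) (fun k => l k 0) (index_enum _) vC Cv l0.
rewrite l1 invr1 scale1r ltr01 => /(_ isT).
suff -> : \sum_k l k 0 *: col k v = x by [].
have /homog_eqP[_ <-] := lx.
apply/colP => a; rewrite mxE summxE; apply: eq_bigr => k _.
by rewrite !mxE mulrC.
Qed.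

Lemma cvg_det m (A_ : nat -> 'M[R]_m) (A : 'M[R]_m) :
  (forall i j, A_ k i j @[k --> \oo] --> A i j) ->
  \det (A_ k) @[k --> \oo] --> \det A.
Proof.
move=> AA; apply: cvg_big => [|s _]; first exact: add_continuous.
apply: cvgM; first exact: cvg_cst.
by apply: cvg_big => [|i _]; [exact: mul_continuous|exact: AA].
Qed.

Lemma cvg_adj m (A_ : nat -> 'M[R]_m) (A : 'M[R]_m) i j :
  (forall i j, A_ k i j @[k --> \oo] --> A i j) ->
  (\adj (A_ k)) i j @[k --> \oo] --> (\adj A) i j.
Proof.
move=> AA; under eq_fun do rewrite mxE; rewrite mxE.
apply: cvgM; first exact: cvg_cst.
by apply: cvg_det => a b; under eq_fun do rewrite !mxE; rewrite !mxE; exact: AA.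
Qed.

Lemma cvg_homog m (v_ : nat -> 'M[R]_(n, m)) (v : 'M[R]_(n, m)) :
  (forall a b, v_ k a b @[k --> \oo] --> v a b) ->
  forall a b, homog (v_ k) a b @[k --> \oo] --> homog v a b.
Proof.
move=> vv a b; rewrite /homog; under eq_fun do rewrite mxE; rewrite mxE.
case: (fintype.split a) => c; last exact: vv.
by under eq_fun do rewrite mxE; rewrite mxE; exact: cvg_cst.
Qed.

(* Barycentric coordinates depend continuously on the vertices, so points
   converging to the centroid of a simplex end up in the moving simplices. *)
Lemma centroid_lower_bound (f_ : nat -> V -> R) f v :
  (forall i, logconcave (f_ i)) -> hypo f_ f -> \det (homog v) != 0 ->
  (forall k, 0 < f (col k v)) ->
  exists p : V, exists2 de : R, 0 < de & forall z_ : nat -> V,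
    z_ i @[i --> \oo] --> p ->
    \forall i \near \oo, de <= f_ i (z_ i).
Proof.
move=> fl [_ fr] dv fv.
(* A positive number below all vertex values of [f], in closed form instead of a minimum. *)
pose de := (1 + \sum_k (f (col k v))^-1)^-1.
have S0 : 0 <= \sum_k (f (col k v))^-1.
  by apply: sumr_ge0 => k _; rewrite invr_ge0 ltW.
have de0 : 0 < de by rewrite invr_gt0 ltr_pwDl.
have de_lt k : de < f (col k v).
  rewrite -[ltRHS]invrK ltf_pV2 ?posrE ?invr_gt0//; last by rewrite ltr_pwDl.
  by rewrite (bigD1 k)//= addrCA ltrDl ltr_pwDl// sumr_ge0// => j _; rewrite invr_ge0 ltW.
pose l : 'cV[R]_(1 + n) := const_mx (1 + n)%:R^-1.
have N0 : 0 < (1 + n)%:R^-1 :> R by rewrite invr_gt0 ltr0n.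
have l1 : \sum_k l k 0 = 1.
  under eq_bigr do rewrite mxE; rewrite sumr_const card_ord -[_ *+ _]mulr_natl.
  by rewrite mulfV// pnatr_eq0.
pose p := v *m l.
have lp : homog v *m l = homog p by apply/homog_eqP; split=> // k; rewrite ord1.
exists p, de => // z_ zp.
have fr2 k : exists x_ : nat -> V, x_ @ \oo --> col k v /\
    f_ i (x_ i) @[i --> \oo] --> f (col k v) by have [x_ ? ?] := fr (col k v); exists x_.
have [x_ Hx] := choice fr2.
pose v_ i : 'M[R]_(n, 1 + n) := \matrix_(a, k) x_ k i a 0.
have colv i k : col k (v_ i) = x_ k i by apply/colP => a; rewrite !mxE.
have vv a k : v_ i a k @[i --> \oo] --> v a k.
  have H : x_ k i a ord0 @[i --> \oo] --> (col k v) a ord0.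
    by apply: cvg_coord; exact: (Hx k).1.
  by under eq_fun do rewrite mxE; rewrite mxE in H.
have hv := cvg_homog vv.
have hz : forall a b, homog (z_ i) a b @[i --> \oo] --> homog p a b.
  by apply: cvg_homog => a b; rewrite (ord1 b); exact: cvg_coord.
have cd := cvg_det hv.
(* Cramer's rule for the barycentric coordinates of [z_ i], whose convergence follows from that of
   the matrix entries. The limits are those of the centroid, hence positive. *)
pose w i := (\det (homog (v_ i)))^-1 *: (\adj (homog (v_ i)) *m homog (z_ i)).
have cw k : w i k 0 @[i --> \oo] --> ((1 + n)%:R^-1 : R).
  have -> : (1 + n)%:R^-1 =
      ((\det (homog v))^-1 *: (\adj (homog v) *m homog p)) k 0.
    by rewrite -lp mulmxA mul_adj_mx mul_scalar_mx scalerA mulVf// scale1r mxE.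
  rewrite mxE; under eq_fun do rewrite mxE.
  apply: cvgM; first exact: cvgV.
  rewrite mxE; under eq_fun do rewrite mxE.
  apply: cvg_big => [|a _]; first exact: add_continuous.
  by apply: cvgM; [exact: cvg_adj|exact: hz].
have ev1 : \forall i \near \oo, \det (homog (v_ i)) != 0.
  exact: cvgr_neq0 cd dv.
have ev2 : \forall i \near \oo, forall k, 0 < w i k 0.
  by apply: filter_forall => k; exact: cvgr_gt (cw k) _ N0.
have ev3 : \forall i \near \oo, forall k, de < f_ i (x_ k i).
  by apply: filter_forall => k; exact: cvgr_gt (proj2 (Hx k)) _ (de_lt k).
near=> i.
have di : \det (homog (v_ i)) != 0 by near: i.
have wi : forall k, 0 < w i k 0 by near: i.
have fi : forall k, de < f_ i (x_ k i) by near: i.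
apply: (@convexs_simplex_sub [set x | de <= f_ i x] (v_ i)).
- move=> x y t /andP[t0 t1] /= fx fy; apply: logconcave_superlevel => //.
  by rewrite !ltW.
- by move=> k /=; rewrite colv ltW.
- exists (w i) => [k|]; first exact: ltW.
  by rewrite /w -scalemxAr mulmxA mul_mx_adj mul_scalar_mx scalerA mulVf// scale1r.
Unshelve. all: by end_near. Qed.

Lemma row_free_col_mx k m (u : 'rV[R]_m) (A : 'M[R]_(k, m)) :
  row_free A -> ~~ (u <= A)%MS -> row_free (col_mx u A).
Proof.
move=> Af uA; apply: inj_row_free => w; rewrite -[w]hsubmxK mul_row_col.
set a := lsubmx w; set b := rsubmx w => e.
have a0 : a 0 0 = 0.
  apply/eqP; apply: contraNT uA => a0; apply/submxP; exists (- (a 0 0)^-1 *: b).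
  have e' : a 0 0 *: u = - (b *m A).
    by apply/eqP; rewrite -addr_eq0 -mul_scalar_mx -mx11_scalar e.
  by rewrite -scalemxAl scaleNr -scalerN -e' scalerA mulVf// scale1r.
have az : a = 0 by rewrite (mx11_scalar a) a0 raddf0.
move: e; rewrite az mul0mx add0r => /eqP; rewrite mulmx_free_eq0// => /eqP ->.
exact: row_mx0.
Qed.

(** Affinely independent points of [S] are collected greedily. If this stops before [1 + n] points,
    a non-zero column of the cokernel is an affine function vanishing on [S]; as [S] is non-empty,
    this function is not constant, and its slope is the normal. *)
Lemma simplex_or_hyperplane (S : set V) : S !=set0 ->
  (exists2 v, \det (homog v) != 0 & forall k, S (col k v)) \/
  (exists w c, w != 0 /\ forall x, S x -> dotv w x = c).
Proof.
move=> [x0 Sx0]; apply: contrapT => /not_orP[nv nw].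
suff H k : (k <= 1 + n)%N -> exists2 A : 'M[R]_(k, 1 + n), row_free A &
    forall i, exists2 x, S x & row i A = (homog x)^T.
  have [A Af AS] := H _ (leqnn _); apply: nv.
  have AE : homog (dsubmx A^T) = A^T.
    rewrite -[RHS]vsubmxK; congr col_mx; apply/rowP => j; rewrite !mxE.
    have [x Sx rx] := AS j.
    have := congr1 (fun r : 'rV_(1 + n) => r 0 (lshift n 0)) rx.
    by rewrite !mxE (unsplitK (inl _)) mxE => ->.
  exists (dsubmx A^T) => [|j].
    by rewrite AE det_tr -unitfE -unitmxE -row_free_unit.
  have [x Sx rx] := AS j; suff -> : col j (dsubmx A^T) = x by [].
  apply: (@homog_inj _ _ 1); apply: trmx_inj; rewrite -rx -[RHS]trmxK; congr (_^T).
  have -> : (row j A)^T = col j (homog (dsubmx A^T)) by rewrite AE tr_row.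
  by apply/colP => i; rewrite !mxE; case: (fintype.split i) => c; rewrite !mxE.
elim: k => [_|k IH kn].
  exists 0 => [|[]//]; rewrite /row_free.
  by rewrite -leqn0 rank_leq_row.
have [A Af AS] := IH (ltnW kn).
have [allA|] := pselect (forall x, S x -> ((homog x)^T <= A)%MS).
  exfalso; apply: nw.
  have : cokermx A != 0.
    rewrite -mxrank_eq0 mxrank_coker; move: Af; rewrite /row_free => /eqP ->.
    by rewrite subn_eq0 -ltnNge.
  move=> /matrix0Pn[a [b ab]].
  pose al := (col b (cokermx A))^T.
  have al0 x : S x -> aff al x = 0.
    move=> /allA; rewrite submxE => /eqP e.
    rewrite /aff /al -[homog x]trmxK -trmx_mul [LHS]mxE.
    by rewrite colE mulmxA e mul0mx mxE.
  exists (rsubmx al)^T, (- al 0 0); split; last first.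
    by move=> x /al0; rewrite affE => h; apply/eqP; rewrite -addr_eq0 addrC h.
  apply/negP => /eqP r0.
  have al00 : al 0 0 = 0.
    by have := al0 _ Sx0; rewrite affE r0 dotv0l addr0.
  have : al = 0.
    rewrite -[al]hsubmxK; have -> : rsubmx al = 0 by rewrite -[LHS]trmxK r0 trmx0.
    have -> : lsubmx al = 0.
      by apply/rowP => j; rewrite ord1 [LHS]mxE [RHS]mxE -[RHS]al00; congr (al _ _); exact/val_inj.
    exact: row_mx0.
  have ala : al 0 a = cokermx A a b by rewrite [LHS]mxE [LHS]mxE.
  by move=> al_0; move: ab; rewrite -ala al_0 mxE eqxx.
move=> /existsNP[y /not_implyP[Sy yA]].
pose A' : 'M[R]_(1 + k, 1 + n) := col_mx (homog y)^T A.
have A'S (i : 'I_(1 + k)) : exists2 x, S x & row i A' = (homog x)^T.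
  case: (split_ordP i) => j ->; last by rewrite /A' rowKd; exact: AS.
  by exists y => //; rewrite /A' rowKu ord1 row_id.
exists A'; last exact: A'S.
by apply: row_free_col_mx => //; exact/negP.
Qed.

End CoreBound.

(** * Hypo-continuity of the integral *)

Section IntegralContinuity.
Context {R : realType} {n : nat}.
Local Notation V := 'cV[R]_n.
Local Notation mR := (measurableTypeR R).
Local Notation mV := ('cV[mR]_n).
Local Notation leb := (@lebesgue_cV R n).
Implicit Types (f g : V -> R).

Lemma intf_dominated (f_ : nat -> V -> R) f g :
  (forall i, measurable_fun [set: mV] (f_ i)) -> measurable_fun [set: mV] f ->
  leb.-integrable setT (EFin \o g) ->
  (\forall i \near \oo, forall x, `|f_ i x| <= g x) ->
  (forall x, f_ i x @[i --> \oo] --> f x) ->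
  intf (f_ i) @[i --> \oo] --> intf f.
Proof.
(* Dominated convergence wants the bound for every index, hence the shift by [N]. *)
move=> mf_ mf ig [N _ fg] ff; rewrite -(cvg_shiftn N).
have [|||||If _ H] := @dominated_convergence _ _ _ leb setT measurableT
  (fun i => EFin \o f_ (i + N)%N) (EFin \o f) (EFin \o g).
- by move=> i; exact/measurable_EFinP.
- exact/measurable_EFinP.
- apply: aeW => x _; apply: cvg_EFin; first exact: nearW.
  by have := ff x; rewrite -(cvg_shiftn N).
- exact: ig.
- by apply: aeW => x i _; rewrite /= lee_fin fg//= leq_addl.
by apply: fine_cvg; rewrite /intf /Rintegral fineK//; exact: integrable_fin_num.
Qed.

(** Truncation turns a one-sided estimate into convergence, which dominated convergence can use. *)
Lemma cvg_min_l (a_ : nat -> R) (a b : R) : b <= a ->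
  (forall e, 0 < e -> \forall i \near \oo, a - e < a_ i) ->
  Num.min (a_ i) b @[i --> \oo] --> b.
Proof.
move=> ba aa; apply/cvgrPdist_lt => e e0; near=> i.
have ai : a - e < a_ i by near: i; exact: aa.
have mb : Num.min (a_ i) b <= b by rewrite ge_min lexx orbT.
rewrite ger0_norm ?subr_ge0// ltrBlDr -ltrBlDl lt_min.
by apply/andP; split; lra.
Unshelve. all: by end_near. Qed.

(** The maximum of [f_ i] and [f] converges to [f] pointwise, because hypo-convergence bounds [f_ i]
    from above at each fixed point; uniform decay supplies the dominating function. *)
Lemma intf_upper (f_ : nat -> V -> R) f : (forall i, LC (f_ i)) -> LC f ->
  hypo f_ f -> forall e, 0 < e -> \forall i \near \oo, intf (f_ i) < intf f + e.
Proof.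
move=> Lf_ Lf ff e e0; have [hs _] := ff.
have [f0 _ _] := LC_lcu Lf.
have [C C0 Hd] := uniform_decay n%:R (fun i => LC_lcu (Lf_ i)) Lf ff.
have [C' HC'] := LC_majorant Lf.
have C'0 : 0 <= `|C'| by [].
have bnd : \forall i \near \oo, forall x, 0 <= Num.max (f_ i x) (f x) <= (C + `|C'|) * majorant x.
  apply: filterS Hd => i fi x; rewrite le_max f0 orbT/= ge_max mulrDl.
  have := majorant_ge0 x; have := expR_le_majorant x => h1 h2.
  apply/andP; split.
    apply: (le_trans (fi x)); apply: ler_wpDr; first exact: mulr_ge0.
    by rewrite ler_pM2l.
  have /andP[_ h3] := HC' x; apply: (le_trans h3).
  apply: ler_wpDl; first by rewrite mulr_ge0// ltW.
  by rewrite ler_wpM2r// ler_norm.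
have mM i : measurable_fun [set: mV] (fun x => Num.max (f_ i x) (f x)).
  by apply: measurable_maxr; exact: LC_measurable.
have cv : intf (fun x => Num.max (f_ i x) (f x)) @[i --> \oo] --> intf f.
  apply: (@intf_dominated _ _ (fun x => (C + `|C'|) * majorant x)).
  - exact: mM.
  - exact: LC_measurable.
  - exact: integrable_majorant.
  - by apply: filterS bnd => i bi x; have /andP[h1 h2] := bi x; rewrite ger0_norm.
  - move=> x; apply/cvgrPdist_lt => d d0.
    have [[A B] [/= Ax Boo] AB] : \forall z \near x & i \near \oo, f_ i z < f x + d.
      by apply: hs; rewrite ltrDl.
    apply: filterS Boo => i Bi.
    have fi : f_ i x < f x + d by apply: (AB (x, i)); split=> //=; exact: nbhs_singleton.
    have h : f x <= Num.max (f_ i x) (f x) by rewrite le_max lexx orbT.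
    rewrite distrC ger0_norm ?subr_ge0// ltrBlDl gt_max fi/=.
    by rewrite ltrDl.
near=> i; apply: (@le_lt_trans _ _ (intf (fun x => Num.max (f_ i x) (f x)))).
  apply: le_intf => [||x]; first exact: LC_integrable.
    by apply: (@majorized_integrable _ _ _ (C + `|C'|)); [exact: mM|near: i].
  by rewrite le_max lexx.
by near: i; apply: cvgr_lt cv _ _; rewrite ltrDl.
Unshelve. all: by end_near. Qed.

(* Contracting f_ i towards a centroid p gives a lower bound at every point, so
   that the boundary of the support needs no attention; the contraction costs
   the factor (1 - la) ^+ n, which tends to 1 with la. *)
Section Lower.
Context (f_ : nat -> V -> R) (f : V -> R) (Lf_ : forall i, LC (f_ i)) (Lf : LC f).
Context (ff : hypo f_ f) (p : V) (de : R) (de0 : 0 < de).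
Hypothesis Hde : forall z_ : nat -> V, z_ i @[i --> \oo] --> p ->
  \forall i \near \oo, de <= f_ i (z_ i).

(** The second argument of the minimum is what log-concavity guarantees in the limit at
    [(1 - la) *: y + la *: p], from the values [f y] and [de]. The minimum with [f y] makes [f] a
    dominating function. *)
Definition shrunk (la : R) (y : V) : R :=
  Num.min (f y) (f y `^ (1 - la) * de `^ la).

Let f0 x : 0 <= f x. Proof. by have [] := LC_lcu Lf. Qed.

Lemma shrunk_ge0 la y : 0 <= shrunk la y.
Proof. by rewrite le_min f0 mulr_ge0 ?powR_ge0. Qed.

Lemma shrunk_le la y : shrunk la y <= f y.
Proof. by rewrite ge_min lexx. Qed.

Lemma measurable_shrunk la : measurable_fun [set: mV] (shrunk la).
Proof.
have mf := LC_measurable Lf.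
apply: measurable_minr => //; apply: measurable_funM => //.
exact: (@measurableT_comp _ _ _ mV R R (fun a => a `^ (1 - la))).
Qed.

Lemma shrunk_integrable la : leb.-integrable setT (EFin \o shrunk la).
Proof.
apply: le_integrable (LC_integrable Lf) => //.
  by apply/measurable_EFinP; exact: measurable_shrunk.
by move=> x _; rewrite /= !lee_fin !ger0_norm ?shrunk_ge0// shrunk_le.
Qed.

Lemma cvg_shrunk (la_ : nat -> R) : la_ i @[i --> \oo] --> (0 : R) ->
  intf (shrunk (la_ i)) @[i --> \oo] --> intf f.
Proof.
move=> la0; apply: (@intf_dominated _ _ f).
- by move=> i; exact: measurable_shrunk.
- exact: LC_measurable.
- exact: LC_integrable.
- by apply: nearW => i x; rewrite ger0_norm ?shrunk_ge0// shrunk_le.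
move=> y; have [fy|fy] := eqVneq (f y) 0.
  rewrite (_ : (fun i => shrunk (la_ i) y) = fun=> f y); first exact: cvg_cst.
  apply/funext => i; apply/eqP; rewrite eq_le shrunk_le/= fy; exact: shrunk_ge0.
have fy0 : 0 < f y by rewrite lt_neqAle eq_sym fy f0.
rewrite /shrunk; under eq_fun do rewrite minC.
apply: (@cvg_min_l _ (f y)) => // e e0.
suff cv : f y `^ (1 - la_ i) * de `^ (la_ i) @[i --> \oo] --> f y.
  by apply: cvgr_gt cv _ _; rewrite gtrBl.
suff : f y `^ (1 - la_ i) * de `^ (la_ i) @[i --> \oo] --> expR (ln (f y)) * expR 0.
  by rewrite expR0 mulr1 (lnK fy0).
under eq_fun do rewrite /powR (negPf fy) (gt_eqF de0).
apply: cvgM; apply: continuous_cvg; try exact: continuous_expR.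
  rewrite -[X in _ --> X]mul1r; apply: cvgM; last exact: cvg_cst.
  by rewrite -[X in _ --> X]subr0; apply: cvgB => //; exact: cvg_cst.
by rewrite -(mul0r (ln de)); apply: cvgM => //; exact: cvg_cst.
Qed.

Lemma shrunk_lower la y : 0 < la < 1 ->
  Num.min (f_ i ((1 - la) *: y + la *: p)) (shrunk la y) @[i --> \oo] -->
  shrunk la y.
Proof.
move=> /andP[la0 la1].
have f_0 i x : 0 <= f_ i x by have [] := LC_lcu (Lf_ i).
have la1' : 0 < 1 - la by rewrite subr_gt0.
have [fy|fy] := eqVneq (f y) 0.
  have -> : shrunk la y = 0.
    by apply/eqP; rewrite eq_le shrunk_ge0 andbT -fy shrunk_le.
  by under eq_fun do rewrite min_r//; exact: cvg_cst.
have fy0 : 0 < f y by rewrite lt_neqAle eq_sym fy f0.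
pose L := f y `^ (1 - la) * de `^ la.
have LE : L = expR ((1 - la) * ln (f y) + la * ln de).
  by rewrite /L /powR (negPf fy) (gt_eqF de0) expRD.
apply: (@cvg_min_l _ L) => [|e e0]; first by rewrite /shrunk ge_min lexx orbT.
have [_ fr] := ff; have [y_ yy fyy] := fr y.
(* Chosen so that [(1 - la) *: y_ i + la *: z_ i] is exactly the fixed point
   [(1 - la) *: y + la *: p]: the motion of the recovery points is absorbed near [p], where the
   bound [de] is stable. *)
pose z_ i := p + ((1 - la) / la) *: (y - y_ i).
have zp : z_ i @[i --> \oo] --> p.
  rewrite -[X in _ --> X]addr0 -(scaler0 _ ((1 - la) / la)) -(subrr y).
  apply: cvgD; first exact: cvg_cst.
  by apply: cvgZr; apply: cvgB => //; exact: cvg_cst.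
have cL : expR ((1 - la) * ln (f_ i (y_ i)) + la * ln de) @[i --> \oo] --> L.
  rewrite LE; apply: continuous_cvg; first exact: continuous_expR.
  apply: cvgD; last exact: cvg_cst.
  apply: cvgM; first exact: cvg_cst.
  by apply: continuous_cvg => //; exact: continuous_ln.
near=> i.
have fi : 0 < f_ i (y_ i) by near: i; exact: cvgr_gt fyy _ fy0.
have zi : de <= f_ i (z_ i) by near: i; exact: Hde.
apply: (@lt_le_trans _ _ (expR ((1 - la) * ln (f_ i (y_ i)) + la * ln de))).
  by near: i; apply: cvgr_gt cL _ _; rewrite gtrBl.
have [_ fl _] := LC_lcu (Lf_ i).
have := fl (y_ i) (z_ i) (ln (f_ i (y_ i))) (ln de) (1 - la).
rewrite la1' gtrBl la0 lnK// (lnK de0) lexx zi => /(_ isT isT isT).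
rewrite subKr => /le_trans; apply.
have -> // : (1 - la) *: y_ i + la *: z_ i = (1 - la) *: y + la *: p.
apply/colP => k; rewrite !mxE; field; exact: lt0r_neq0.
Unshelve. all: by end_near. Qed.

Lemma intf_lower e : 0 < e -> \forall i \near \oo, intf f - e < intf (f_ i).
Proof.
(* Starting at [1 / 2] keeps the contraction factor [1 - la_ k] positive. *)
move=> e0; pose la_ k : R := k.+2%:R^-1.
have la_0 k : 0 < la_ k < 1.
  by rewrite invr_gt0 ltr0n/= invf_lt1 ?ltr0n// ltr1n.
have cla : la_ k @[k --> \oo] --> (0 : R).
  by have := @cvg_harmonic R; rewrite -(cvg_shiftn 1); under eq_fun do rewrite /= addn1.
have cI : (1 - la_ k) ^+ n * intf (shrunk (la_ k)) @[k --> \oo] --> intf f.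
  have c1 : 1 - la_ k @[k --> \oo] --> (1 : R).
    by rewrite -[X in _ --> X]subr0; apply: cvgB => //; exact: cvg_cst.
  rewrite -[X in _ --> X]mul1r; apply: cvgM; last exact: cvg_shrunk.
  rewrite -[X in _ --> X](expr1n _ n).
  by apply: (cvg_comp _ (fun r => r ^+ n) c1); exact: exprn_continuous.
have [k Hk] : exists k, intf f - e < (1 - la_ k) ^+ n * intf (shrunk (la_ k)).
  have [k _ /(_ k (leqnn k))] : \forall k \near \oo,
      intf f - e < (1 - la_ k) ^+ n * intf (shrunk (la_ k)).
    by apply: cvgr_gt cI _ _; rewrite gtrBl.
  by exists k.
have /andP[la0 la1] := la_0 k; set la := la_ k in Hk la0 la1 *.
have la1' : 0 < 1 - la by rewrite subr_gt0.
pose F i y := f_ i ((1 - la) *: y + la *: p).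
have LF i : LC (F i).
  have -> : F i = fun y => f_ i ((1 - la)%:M *m y + la *: p).
    by apply/funext => y; rewrite mul_scalar_mx.
  by apply: LC_affine => //; rewrite unitmxE det_scalar unitfE expf_neq0// gt_eqF.
have fF i : intf (f_ i) = (1 - la) ^+ n * intf (F i).
  have [f_0 _ _] := LC_lcu (Lf_ i).
  rewrite -(@intf_affine _ _ (f_ i) (1 - la)%:M (la *: p) (LC_measurable (Lf_ i)) f_0).
    rewrite det_scalar ger0_norm ?exprn_ge0 ?ltW//; congr (_ * intf _).
    by apply/funext => y; rewrite mul_scalar_mx.
  by rewrite det_scalar expf_neq0// gt_eqF.
pose G i y := Num.min (F i y) (shrunk la y).
have G0 i y : 0 <= G i y.
  by rewrite le_min shrunk_ge0 andbT; have [] := LC_lcu (LF i).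
have mG i : measurable_fun [set: mV] (G i).
  by apply: measurable_minr; [exact: LC_measurable|exact: measurable_shrunk].
have cG : intf (G i) @[i --> \oo] --> intf (shrunk la).
  apply: (@intf_dominated _ _ (shrunk la)).
  - exact: mG.
  - exact: measurable_shrunk.
  - exact: shrunk_integrable.
  - by apply: nearW => i y; rewrite ger0_norm// ge_min lexx orbT.
  - by move=> y; apply: shrunk_lower; rewrite la0.
have cG' : (1 - la) ^+ n * intf (G i) @[i --> \oo] --> (1 - la) ^+ n * intf (shrunk la).
  by apply: cvgM => //; exact: cvg_cst.
near=> i; apply: (@lt_le_trans _ _ ((1 - la) ^+ n * intf (G i))).
  by near: i; exact: cvgr_gt cG' _ Hk.
rewrite fF; apply: ler_wpM2l; first by rewrite exprn_ge0 ?ltW.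
apply: le_intf.
- apply: le_integrable (shrunk_integrable la) => //; first exact/measurable_EFinP.
  move=> y _; rewrite /= !lee_fin !ger0_norm ?shrunk_ge0//.
  by rewrite ge_min lexx orbT.
- exact: LC_integrable.
- by move=> y; rewrite ge_min lexx.
Unshelve. all: by end_near. Qed.

End Lower.

(** The lower estimate distinguishes two cases: if the support of [f] lies in a hyperplane, its
    integral is 0 and non-negativity suffices; otherwise the support contains the vertices of a
    proper simplex, whose centroid is the centre of contraction. *)
Lemma intf_cvg (f_ : nat -> V -> R) f : (forall i, LC (f_ i)) -> LC f ->
  hypo f_ f -> intf (f_ i) @[i --> \oo] --> intf f.
Proof.
move=> Lf_ Lf ff; have [f0 _ _] := LC_lcu Lf.
have low e : 0 < e -> \forall i \near \oo, intf f - e < intf (f_ i).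
  move=> e0; have [x fx] : exists x, 0 < f x by case: Lf.
  have [|[v dv fv]|[w [c [w0 wf]]]] := @simplex_or_hyperplane R n [set x | 0 < f x].
  - by exists x.
  - have fl i : logconcave (f_ i) by have [_ fl _] := LC_lcu (Lf_ i).
    have [p [de de0 Hde]] := centroid_lower_bound fl ff dv fv.
    exact: intf_lower Lf_ Lf ff p de de0 Hde e e0.
  - have -> : intf f = 0.
      by apply: (intf_hyperplane Lf w0) => y fy; apply: wf; rewrite /= lt_neqAle eq_sym fy f0.
    apply: nearW => i; rewrite sub0r (lt_le_trans (_ : _ < 0)) ?oppr_lt0//.
    by apply: intf_ge0; have [] := LC_lcu (Lf_ i).
apply/cvgrPdist_lt => e e0; near=> i.
have h1 : intf f - e < intf (f_ i) by near: i; exact: low.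
have h2 : intf (f_ i) < intf f + e by near: i; exact: intf_upper.
by rewrite distrC ltr_distl h1 h2.
Unshelve. all: by end_near. Qed.

Lemma intf_invariant_valuation : invariant_valuation (@intf R n).
Proof.
split.
- exact: intf_cvg.
- exact: intf_comp.
- exact: intf_valuation.
- exact: intf_translate.
- by move=> f s _; exact: intf_scale.
Qed.

Lemma intf_point0 : (0 < n)%N -> intf (@point0 R n) = 0.
Proof.
move=> n0; apply: (@intf_hyperplane _ _ _ (const_mx 1) 0 (@LC_point0 R n)).
  apply/eqP => /(congr1 (fun v : V => v (Ordinal n0) 0)); rewrite !mxE => /eqP.
  by rewrite oner_eq0.
move=> x; have [->|x0] := eqVneq x 0; first by rewrite dotvC dotv0l.
by rewrite point0_neq0// eqxx.
Qed.

(** The simplex contains the cube with one corner at the origin and edges of length [1 / n], whose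
    measure is known. *)
Lemma intf_stdsimplex (n1 : (1 < n)%N) :
  0 < intf (expsimplex (fun=> 0) (@stdsimplex R n n1 1)).
Proof.
have n0 : 0 < n%:R^-1 :> R by rewrite invr_gt0 ltr0n ltnW.
pose I : set mR := `[0, n%:R^-1 : R]%classic.
pose box : set V := [set v | forall i, I (v i ord0)].
have mbox : measurable (box : set mV).
  by apply: (@measurable_box _ _ (fun=> I)) => i; exact: measurable_itv.
have le x : (\1_box x : R) <= expsimplex (fun=> 0) (stdsimplex n1 1) x.
  rewrite indicE; have [bx|bx] := boolP (x \in box); last first.
    by apply: restr_ge0 => y; exact: expR_ge0.
  rewrite /expsimplex restrT ?expR0//.
  have xi i : 0 <= x i 0 <= n%:R^-1.
    by have := set_mem bx i; rewrite /I /= in_itv.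
  exists (col_mx (const_mx (1 - \sum_i x i 0)) x).
    move=> i; rewrite mxE; case: (fintype.split i) => j; last by have /andP[] := xi j.
    rewrite mxE subr_ge0 (@le_trans _ _ (\sum_(i < n) n%:R^-1))//.
      by apply: ler_sum => k _; have /andP[] := xi k.
    by rewrite sumr_const card_ord -[_ *+ _]mulr_natl mulfV// pnatr_eq0 -lt0n ltnW.
  apply/homog_eqP; split=> [k|].
    rewrite big_split_ord/= big_ord1 col_mxEu mxE (ord1 k).
    rewrite [X in _ + X](_ : _ = \sum_i x i 0) ?subrK//.
    by apply: eq_bigr => i _; exact: col_mxEd.
  rewrite /stdsimplex mul_row_col mul0mx add0r.
  rewrite (_ : stddiag n1 1 = const_mx 1) ?diag_const_mx ?mul1mx//.
  by apply/rowP => k; rewrite !mxE; case: ifP.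
have LD : LC (expsimplex (fun=> 0) (@stdsimplex R n n1 1)).
  apply: (@LC_exp_simplex _ _ (fun=> 0)) => [x y t _|]; last exact: cst_continuous.
  by rewrite !mulr0 addr0.
have Ibox : intf (\1_box : V -> R) = n%:R^-1 ^+ n.
  rewrite /intf /Rintegral integral_indic// setIT.
  transitivity (fine (\prod_(i < n) lebesgue_measure I)%E).
    congr fine; apply: (@lebesgue_cV_box R n (fun=> I)) => i.
    exact: measurable_itv.
  rewrite (eq_bigr (fun=> (n%:R^-1)%:E)).
    by rewrite prodEFin/= prodr_const card_ord.
  by move=> i _; rewrite /I lebesgue_measure_itv/= lte_fin n0 -EFinB subr0.
apply: (@lt_le_trans _ _ (intf (\1_box : V -> R))).
  by rewrite Ibox exprn_gt0.
apply: le_intf => //; last exact: LC_integrable.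
apply: le_integrable (LC_integrable LD) => //.
  by apply/measurable_EFinP; exact: measurable_indic.
move=> x _; rewrite /= !lee_fin !ger0_norm ?indicE ?ler0n//.
  by have := le x; rewrite indicE.
by apply: restr_ge0 => y; exact: expR_ge0.
Qed.

End IntegralContinuity.

Lemma polar_laplaceE (R : realType) (n : nat) (c1 c2 : R) (f : 'cV[R]_n -> R) : LC_sc f ->
  (fun x => c1 / polar f x + c2 * laplace f x) =
  (fun x => c1 * maxf (tilt x f) + c2 * intf (tilt x f)).
Proof. by move=> /LC_scP Lf; apply/funext => x; rewrite -polarE. Qed.

Theorem theorem1p3 (R : realType) (n : nat) (hn : (3 <= n)%N)
    (Z : ('cV[R]_n -> R) -> ('cV[R]_n -> R)) :
  [/\ hypo_continuous Z,
      SL_contravariant Z,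
      valuation Z,
      forall (f : 'cV[R]_n -> R) (y : 'cV[R]_n), LC_sc f ->
        Z (translate y f) = (fun x => expR (dotv x y) * Z f x)
    & forall (f : 'cV[R]_n -> R) (y : 'cV[R]_n), LC_sc f ->
        Z (fun x => expR (- dotv x y) * f x) = translate y (Z f)]
  <->
  exists c1 c2 : R, forall f : 'cV[R]_n -> R, LC_sc f ->
    Z f = (fun x => c1 / polar f x + c2 * laplace f x).
Proof.
have n0 : (0 < n)%N by exact: leq_trans hn.
have n1 : (1 < n)%N by exact: leq_trans hn.
pose Mv := @maxf_invariant_valuation R n; pose Iv := @intf_invariant_valuation R n.
split=> [/(operator_invariant_valuation n0)[z vz ZE]|[c1 [c2 ZE]]]; last first.
  apply: (invariant_valuation_operator (invariant_valuation_lin c1 c2 Mv Iv)).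
  by move=> f Lf; rewrite ZE// polar_laplaceE.
pose D := expsimplex (fun=> 0) (@stdsimplex R n n1 1).
have ID : 0 < intf D := intf_stdsimplex n1.
(* The linear system for the constants is triangular: at [point0] the maximum is 1 and the integral
   0, while at [D] the integral is positive. *)
pose c1 := z point0; pose c2 := (z D - c1 * maxf D) / intf D.
exists c1, c2 => f Lf; rewrite ZE// polar_laplaceE//; apply/funext => x.
have vz' := invariant_valuation_lin 1 (-1) vz (invariant_valuation_lin c1 c2 Mv Iv).
have Ltf : LC (tilt x f) by apply: LC_tilt; exact/LC_scP.
have mp0 : maxf (@point0 R n) = 1.
  rewrite -(@point0_0 R n); apply: maxfE => y; rewrite point0_0.
  by have [->|y0] := eqVneq y 0; rewrite ?point0_0// point0_neq0.
apply/eqP; rewrite -subr_eq0 -[X in X - _]mul1r -mulN1r; apply/eqP.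
apply: (simple_eq0 (n1 := n1) vz' _ _ Ltf).
  by rewrite mp0 intf_point0// mulr0 addr0 mulr1 mul1r mulN1r subrr.
rewrite -/D /c2 divfK ?gt_eqF//; ring.
Qed.
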